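(* Let $r\geqslant 2$ and $k\geqslant 3$ be fixed integers. Then there exist constants $d_{r,k,\ell}$ ($0\leqslant \ell\leqslant r(k-1)$), depending only on $r,k,\ell$ and computable, such that for every $\varepsilon>0$ and every real $x\geqslant 2$, \[ \sum_{n_1,\dots,n_r\leqslant x}\tau_k(n_1\cdots n_r)=M_{r,k}(x)+O\!\left(x^{r-1+\alpha_k+\varepsilon}\right),\qquad M_{r,k}(x)=x^r\sum_{\ell=0}^{r(k-1)}d_{r,k,\ell}(\log x)^{\ell}, \] where the sum runs over positive integers $n_1,\dots,n_r$ and the implied constant depends on $r,k,\varepsilon$.
   Context: For an integer $k\geqslant 2$, $\tau_k(n)$ denotes the number of ordered $k$-tuples of positive integers whose product is $n$. For $k\geqslant 3$ write $\sum_{n\leqslant x}\tau_k(n)=xP_{k-1}(\log x)+\Delta_k(x)$, where $xP_{k-1}(\log x)$ is the residue of $\zeta^k(s)x^s/s$ at $s=1$ ($P_{k-1}$ a polynomial of degree $k-1$), and $\Delta_k(x)$ is the error term. Define $\alpha_k=\inf\{a:\Delta_k(x)=O(x^{a})\}$; it is known that $0<\alpha_k<1$ (e.g. $\alpha_3\leqslant 43/96$, $\alpha_k\leqslant (3k-4)/(4k)$ for $4\leqslant k\leqslant 8$). *)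

(* Defs.v *)
From Stdlib Require Import Reals.
From Coquelicot Require Import Coquelicot.
From mathcomp Require Import all_boot.

Set Implicit Arguments.
Unset Strict Implicit.
Unset Printing Implicit Defensive.

Local Open Scope R_scope.

(* For n >= 1 every factor of n lies in 0..n, so bounding the entries of the
   tuple loses nothing, and no entry can be 0; tau k 0 is a junk value. *)
Definition tau (k n : nat) : nat :=
  #|[set t : {ffun 'I_k -> 'I_n.+1} | (\prod_(i < k) (t i : nat) == n)%N]|.

Definition nat_floor (x : R) : nat := Z.to_nat (Int_part x).

Definition tau_sum (k : nat) (x : R) : nat :=
  (\sum_(1 <= n < (nat_floor x).+1) tau k n)%N.

(* The summation variable n_i is (n i).+1, which runs over 1..floor x. *)
Definition tau_prod_sum (r k : nat) (x : R) : nat :=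
  (\sum_(n : {ffun 'I_r -> 'I_(nat_floor x)}) tau k (\prod_(i < r) (n i).+1))%N.

(* t^s for real t > 0 and complex s *)
Definition cpow (t : R) (s : C) : C :=
  (RtoC (exp (Re s * ln t)) * (cos (Im s * ln t), sin (Im s * ln t)))%C.

(* zeta(s) = lim_N (sum_{n <= N} n^(-s) - N^(1-s) / (1-s)) for Re s > 0, s <> 1.
   For Re s > 1 the subtracted term tends to 0 and this is the Dirichlet series;
   the limit is locally uniform on Re s > 0, s <> 1, so it is the analytic
   continuation there. The values for Re s <= 0 are not those of zeta.
   The index N below stands for the cut-off N + 1. *)
Definition zeta_approx (s : C) (N : nat) : C :=
  (sum_n (fun n => cpow (INR n.+1) (- s)) N
   - cpow (INR N.+1) (1 - s) / (1 - s))%C.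

Definition zeta (s : C) : C :=
  @lim C_R_CompleteNormedModule (filtermap (zeta_approx s) eventually).

(* Normalised by the factor 1 / (2 i pi); the contour is the positively oriented
   circle |z - z0| = rho. *)
Definition circle_integral (f : C -> C) (z0 : C) (rho : R) : C :=
  (/ (2 * PI * Ci)
   * @RInt C_R_CompleteNormedModule
       (fun th : R =>
          let e := (cos th, sin th) : C in
          (f (z0 + rho * e) * (Ci * rho * e))%C)
       0 (2 * PI))%C.

(* For f holomorphic on a punctured neighbourhood of z0 the integral does not
   depend on rho once rho is small. *)
Definition residue (f : C -> C) (z0 : C) : C :=
  @lim C_R_CompleteNormedModule (filtermap (circle_integral f z0) (at_right 0)).

(* x P_{k-1}(log x); the residue is real for real x > 0. *)
Definition main_term (k : nat) (x : R) : R :=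
  Re (residue (fun s => (zeta s ^ k * cpow x s / s)%C) 1).

Definition Delta_tau (k : nat) (x : R) : R := INR (tau_sum k x) - main_term k x.

Definition Delta_bigO (k : nat) (a : R) : Prop :=
  exists K x0 : R, forall x : R,
    0 < x -> x0 <= x -> Rabs (Delta_tau k x) <= K * Rpower x a.

Definition alpha (k : nat) : R := real (Glb_Rbar (Delta_bigO k)).

(* Total recursive functions: the closure of zero, successor and projections
   under composition, primitive recursion and minimization of functions that
   have a zero in the minimized argument. *)
Inductive recursive : forall n : nat, (n.-tuple nat -> nat) -> Prop :=
| rec_zero n (f : n.-tuple nat -> nat) :
    (forall v, f v = 0%N) -> recursive f
| rec_succ (f : 1.-tuple nat -> nat) :
    (forall v, f v = (thead v).+1) -> recursive f
| rec_proj n (i : 'I_n) (f : n.-tuple nat -> nat) :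
    (forall v, f v = tnth v i) -> recursive f
| rec_comp m n (g : m.-tuple nat -> nat) (h : 'I_m -> n.-tuple nat -> nat)
    (f : n.-tuple nat -> nat) :
    recursive g -> (forall i, recursive (h i)) ->
    (forall v, f v = g [tuple h i v | i < m]) -> recursive f
| rec_prim n (g : n.-tuple nat -> nat) (h : n.+2.-tuple nat -> nat)
    (f : n.+1.-tuple nat -> nat) :
    recursive g -> recursive h ->
    (forall v : n.-tuple nat, f [tuple of 0%N :: v] = g v) ->
    (forall (m : nat) (v : n.-tuple nat),
        f [tuple of m.+1 :: v]
        = h [tuple of m :: f [tuple of m :: v] :: v]) ->
    recursive f
| rec_min n (g : n.+1.-tuple nat -> nat) (f : n.-tuple nat -> nat) :
    recursive g ->
    (forall v, g [tuple of f v :: v] = 0%N) ->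
    (forall (v : n.-tuple nat) (m : nat),
        (m < f v)%N -> g [tuple of m :: v] <> 0%N) ->
    recursive f.

Definition recursive1 (f : nat -> nat) : Prop :=
  recursive (fun v : 1.-tuple nat => f (thead v)).

(* The rationals (p n - q n) / (m n + 1) approximate y within 2^(-n). *)
Definition computable_real (y : R) : Prop :=
  exists p q m : nat -> nat,
    [/\ recursive1 p, recursive1 q, recursive1 m &
        forall n : nat,
          (Rabs (y - (INR (p n) - INR (q n)) / INR (m n).+1) <= / 2 ^ n)].

(* Main.v *)
Require Import Defs.
From HB Require Import structures.
From Stdlib Require Import Reals ZArith Factorial Lra Lia ClassicalEpsilon.
From Coquelicot Require Import Coquelicot.
From mathcomp Require Import all_boot zify.

(** A factorization [n_1 ... n_r = e_1 ... e_k] refines in exactly one way to an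
    [r x k] matrix with row products [n_i] and column products [e_j] whose entries
    satisfy [gcd(m_(i' j), m_(i l)) = 1] for [i < i'], [j < l].  So the sum counts such
    matrices with row products at most [x], and expanding each coprimality condition
    with the Moebius function gives
    [sum_d prod_e mu(d_e) prod_i D_k(x / Lam_i(d))], where [D_k] is the summatory
    function of [tau_k], [d] assigns an integer to every pair of conflicting entries and
    [Lam_i] is a product over the row of least common multiples.  With [R] the lcm of
    all [d_e], [R] divides the product of the [Lam_i] over any [r - 1] rows and [R^2]
    divides the product over all rows; since only [tau(R)^O(1)] families [d] share the same [R],
    [sum_d Lam_(i0)^(-delta) prod_(i <> i0) Lam_i^(-sigma)] converges as soon as
    [sigma + delta > 1].  Inserting [D_k(y) = y P(log y) + O(y^delta)] with
    [alpha_k < delta < 1] gives the asymptotic formula; if [alpha_k >= 1] the trivial bound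
    [D_k(x)^r] suffices with all coefficients [0].

    That the main term of [D_k] is [x] times a polynomial in [log x] only needs
    a Taylor expansion of [(s - 1) zeta(s)] at [1] with remainder [O(|s - 1|^k)] and
    continuity on small circles, because the residue is a limit over shrinking circles.

    The coefficients are computable because of the asymptotic formula itself: at
    [x = 2^n] it approximates a polynomial in [n] with exponentially small error by
    recursive rationals, and interpolation recovers its coefficients. *)

Set Implicit Arguments.
Unset Strict Implicit.
Unset Printing Implicit Defensive.

Local Open Scope nat_scope.

(** * Refining factorizations into matrices *)

(** The obstacle is that coprimality couples different rows, while the hypothesis on [tau_k] treats
    one row at a time; Moebius inversion leaves divisibilities of single entries, and the rows
    become independent. Replacing the factors [D_k(x / Lam_i)] by their main terms one at a time
    leaves one row, of modulus [u], with exponent [delta], and the others, of product [v], with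
    exponent [sigma] close to 1. Then [u^(-delta) v^(-sigma) = (u v)^(-delta) v^(-(sigma - delta))],
    so [u v >= R^2] and [v >= R] give [R^(-(sigma + delta))], and every positive [delta] is
    admissible. The sum over [d] is cut to a box of side [N >= floor x], where the formula is exact;
    the error bound is uniform in [N], and [N] tends to infinity for fixed [x]. Tails need no
    separate estimate, because the bound for [D_k] is first extended to all [y > 0]: below 1 the sum
    is empty and the main term itself is [O(y^delta)]. The truncated main terms converge to a
    polynomial in [log x] because coefficients of bounded degree are fixed combinations of finitely
    many values. *)

Lemma coprime_prodl I (s : seq I) (P : pred I) (F : I -> nat) m :
  coprime (\prod_(i <- s | P i) F i) m = all (fun i => P i ==> coprime (F i) m) s.
Proof.
elim: s => [|x s IH]; first by rewrite big_nil /coprime gcd1n.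
by rewrite big_cons /=; case: (P x) => //=; rewrite coprimeMl IH.
Qed.

Lemma coprime_prod_ordl n (F : nat -> nat) m :
  (forall i, i < n -> coprime (F i) m) -> coprime (\prod_(i < n) F i) m.
Proof.
move=> h; rewrite coprime_prodl; apply/allP => i _ /=.
exact: h.
Qed.

Lemma prod_ord_recl n (F : nat -> nat) :
  \prod_(i < n.+1) F i = F 0 * \prod_(i < n) F i.+1.
Proof. by rewrite big_ord_recl. Qed.

Lemma dvdn_prod_ord n (F : nat -> nat) i : i < n -> F i %| \prod_(j < n) F j.
Proof. by move=> h; rewrite (bigD1 (Ordinal h)) //= dvdn_mulr. Qed.

Lemma prod_ord_gt0 n (F : nat -> nat) : (forall i, i < n -> 0 < F i) -> 0 < \prod_(j < n) F j.
Proof. by move=> h; apply: prodn_cond_gt0 => i _; apply: h. Qed.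

(* Greedy choice [a_0 = gcd(e_0, n)], then recursively for [n / a_0]. *)
Lemma divisor_split k (e : nat -> nat) n :
  (forall j, j < k -> 0 < e j) -> 0 < n -> n %| \prod_(j < k) e j ->
  exists a b : nat -> nat, [/\ forall j, j < k -> e j = a j * b j, \prod_(j < k) a j = n &
    forall j l, j < l < k -> coprime (b j) (a l)].
Proof.
elim: k e n => [|k IH] e n e0 n0.
  rewrite big_ord0 dvdn1 => /eqP ->.
  by exists (fun=> 1), (fun=> 1); split => //; rewrite big_ord0.
rewrite prod_ord_recl => hd.
have e00 := e0 0 isT.
set g := gcdn (e 0) n.
have g0 : 0 < g by rewrite gcdn_gt0 n0 orbT.
have [q hq] := dvdnP (dvdn_gcdl (e 0) n).
have [n' hn'] := dvdnP (dvdn_gcdr (e 0) n).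
rewrite -/g in hq hn'.
have cop : coprime q n'.
  rewrite /coprime -(eqn_pmul2r g0) mul1n muln_gcdl -hq -hn'.
  by rewrite eqxx.
have n'0 : 0 < n' by move: n0; rewrite hn' muln_gt0 => /andP[].
have hd' : n' %| \prod_(j < k) e j.+1.
  move: hd; rewrite hq [X in X %| _]hn' -mulnA [g * _]mulnC mulnA dvdn_pmul2r //.
  by rewrite Gauss_dvdr // coprime_sym.
have [a [b [h1 h2 h3]]] := IH (fun j => e j.+1) n' (fun j hj => e0 j.+1 hj) n'0 hd'.
exists (fun j => if j is j'.+1 then a j' else g), (fun j => if j is j'.+1 then b j' else q); split.
- by case=> [_|j hj]; [rewrite hq mulnC|apply: h1].
- by rewrite (prod_ord_recl k (fun j => if j is j'.+1 then a j' else g)) h2 mulnC -hn'.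
- case=> [|j] [|l] // hl; last exact: h3.
  by apply: coprime_dvdr cop; rewrite -h2 dvdn_prod_ord.
Qed.

(** Since [b 0] is coprime to every later [a l], the gcd of [e 0 = a 0 * b 0] with the total product
    is [a 0] itself. The first factor is thus forced, and cancelling it leaves the same situation
    with one index less. *)
Lemma divisor_split_unique k (e a b a' b' : nat -> nat) :
  (forall j, j < k -> 0 < e j) ->
  (forall j, j < k -> e j = a j * b j) -> (forall j, j < k -> e j = a' j * b' j) ->
  \prod_(j < k) a j = \prod_(j < k) a' j ->
  (forall j l, j < l < k -> coprime (b j) (a l)) ->
  (forall j l, j < l < k -> coprime (b' j) (a' l)) ->
  forall j, j < k -> a j = a' j.
Proof.
elim: k e a b a' b' => [|k IH] e a b a' b' e0 h1 h1' h2 h3 h3' //.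
have first_gcd (c d : nat -> nat) : (forall j, j < k.+1 -> e j = c j * d j) ->
    (forall j l, j < l < k.+1 -> coprime (d j) (c l)) -> c 0 = gcdn (e 0) (\prod_(j < k.+1) c j).
  move=> f1 f2; rewrite prod_ord_recl f1 // -muln_gcdr.
  have : coprime (d 0) (\prod_(i < k) c i.+1).
    by rewrite coprime_sym; apply: (coprime_prod_ordl (F := fun i => c i.+1)) => i hi; rewrite coprime_sym; apply: f2.
  by rewrite /coprime => /eqP ->; rewrite muln1.
have a00 : a 0 = a' 0 by rewrite (first_gcd a b) // (first_gcd a' b') // h2.
case=> [|j] // hj.
apply: (IH (fun j => e j.+1) (fun j => a j.+1) (fun j => b j.+1) (fun j => a' j.+1) (fun j => b' j.+1)) => //.
- by move=> i hi; apply: e0.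
- by move=> i hi; apply: h1.
- by move=> i hi; apply: h1'.
- have a0 : 0 < a 0 by have := e0 0 isT; rewrite h1 // muln_gt0 => /andP[].
  by move: h2; rewrite !prod_ord_recl -a00 => /eqP; rewrite eqn_pmul2l // => /eqP.
- by move=> i l hl; apply: h3.
- by move=> i l hl; apply: h3'.
Qed.

(** The first entry of a pair lies strictly below and to the left of the second. This is what greedy
    splitting leaves behind: whatever lower rows take from column [j] is coprime to what row [i]
    takes from a later column [l]. *)
Definition staircase_coprime (r k : nat) (m : nat -> nat -> nat) :=
  forall i i' j l, i < i' < r -> j < l < k -> coprime (m i' j) (m i l).

(** Rows are split off one at a time: row 0 takes the factors [a] of [divisor_split], and the
    cofactors [b] are the column products of the rows below. Coprimality of [b j] passes to the
    lower entries, which divide it. *)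
Lemma refinement r k (e n : nat -> nat) :
  (forall j, j < k -> 0 < e j) -> (forall i, i < r -> 0 < n i) ->
  \prod_(j < k) e j = \prod_(i < r) n i ->
  exists m : nat -> nat -> nat,
    [/\ forall i, i < r -> \prod_(j < k) m i j = n i,
        forall j, j < k -> \prod_(i < r) m i j = e j &
        staircase_coprime r k m].
Proof.
elim: r e n => [|r IH] e n e0 n0 he.
  exists (fun _ _ => 1); split => // j hj.
  rewrite big_ord0; apply/esym/eqP; rewrite -dvdn1.
  by move: he; rewrite big_ord0 => <-; apply: dvdn_prod_ord.
have n00 := n0 0 isT.
have hd : n 0 %| \prod_(j < k) e j by rewrite he; apply: dvdn_prod_ord.
have [a [b [h1 h2 h3]]] := divisor_split e0 n00 hd.
have b0 j : j < k -> 0 < b j by move=> hj; have := e0 j hj; rewrite h1 // muln_gt0 => /andP[].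
have hb : \prod_(j < k) b j = \prod_(i < r) n i.+1.
  apply/eqP; rewrite -(eqn_pmul2l n00) -prod_ord_recl -he -h2 -big_split /=; apply/eqP.
  by apply: eq_bigr => j _; rewrite h1.
have [m [m1 m2 m3]] := IH b (fun i => n i.+1) b0 (fun i hi => n0 i.+1 hi) hb.
exists (fun i j => if i is i'.+1 then m i' j else a j); split.
- by case=> [|i] hi //; apply: m1.
- by move=> j hj; rewrite (prod_ord_recl r (fun i => if i is i'.+1 then m i' j else a j)) m2 // h1.
- move=> [|i] [|i'] // j l hi hl; last exact: m3.
  apply: coprime_dvdl (h3 j l hl); rewrite -m2; last lia.
  by apply: (@dvdn_prod_ord _ (fun i => m i j)).
Qed.

(** Row 0 is determined by [divisor_split_unique], with the products of the remaining rows as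
    cofactors; it can then be cancelled from every column. *)
Lemma refinement_unique r k (m m' : nat -> nat -> nat) :
  (forall i j, i < r -> j < k -> 0 < m i j) ->
  (forall i, i < r -> \prod_(j < k) m i j = \prod_(j < k) m' i j) ->
  (forall j, j < k -> \prod_(i < r) m i j = \prod_(i < r) m' i j) ->
  staircase_coprime r k m -> staircase_coprime r k m' ->
  forall i j, i < r -> j < k -> m i j = m' i j.
Proof.
elim: r m m' => [|r IH] m m' m0 hr hc v v' //.
have E j : j < k -> m 0 j = m' 0 j.
  apply: (@divisor_split_unique k (fun j => \prod_(i < r.+1) m i j) _ (fun j => \prod_(i < r) m i.+1 j) _ (fun j => \prod_(i < r) m' i.+1 j)).
  - by move=> l hl; apply: (prod_ord_gt0 (F := fun i => m i l)) => i hi; apply: m0.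
  - by move=> l hl; rewrite (prod_ord_recl r (fun i => m i l)).
  - by move=> l hl; rewrite hc // (prod_ord_recl r (fun i => m' i l)).
  - exact: hr.
  - by move=> i l hl; apply: (coprime_prod_ordl (F := fun p => m p.+1 i)) => p hp; apply: v.
  - by move=> i l hl; apply: (coprime_prod_ordl (F := fun p => m' p.+1 i)) => p hp; apply: v'.
case=> [|i] j hi hj; first exact: E.
apply: (IH (fun i => m i.+1) (fun i => m' i.+1)) => //.
- by move=> p q hp hq; apply: m0.
- by move=> p hp; apply: hr.
- move=> l hl; have := hc l hl.
  rewrite (prod_ord_recl r (fun i => m i l)) (prod_ord_recl r (fun i => m' i l)) -E // => /eqP.
  by rewrite eqn_pmul2l ?m0 // => /eqP.
- by move=> p p' q l hp hl; apply: v.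
- by move=> p p' q l hp hl; apply: v'.
Qed.

(** Bridges families indexed by ordinals, which can be counted, and functions on [nat], which can be
    shifted in the inductions above. The default [1] is neutral for products. *)
Definition ext_ord k (f : 'I_k -> nat) (j : nat) : nat := oapp f 1 (insub j).

Lemma ext_ordE k (f : 'I_k -> nat) (j : 'I_k) : ext_ord f j = f j.
Proof. by rewrite /ext_ord valK. Qed.

Lemma ext_ordP k (f : 'I_k -> nat) j (h : j < k) : ext_ord f j = f (Ordinal h).
Proof. by rewrite -(ext_ordE f (Ordinal h)). Qed.

Lemma prod_ext_ord k (f : 'I_k -> nat) : \prod_(j < k) ext_ord f j = \prod_(j < k) f j.
Proof. by apply: eq_bigr => j _; rewrite ext_ordE. Qed.

Lemma dvdn_prod_I (I : finType) (F : I -> nat) i : F i %| \prod_j F j.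
Proof. by rewrite (bigD1 i) //= dvdn_mulr. Qed.

(** * Counting matrices with bounded row products *)

Section Matrices.
Variables r k X : nat.

(** An entry [c] stands for the integer [c.+1], so entries run over [1..X] and zero never occurs. *)
Definition nat_mat := {ffun 'I_r -> {ffun 'I_k -> 'I_X}}.

Definition mat_coprime (m : nat_mat) :=
  [forall i : 'I_r, forall i' : 'I_r, forall j : 'I_k, forall l : 'I_k,
    (i < i') && (j < l) ==> coprime (m i' j).+1 (m i l).+1].

(** The bijection sends a matrix to its column products: [refinement_unique] makes it injective,
    [refinement] surjective. Entries fit into [1..X] because they divide the row products, which are
    at most [X]. *)
Lemma tau_mat (n : {ffun 'I_r -> 'I_X}) :
  tau k (\prod_(i < r) (n i).+1) =
  #|[set m : nat_mat | mat_coprime m & [forall i, \prod_(j < k) (m i j).+1 == (n i).+1]]|.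
Proof.
set N := \prod_(i < r) _.
have N0 : 0 < N by apply: prodn_cond_gt0.
set A := [set m | _ & _].
pose xm (m : nat_mat) := fun i j => ext_ord (fun i0 => ext_ord (fun j0 => (m i0 j0).+1) j) i.
have xmE (m : nat_mat) (i : 'I_r) (j : 'I_k) : xm m i j = (m i j).+1.
  by rewrite /xm !ext_ordE.
have xmP (m : nat_mat) i j (hi : i < r) (hj : j < k) : xm m i j = (m (Ordinal hi) (Ordinal hj)).+1.
  by rewrite -xmE.
have cs (m : nat_mat) : mat_coprime m -> staircase_coprime r k (xm m).
  move=> /forallP h i i' j l hi hj.
  have hi' : i' < r by lia.
  have hi0 : i < r by lia.
  have hl : l < k by lia.
  have hj0 : j < k by lia.
  rewrite (xmP _ _ _ hi' hj0) (xmP _ _ _ hi0 hl).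
  have /forallP/(_ (Ordinal hi'))/forallP/(_ (Ordinal hj0))/forallP/(_ (Ordinal hl)) := h (Ordinal hi0).
  by move/implyP; apply; rewrite /=; lia.
have rows (m : nat_mat) (i : 'I_r) : \prod_(j < k) xm m i j = \prod_(j < k) (m i j).+1.
  by apply: eq_bigr => j _; rewrite xmE.
have cols (m : nat_mat) (j : 'I_k) : \prod_(i < r) xm m i j = \prod_(i < r) (m i j).+1.
  by apply: eq_bigr => i _; rewrite xmE.
(* On [A] the column products divide [N], so [inord] keeps their values. *)
pose phi (m : nat_mat) : {ffun 'I_k -> 'I_N.+1} := [ffun j => inord (\prod_(i < r) (m i j).+1)].
have phiE (m : nat_mat) (j : 'I_k) : m \in A -> phi m j = \prod_(i < r) (m i j).+1 :> nat.
  rewrite inE => /andP[_ /forallP h].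
  rewrite ffunE inordK // ltnS; apply: dvdn_leq => //.
  rewrite /N -(eq_bigr _ (fun i _ => eqP (h i))) exchange_big /=.
  exact: (dvdn_prod_I (fun j => \prod_(i < r) (m i j).+1)).
rewrite /tau -[RHS](@card_in_imset _ _ phi); last first.
  move=> m m' hm hm' e.
  have := hm; have := hm'; rewrite !inE => /andP[c' /forallP h'] /andP[c /forallP h].
  apply/ffunP => i; apply/ffunP => j; apply: val_inj; apply: succn_inj => /=.
  rewrite -!xmE; apply: (@refinement_unique r k) => //.
  - by move=> p q hp hq; rewrite (xmP _ _ _ hp hq).
  - move=> p hp; have -> : p = Ordinal hp by [].
    by rewrite !rows (eqP (h _)) (eqP (h' _)).
  - move=> p hp; have -> : p = Ordinal hp by [].
    by rewrite !cols -!phiE // e.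
  - exact: cs.
  - exact: cs.
congr #|pred_of_set _|; apply/setP => t; rewrite inE; apply/eqP/imsetP; last first.
  move=> [m hm ->]; rewrite (eq_bigr _ (fun j _ => phiE m j hm)) exchange_big /=.
  move: hm; rewrite inE => /andP[_ /forallP h].
  by apply: eq_bigr => i _; apply/eqP.
move=> ht.
have t0 (j : 'I_k) : 0 < t j.
  have : 0 < \prod_j t j by rewrite ht.
  by rewrite (bigD1 j) //= muln_gt0 => /andP[].
have e0 j : j < k -> 0 < ext_ord (fun j : 'I_k => t j : nat) j.
  by move=> hj; rewrite (ext_ordP _ hj).
have n0 i : i < r -> 0 < ext_ord (fun i : 'I_r => (n i).+1) i.
  by move=> hi; rewrite (ext_ordP _ hi).
have [|m [m1 m2 m3]] := @refinement r k _ _ e0 n0; first by rewrite !prod_ext_ord.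
have r1 (i : 'I_r) : \prod_(j < k) m i j = (n i).+1 by rewrite m1 // ext_ordE.
have mp (i : 'I_r) (j : 'I_k) : 0 < m i j <= X.
  have d : m i j %| (n i).+1 by rewrite -r1; apply: (dvdn_prod_I (fun j : 'I_k => m i j)).
  rewrite (dvdn_gt0 _ d) //=; apply: leq_trans (dvdn_leq _ d) _ => //.
have X0 (i : 'I_r) (j : 'I_k) : (m i j).-1 < X by have := mp i j; lia.
pose M : nat_mat := [ffun i => [ffun j => Ordinal (X0 i j)]].
have ME i j : (M i j).+1 = m i j by rewrite !ffunE /=; have := mp i j; lia.
have MA : M \in A.
  rewrite inE; apply/andP; split.
    apply/forallP => i; apply/forallP => i'; apply/forallP => j; apply/forallP => l.
    apply/implyP => /andP[h1 h2]; rewrite !ME; apply: m3; rewrite ?h1 ?h2 /=; exact: ltn_ord.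
  by apply/forallP => i; apply/eqP; rewrite -r1; apply: eq_bigr => j _; rewrite ME.
exists M => //; apply/ffunP => j; apply: val_inj => /=.
rewrite phiE // -[LHS](ext_ordE (fun j : 'I_k => t j : nat)) -m2 //.
by apply: eq_bigr => i _; rewrite ME.
Qed.

Lemma sum_ord_eqS (a : nat) : 0 < a -> \sum_(c < X) (a == c.+1) = (a <= X).
Proof.
case: a => // a _; rewrite -(big_mkord xpredT (fun c => (a.+1 == c.+1 : nat))).
elim: X => [|Y IH]; first by rewrite big_nil.
by rewrite big_nat_recr //= IH; lia.
Qed.

Lemma sum_tau_mat :
  \sum_(n : {ffun 'I_r -> 'I_X}) tau k (\prod_(i < r) (n i).+1) =
  #|[set m : nat_mat | mat_coprime m & [forall i, \prod_(j < k) (m i j).+1 <= X]]|.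
Proof.
have cardE (T : finType) (P Q : pred T) : #|[set m | P m & Q m]| = \sum_m P m * Q m.
  rewrite -sum1_card big_mkcond /=; apply: eq_bigr => m _.
  by rewrite inE; case: (P m); case: (Q m).
rewrite (eq_bigr _ (fun n _ => tau_mat n)).
under eq_bigr do rewrite cardE.
rewrite cardE exchange_big /=; apply: eq_bigr => m _.
rewrite -big_distrr /=; congr (_ * _).
have allE (P : pred 'I_r) : nat_of_bool [forall i, P i] = \prod_(i < r) P i.
  case: forallP => h; first by rewrite big1 // => i _; rewrite h.
  apply/esym/eqP; rewrite -leqn0 leqNgt; apply/negP => h'; apply: h => i.
  by move: h'; rewrite (bigD1 i) //= muln_gt0; case: (P i).
under eq_bigr do rewrite allE.
(* For a fixed matrix the sum over [n] factors over the rows, and each factor counts the only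
   possible value of [n_i]. *)
rewrite allE -(bigA_distr_bigA (fun i c => nat_of_bool (\prod_(j < k) (m i j).+1 == (c : 'I_X).+1))) /=.
apply: eq_bigr => i _; rewrite sum_ord_eqS //.
by apply: prodn_cond_gt0.
Qed.

End Matrices.

(** [tau] lets factors range over [0..n]; counting needs them shifted by one and in a range common
    to all [n <= X]. Nothing is lost, as the factors of a positive [n] lie in [1..n]. *)
Lemma tau_shift k X n : 0 < n <= X ->
  tau k n = #|[set t : {ffun 'I_k -> 'I_X} | \prod_(j < k) (t j).+1 == n]|.
Proof.
case: X => [|X]; first lia.
move=> /andP[n0 nX]; rewrite /tau.
set A := [set t : {ffun 'I_k -> 'I_X.+1} | _].
have le (t : {ffun 'I_k -> 'I_X.+1}) j : t \in A -> (t j).+1 <= n.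
  rewrite inE => /eqP h; apply: dvdn_leq => //; rewrite -h.
  exact: (dvdn_prod_I (fun j => (t j).+1)).
pose phi (t : {ffun 'I_k -> 'I_X.+1}) : {ffun 'I_k -> 'I_n.+1} := [ffun j => inord (t j).+1].
have phiE t j : t \in A -> phi t j = (t j).+1 :> nat by move=> h; rewrite ffunE inordK // ltnS le.
rewrite -[RHS](@card_in_imset _ _ phi); last first.
  move=> t t' h h' e; apply/ffunP => j; apply: val_inj; apply: succn_inj => /=.
  by rewrite -!phiE // e.
congr #|pred_of_set _|; apply/setP => t; rewrite inE; apply/eqP/imsetP; last first.
  move=> [u hu ->]; rewrite (eq_bigr _ (fun j _ => phiE u j hu)).
  by move: hu; rewrite inE => /eqP.
move=> ht.
have tn (j : 'I_k) : 0 < t j <= n.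
  have d : t j %| n by rewrite -[X in _ %| X]ht; apply: (dvdn_prod_I (fun j => t j : nat)).
  by rewrite (dvdn_gt0 n0 d) dvdn_leq.
pose u : {ffun 'I_k -> 'I_X.+1} := [ffun j => inord (t j).-1].
have uE j : (u j).+1 = t j by rewrite ffunE inordK; have := tn j; lia.
have uA : u \in A by rewrite inE -[X in _ == X]ht; apply/eqP; apply: eq_bigr => j _; rewrite uE.
exists u => //; apply/ffunP => j; apply: val_inj => /=; by rewrite phiE // uE.
Qed.

Lemma sum_tau_shift k X Y : Y <= X ->
  \sum_(1 <= n < Y.+1) tau k n = #|[set t : {ffun 'I_k -> 'I_X} | \prod_(j < k) (t j).+1 <= Y]|.
Proof.
move=> hY.
have -> : \sum_(1 <= n < Y.+1) tau k n = \sum_(n < Y) \sum_(t : {ffun 'I_k -> 'I_X}) (\prod_(j < k) (t j).+1 == n.+1).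
  rewrite big_add1 /= big_mkord; apply: eq_bigr => n _.
  rewrite (@tau_shift k X); last by have := ltn_ord n; lia.
  by rewrite -sum1_card big_mkcond /=; apply: eq_bigr => t _; rewrite inE; case: eqP.
rewrite exchange_big /= -sum1_card [RHS]big_mkcond /=; apply: eq_bigr => t _.
rewrite inE sum_ord_eqS; last exact: prodn_cond_gt0.
by case: leqP.
Qed.

(** Writing component [j] as [L j] times a new component turns the bound [X] on the product into its
    integer quotient by the product of the [L j]. *)
Lemma card_divisible_tuples k X (L : 'I_k -> nat) : (forall j, 0 < L j) ->
  #|[set t : {ffun 'I_k -> 'I_X} | [forall j, L j %| (t j).+1] & \prod_(j < k) (t j).+1 <= X]| =
  \sum_(1 <= n < (X %/ \prod_(j < k) L j).+1) tau k n.
Proof.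
move=> L0; rewrite (@sum_tau_shift k X); last exact: leq_div.
have P0 : 0 < \prod_(j < k) L j by apply: prodn_cond_gt0.
set A := [set t | _ & _]; set B := [set t | _].
have inB (t : {ffun 'I_k -> 'I_X}) : (t \in B) = (\prod_(j < k) (L j * (t j).+1) <= X).
  by rewrite inE leq_divRL // big_split /= mulnC.
have lt (t : {ffun 'I_k -> 'I_X}) j : t \in B -> (L j * (t j).+1).-1 < X.
  rewrite inB => h.
  have d := dvdn_prod_I (fun j => L j * (t j).+1) j.
  have p : 0 < L j * (t j).+1 by rewrite muln_gt0 L0.
  have p2 : 0 < \prod_(j < k) (L j * (t j).+1) by apply: prodn_cond_gt0 => i _; rewrite muln_gt0 L0.
  have dl : L j * (t j).+1 <= \prod_(j < k) (L j * (t j).+1) := dvdn_leq p2 d.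
  by rewrite prednK // (leq_trans dl).
(* The default of [odflt] is never reached on [B], where every scaled component is at most [X]. *)
pose phi (t : {ffun 'I_k -> 'I_X}) : {ffun 'I_k -> 'I_X} := [ffun j => odflt (t j) (insub (L j * (t j).+1).-1)].
have phiE t j : t \in B -> (phi t j).+1 = L j * (t j).+1.
  move=> h; rewrite ffunE (insubT (fun i => i < X) (lt t j h)) /=.
  by rewrite prednK // muln_gt0 L0.
rewrite -[RHS](@card_in_imset _ _ phi); last first.
  move=> t t' h h' e; apply/ffunP => j; apply: val_inj; apply: succn_inj => /=.
  by apply/eqP; rewrite -(eqn_pmul2l (L0 j)) -!phiE // e.
congr #|pred_of_set _|; apply/setP => t; rewrite inE; apply/andP/imsetP; last first.
  move=> [u hu ->]; split; first by apply/forallP => j; rewrite phiE // dvdn_mulr.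
  by rewrite (eq_bigr _ (fun j _ => phiE u j hu)) -inB.
move=> [/forallP hd hle].
have lt2 j : ((t j).+1 %/ L j).-1 < X.
  have := leq_div (t j).+1 (L j); have := ltn_ord (t j); lia.
pose u : {ffun 'I_k -> 'I_X} := [ffun j => Ordinal (lt2 j)].
have uE j : L j * (u j).+1 = (t j).+1.
  rewrite ffunE /= prednK; first by rewrite mulnC divnK.
  by rewrite divn_gt0 // dvdn_leq.
have uB : u \in B by rewrite inB (eq_bigr _ (fun j _ => uE j)).
exists u => //; apply/ffunP => j; apply: val_inj; apply: succn_inj => /=.
by rewrite phiE // uE.
Qed.

(** * Recursive functions *)

(* Functions of an environment: variable [i] is [nth 0 s i]. *)
Definition recs (n : nat) (F : seq nat -> nat) := recursive (fun v : n.-tuple nat => F v).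

Lemma recs_subst p n H (h : nat -> seq nat -> nat) :
  recs p H -> (forall i, i < p -> recs n (h i)) ->
  recs n (fun s => H (mkseq (fun i => h i s) p)).
Proof.
move=> hH hh; apply: (rec_comp (h := fun (i : 'I_p) (v : n.-tuple nat) => h i v) hH).
  by move=> i; apply: hh.
move=> v; congr H; apply: (@eq_from_nth _ 0); rewrite ?size_tuple ?size_mkseq // => i hi.
rewrite nth_mkseq // -[RHS](tnth_nth 0 _ (Ordinal hi)).
by rewrite tnth_mktuple.
Qed.

Lemma recs_var n i : i < n -> recs n (fun s => nth 0 s i).
Proof. by move=> h; apply: (rec_proj (i := Ordinal h)) => v; rewrite (tnth_nth 0). Qed.

(** [rec_comp] asks only for a pointwise equation, so composing with all projections takes the place
    of function extensionality. *)
Lemma recs_ext n F G : (forall s, size s = n -> F s = G s) -> recs n F -> recs n G.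
Proof.
move=> e h; apply: (rec_comp (h := fun (i : 'I_n) (v : n.-tuple nat) => tnth v i) h).
  by move=> i; apply: (rec_proj (i := i)).
move=> v; rewrite -e ?size_tuple //; congr F.
by congr tval; apply: eq_from_tnth => i; rewrite tnth_mktuple.
Qed.

Lemma recs_comp1 (u : nat -> nat) n F :
  recs 1 (fun s => u (nth 0 s 0)) -> recs n F -> recs n (fun s => u (F s)).
Proof. by move=> hu hF; apply: (recs_subst (h := fun=> F) hu). Qed.

Lemma recs_comp2 (u : nat -> nat -> nat) n F G :
  recs 2 (fun s => u (nth 0 s 0) (nth 0 s 1)) -> recs n F -> recs n G ->
  recs n (fun s => u (F s) (G s)).
Proof.
move=> hu hF hG; apply: (recs_subst (h := fun i => if i is 0 then F else G) hu).
by case.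
Qed.

(** Recursion schemes push an index and an accumulator onto the environment; this forgets the first
    [j] variables and puts one computed value in front. *)
Lemma recs_consdrop j n H Cf : recs n.+1 H -> recs (j + n) Cf ->
  recs (j + n) (fun s => H (Cf s :: drop j s)).
Proof.
move=> hH hC.
have := @recs_subst n.+1 (j + n) H (fun i => if i is i'.+1 then fun s => nth 0 s (j + i') else Cf) hH.
have hv i : i < n.+1 -> recs (j + n) (if i is i'.+1 then fun s => nth 0 s (j + i') else Cf).
  by case: i => [|i] // hi; apply: recs_var; lia.
move=> /(_ hv); apply: recs_ext => s hs; congr H.
apply: (@eq_from_nth _ 0); first by rewrite size_mkseq /= size_drop hs; lia.
move=> i; rewrite size_mkseq => hi; rewrite nth_mkseq //.
by case: i hi => [|i] hi //=; rewrite nth_drop.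
Qed.

Lemma recs_const n c : recs n (fun=> c).
Proof.
elim: c => [|c IH]; first exact: rec_zero.
by apply: (@recs_comp1 succn) IH; apply: rec_succ => v; rewrite /thead (tnth_nth 0).
Qed.

Lemma recs_succ n F : recs n F -> recs n (fun s => (F s).+1).
Proof. by apply: recs_comp1; apply: rec_succ => v; rewrite /thead (tnth_nth 0). Qed.

Lemma recs_prim n g h F : recs n g -> recs n.+2 h ->
  (forall s, F (0 :: s) = g s) -> (forall m s, F (m.+1 :: s) = h [:: m, F (m :: s) & s]) ->
  recs n.+1 F.
Proof.
move=> hg hh h0 hS; apply: (rec_prim hg hh) => [v|m v]; first exact: h0.
exact: hS.
Qed.

Lemma recs_add n F G : recs n F -> recs n G -> recs n (fun s => F s + G s).
Proof.
apply: (@recs_comp2 addn).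
apply: (@recs_prim 1 (fun s => nth 0 s 0) (fun s => (nth 0 s 1).+1)) => //.
  exact: recs_var.
by apply: recs_succ; apply: recs_var.
Qed.

Lemma recs_mul n F G : recs n F -> recs n G -> recs n (fun s => F s * G s).
Proof.
apply: (@recs_comp2 muln).
apply: (@recs_prim 1 (fun=> 0) (fun s => nth 0 s 2 + nth 0 s 1)) => //.
- exact: recs_const.
- by apply: recs_add; apply: recs_var.
Qed.

Lemma recs_pred n F : recs n F -> recs n (fun s => (F s).-1).
Proof.
apply: (@recs_comp1 predn).
apply: (@recs_prim 0 (fun=> 0) (fun s => nth 0 s 0)) => //; first exact: recs_const.
exact: recs_var.
Qed.

Lemma recs_sub n F G : recs n F -> recs n G -> recs n (fun s => F s - G s).
Proof.
(* Primitive recursion runs over the first variable, while truncated subtraction recurses on its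
   second argument; hence the swap. *)
move=> hF hG; apply: (@recs_comp2 (fun a b => b - a) n G F) => //.
apply: (@recs_prim 1 (fun s => nth 0 s 0) (fun s => (nth 0 s 1).-1)) => //.
- exact: recs_var.
- by apply: recs_pred; apply: recs_var.
- by move=> s /=; rewrite subn0.
- by move=> m s /=; rewrite subnS.
Qed.

Lemma recs_leq n F G : recs n F -> recs n G -> recs n (fun s => (F s <= G s : nat)).
Proof.
move=> hF hG; apply: (@recs_ext _ (fun s => 1 - (F s - G s))).
  by move=> s _; rewrite /leq; case: (F s - G s).
by apply: recs_sub; [exact: recs_const|exact: recs_sub].
Qed.

Lemma recs_eq n F G : recs n F -> recs n G -> recs n (fun s => (F s == G s : nat)).
Proof.
move=> hF hG; apply: (@recs_ext _ (fun s => (F s <= G s) * (G s <= F s))).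
  by move=> s _; rewrite eqn_leq mulnb.
by apply: recs_mul; apply: recs_leq.
Qed.

Lemma recs_exp2 n F : recs n F -> recs n (fun s => 2 ^ F s).
Proof.
apply: (@recs_comp1 (expn 2)).
apply: (@recs_prim 0 (fun=> 1) (fun s => 2 * nth 0 s 1)) => //; first exact: recs_const.
  by apply: recs_mul; [exact: recs_const|exact: recs_var].
by move=> m s; rewrite /= expnS.
Qed.

Lemma recs_expc n F l : recs n F -> recs n (fun s => F s ^ l).
Proof.
move=> hF; elim: l => [|l IH]; first exact: recs_const.
by apply: (@recs_ext _ (fun s => F s * F s ^ l)); [move=> s _; rewrite expnS|apply: recs_mul].
Qed.

(** Primitive recursion on the bound, which is kept as an extra first variable and only afterwards
    set to [B s]. *)
Lemma recs_bsum n B F : recs n B -> recs n.+1 F ->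
  recs n (fun s => \sum_(i < B s) F ((i : nat) :: s)).
Proof.
move=> hB hF.
have hS : recs n.+1 (fun s => \sum_(i < nth 0 s 0) F ((i : nat) :: behead s)).
  apply: (@recs_prim n (fun=> 0) (fun s => nth 0 s 1 + F (nth 0 s 0 :: drop 2 s))).
  - exact: recs_const.
  - by apply: recs_add; [exact: recs_var|apply: (@recs_consdrop 2) => //; exact: recs_var].
  - by move=> s /=; rewrite big_ord0.
  - by move=> m s; rewrite /= drop0 big_ord_recr.
have := @recs_consdrop 0 n _ _ hS hB; apply: recs_ext => s _ /=.
by rewrite drop0.
Qed.

Lemma recs_behead n F : recs n F -> recs n.+1 (fun s => F (behead s)).
Proof.
move=> hF.
have := @recs_subst n n.+1 F (fun i s => nth 0 s i.+1) hF.
have hv i : i < n -> recs n.+1 (fun s => nth 0 s i.+1) by move=> hi; apply: recs_var.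
move=> /(_ hv); apply: recs_ext => s hs; congr F.
apply: (@eq_from_nth _ 0); first by rewrite size_mkseq size_behead hs.
by move=> i; rewrite size_mkseq => hi; rewrite nth_mkseq // nth_behead.
Qed.

(** A sum over tuples as [r] nested bounded sums carrying the running product [c]; in this form
    recursiveness follows by induction on [r]. *)
Fixpoint nsum (r X : nat) (F : nat -> nat) (c : nat) : nat :=
  if r is r'.+1 then \sum_(a < X) nsum r' X F (c * a.+1) else F c.

Lemma recs_nsum n r X F : recs n X -> recs n.+1 F ->
  recs n.+1 (fun s => nsum r (X (behead s)) (fun P => F (P :: behead s)) (nth 0 s 0)).
Proof.
move=> hX hF.
have hXb := recs_behead hX.
elim: r => [|r IH].
  by apply: recs_ext hF => -[|x s] //= _.
have h : recs n.+2 (fun s => nsum r (X (drop 2 s)) (fun P => F (P :: drop 2 s)) (nth 0 s 1 * (nth 0 s 0).+1)).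
  apply: (@recs_consdrop 2 n _ (fun s => nth 0 s 1 * (nth 0 s 0).+1) IH).
  by apply: recs_mul; [exact: recs_var|apply: recs_succ; exact: recs_var].
have := recs_bsum hXb h; apply: recs_ext => -[|x s] //= _.
by rewrite drop0.
Qed.

Lemma sum_ffun_recl r X (G : {ffun 'I_r.+1 -> 'I_X} -> nat) :
  \sum_(f : {ffun 'I_r.+1 -> 'I_X}) G f =
  \sum_(a < X) \sum_(f : {ffun 'I_r -> 'I_X}) G [ffun i => oapp f a (unlift ord0 i)].
Proof.
rewrite pair_big /=.
pose h (p : 'I_X * {ffun 'I_r -> 'I_X}) : {ffun 'I_r.+1 -> 'I_X} := [ffun i => oapp p.2 p.1 (unlift ord0 i)].
pose h' (f : {ffun 'I_r.+1 -> 'I_X}) : 'I_X * {ffun 'I_r -> 'I_X} := (f ord0, [ffun i => f (lift ord0 i)]).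
rewrite (reindex h); first by apply: eq_bigr => -[a f] _.
exists h' => [[a f] _|f _].
  rewrite /h' /h ffunE unlift_none /=; congr pair; apply/ffunP => i.
  by rewrite !ffunE liftK.
apply/ffunP => i; rewrite !ffunE /=; case: unliftP => [j ->|->] /=; by rewrite ?ffunE.
Qed.

Lemma nsum_ffun r X F c :
  nsum r X F c = \sum_(f : {ffun 'I_r -> 'I_X}) F (c * \prod_(i < r) (f i).+1).
Proof.
elim: r c => [|r IH] c /=.
  rewrite (eq_bigr (fun=> F c)); last by move=> f _; rewrite big_ord0 muln1.
  by rewrite sum_nat_const card_ffun !card_ord expn0 mul1n.
rewrite sum_ffun_recl; apply: eq_bigr => a _; rewrite IH; apply: eq_bigr => f _.
congr F; rewrite big_ord_recl !ffunE unlift_none /= mulnA; congr (_ * _).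
by apply: eq_bigr => i _; rewrite ffunE liftK.
Qed.

Lemma tau_nsum k n : 0 < n -> tau k n = nsum k n (fun P => (P == n : nat)) 1.
Proof.
move=> n0; rewrite (@tau_shift k n) ?n0 ?leqnn // nsum_ffun.
rewrite -sum1_card big_mkcond /=; apply: eq_bigr => t _; rewrite inE mul1n.
by case: eqP.
Qed.

Definition tau_box (r k X : nat) : nat :=
  \sum_(n : {ffun 'I_r -> 'I_X}) tau k (\prod_(i < r) (n i).+1).

Lemma nsum_eq r X F G c : 0 < c -> (forall n, 0 < n -> F n = G n) -> nsum r X F c = nsum r X G c.
Proof.
move=> c0 h; elim: r c c0 => [|r IH] c c0 /=; first exact: h.
by apply: eq_bigr => a _; apply: IH; rewrite muln_gt0 c0.
Qed.

Lemma tau_box_nsum r k X :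
  tau_box r k X = nsum r X (fun n => nsum k n (fun P => (P == n : nat)) 1) 1.
Proof.
rewrite (@nsum_eq _ _ _ (tau k)) // => [|n n0]; last by rewrite tau_nsum.
by rewrite nsum_ffun; apply: eq_bigr => f _; rewrite mul1n.
Qed.

Lemma recs_tau_box r k n F : recs n F -> recs n (fun s => tau_box r k (F s)).
Proof.
apply: (@recs_comp1 (tau_box r k)).
have ht : recs 1 (fun s => nsum k (nth 0 s 0) (fun P => (P == nth 0 s 0 : nat)) 1).
  have h : recs 2 (fun s => nsum k (nth 0 (behead s) 0) (fun P => (P == nth 0 (behead s) 0 : nat)) (nth 0 s 0)).
    apply: (@recs_nsum 1 k (fun s => nth 0 s 0) (fun s => (nth 0 s 0 == nth 0 s 1 : nat))); first exact: recs_var.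
    by apply: recs_eq; apply: recs_var.
  have := @recs_consdrop 0 1 _ (fun=> 1) h (recs_const _ _).
  by apply: recs_ext => -[|x [|y s]].
have h : recs 2 (fun s => nsum r (nth 0 (behead s) 0) (fun n => nsum k n (fun P => (P == n : nat)) 1) (nth 0 s 0)).
  apply: (@recs_nsum 1 r (fun s => nth 0 s 0) (fun s => nsum k (nth 0 s 0) (fun P => (P == nth 0 s 0 : nat)) 1)); first exact: recs_var.
  have := @recs_comp1 (fun n => nsum k n (fun P => (P == n : nat)) 1) 2 (fun s => nth 0 s 0) ht.
  by apply; apply: recs_var.
have := @recs_consdrop 0 1 _ (fun=> 1) h (recs_const _ _).
by apply: recs_ext => -[|x [|y s]] //= _; rewrite tau_box_nsum.
Qed.

Local Open Scope R_scope.

(** * Taylor expansions with bounded remainder *)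

Lemma C_ext (a b : C) : Re a = Re b -> Im a = Im b -> a = b.
Proof. by case: a b => a1 a2 [b1 b2] /= -> ->. Qed.

Lemma ReD (a b : C) : Re (a + b)%C = Re a + Re b. Proof. by []. Qed.
Lemma ImD (a b : C) : Im (a + b)%C = Im a + Im b. Proof. by []. Qed.
Lemma ReB (a b : C) : Re (a - b)%C = Re a - Re b. Proof. by []. Qed.
Lemma ImB (a b : C) : Im (a - b)%C = Im a - Im b. Proof. by []. Qed.
Lemma ReM (a b : C) : Re (a * b)%C = Re a * Re b - Im a * Im b. Proof. by []. Qed.
Lemma ImM (a b : C) : Im (a * b)%C = Re a * Im b + Im a * Re b. Proof. by []. Qed.
Lemma ReR (x : R) : Re (RtoC x) = x. Proof. by []. Qed.
Lemma ImR (x : R) : Im (RtoC x) = 0. Proof. by []. Qed.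
Definition ReImE := (ReD, ImD, ReB, ImB, ReM, ImM, ReR, ImR).

Lemma Cmod_le_ReIm (z : C) : Cmod z <= Rabs (Re z) + Rabs (Im z).
Proof.
rewrite {1}(_ : z = (RtoC (Re z) + RtoC (Im z) * Ci)%C); last first.
  by apply: C_ext => /=; ring.
apply: (Rle_trans _ _ _ (Cmod_triangle _ _)).
by rewrite Cmod_mult !Cmod_R Cmod_Ci Rmult_1_r; apply: Rle_refl.
Qed.

Lemma im_le_Cmod (z : C) : Rabs (Im z) <= Cmod z.
Proof. by apply: Rle_trans (Rmax_Cmod z); apply: Rmax_r. Qed.

Lemma exp_le (x y : R) : x <= y -> exp x <= exp y.
Proof. by case=> [/exp_increasing/Rlt_le|->] //; apply: Rle_refl. Qed.

Definition cexp (z : C) : C := (exp (Re z) * cos (Im z), exp (Re z) * sin (Im z)).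

Lemma cexpD (a b : C) : cexp (a + b)%C = (cexp a * cexp b)%C.
Proof.
case: a b => a1 a2 [b1 b2]; rewrite /cexp /= exp_plus cos_plus sin_plus.
by apply: C_ext => /=; ring.
Qed.

Lemma Cmod_cexp (z : C) : Cmod (cexp z) = exp (Re z).
Proof.
rewrite (_ : cexp z = (RtoC (exp (Re z)) * (cos (Im z), sin (Im z)))%C); last first.
  by apply: C_ext => /=; ring.
rewrite Cmod_mult Cmod_R Rabs_pos_eq; last exact: Rlt_le (exp_pos _).
rewrite /Cmod /= !Rmult_1_r.
have := sin2_cos2 (Im z); rewrite /Rsqr Rplus_comm => ->.
by rewrite sqrt_1 Rmult_1_r.
Qed.

Lemma cpowE (t : R) (s : C) : cpow t s = cexp (s * ln t)%C.
Proof. 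
case: s => s1 s2; rewrite /cpow /cexp.
rewrite (_ : Re ((s1, s2) * ln t)%C = s1 * ln t); last by rewrite /=; ring.
rewrite (_ : Im ((s1, s2) * ln t)%C = s2 * ln t); last by rewrite /=; ring.
by apply: C_ext => /=; ring.
Qed.

(** The remainder of the exponential series after its first [k] terms. *)
Fixpoint exprem (k : nat) (z : C) : C :=
  if k is k'.+1 then (exprem k' z - z ^ k' * RtoC (/ INR (fact k')))%C else cexp z.

Definition is_cderive (f : R -> C) (t : R) (l : C) :=
  is_derive (fun u => Re (f u)) t (Re l) /\ is_derive (fun u => Im (f u)) t (Im l).

Lemma exprem_derive k (z : C) (t : R) :
  is_cderive (fun u => exprem k.+1 (RtoC u * z)) t (z * exprem k (RtoC t * z)).
Proof.
elim: k => [|k [IHr IHi]].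
  case: z => a b; split; rewrite /cexp /=.
    by auto_derive => //; rewrite /Re /Rminus /=; ring.
  by auto_derive => //; rewrite /Im /Rminus /=; ring.
have E (u : R) : exprem k.+2 (RtoC u * z) =
   (exprem k.+1 (RtoC u * z) - RtoC (u ^ k.+1 * / INR (fact k.+1)) * z ^ k.+1)%C.
  rewrite (_ : exprem k.+2 _ = exprem k.+1 (RtoC u * z) - (RtoC u * z) ^ k.+1 * RtoC (/ INR (fact k.+1)))%C //.
  by rewrite Cpow_mult_l RtoC_mult RtoC_pow; ring.
have Fk : INR (fact k.+1) = INR k.+1 * INR (fact k) by rewrite -mult_INR.
have K0 : INR k.+1 <> 0 by apply: not_0_INR.
have F0 : INR (fact k) <> 0 by apply: INR_fact_neq_0.
have D : is_derive (fun u : R => u ^ k.+1 * / INR (fact k.+1)) t (t ^ k * / INR (fact k)).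
  auto_derive => //; rewrite Fk; change (1 * (INR k.+1 * t ^ k) * / (INR k.+1 * INR (fact k)) = t ^ k * / INR (fact k)); field; split=> //.
have E2 : (z * exprem k.+1 (RtoC t * z) = z * exprem k (RtoC t * z) - RtoC (t ^ k * / INR (fact k)) * z ^ k.+1)%C.
  by rewrite [exprem k.+1 _]/= Cpow_mult_l RtoC_mult RtoC_pow Cpow_S; ring.
rewrite E2; split.
- apply: (is_derive_ext (fun u => Re (exprem k.+1 (RtoC u * z)) - (u ^ k.+1 * / INR (fact k.+1)) * Re (z ^ k.+1)%C)).
    by move=> u; apply: (@eq_trans R _ _ _ _ (esym (f_equal Re (E u)))); rewrite !ReImE; ring.
  rewrite ReB (_ : Re (RtoC _ * _)%C = t ^ k * / INR (fact k) * Re (z ^ k.+1)%C); last by rewrite !ReImE; ring.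
  by apply: is_derive_minus => //; apply: (@is_derive_scal_l _ _ _ _ _ (Re (z ^ k.+1)%C) D).
- apply: (is_derive_ext (fun u => Im (exprem k.+1 (RtoC u * z)) - (u ^ k.+1 * / INR (fact k.+1)) * Im (z ^ k.+1)%C)).
    by move=> u; apply: (@eq_trans R _ _ _ _ (esym (f_equal Im (E u)))); rewrite !ReImE; ring.
  rewrite ImB (_ : Im (RtoC _ * _)%C = t ^ k * / INR (fact k) * Im (z ^ k.+1)%C); last by rewrite !ReImE; ring.
  by apply: is_derive_minus => //; apply: (@is_derive_scal_l _ _ _ _ _ (Im (z ^ k.+1)%C) D).
Qed.

Lemma exprem_at0 k : exprem k.+1 0 = 0.
Proof.
elim: k => [|k IH].
  by apply: C_ext; rewrite /= exp_0 ?cos_0 ?sin_0; field.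
rewrite (_ : exprem k.+2 _ = exprem k.+1 0 - 0 ^ k.+1 * RtoC (/ INR (fact k.+1)))%C // IH.
by rewrite Cpow_S; ring.
Qed.

(** Induction along the segment from [0] to [z], where the derivative of one remainder is [z] times
    the previous one. The mean value inequality is applied to real and imaginary parts separately,
    which costs a factor 2 at each step. *)
Lemma exprem_bound k (z : C) : Cmod (exprem k z) <= 2 ^ k * Cmod z ^ k * exp (Cmod z).
Proof.
elim: k z => [|k IH] z.
  rewrite /= Cmod_cexp !Rmult_1_l.
  apply: exp_le; apply: Rle_trans (re_le_Cmod z); exact: Rle_abs.
set D := Cmod z * (2 ^ k * Cmod z ^ k * exp (Cmod z)).
have c0 := Cmod_ge_0 z.
have bd t : Rabs (t - 0) <= Rabs (1 - 0) -> Cmod (z * exprem k (RtoC t * z))%C <= D.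
  rewrite !Rminus_0_r Rabs_R1 => ht.
  rewrite Cmod_mult; apply: Rmult_le_compat_l => //.
  apply: (Rle_trans _ _ _ (IH _)).
  have h : Cmod (RtoC t * z) <= Cmod z.
    by rewrite Cmod_mult Cmod_R; nra.
  have h0 := Cmod_ge_0 (RtoC t * z).
  apply: Rmult_le_compat.
  - by apply: Rmult_le_pos; apply: pow_le; lra.
  - exact: Rlt_le (exp_pos _).
  - by apply: Rmult_le_compat_l; [apply: pow_le; lra|apply: pow_incr].
  - exact: exp_le.
have h1 : Rabs (Re (exprem k.+1 (RtoC 1 * z))%C - Re (exprem k.+1 (RtoC 0 * z))%C) <= D * Rabs (1 - 0).
  apply: (@bounded_variation (fun u => Re (exprem k.+1 (RtoC u * z)%C)) (fun t => Re (z * exprem k (RtoC t * z))%C)) => t ht.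
  split; first by have [] := exprem_derive k z t.
  by apply: Rle_trans (bd t ht); apply: re_le_Cmod.
have h2 : Rabs (Im (exprem k.+1 (RtoC 1 * z))%C - Im (exprem k.+1 (RtoC 0 * z))%C) <= D * Rabs (1 - 0).
  apply: (@bounded_variation (fun u => Im (exprem k.+1 (RtoC u * z)%C)) (fun t => Im (z * exprem k (RtoC t * z))%C)) => t ht.
  split; first by have [] := exprem_derive k z t.
  by apply: Rle_trans (bd t ht); apply: im_le_Cmod.
move: h1 h2.
rewrite (_ : RtoC 0 * z = 0)%C; last by ring.
rewrite (_ : RtoC 1 * z = z)%C; last by ring.
rewrite exprem_at0 ReR ImR !Rminus_0_r Rabs_R1 !Rmult_1_r => h1 h2.
apply: (Rle_trans _ _ _ (Cmod_le_ReIm _)).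
by rewrite /D in h1 h2; rewrite -!tech_pow_Rmult; lra.
Qed.

(** Stands in for analyticity: on the punctured disc [f] is a polynomial of degree below [k] plus
    [w^k] times a remainder, with coefficients and remainder all bounded by the same [M]. Peeling
    one coefficient per level suits induction. *)
Fixpoint taylor_bounded (rho : R) (k : nat) (M : R) (f : C -> C) : Prop :=
  if k is k'.+1 then
    exists (c : C) (f1 : C -> C), [/\ Cmod c <= M, taylor_bounded rho k' M f1 &
      forall w, 0 < Cmod w <= rho -> f w = (c + w * f1 w)%C]
  else forall w, 0 < Cmod w <= rho -> Cmod (f w) <= M.

Section Taylor.
Variable rho : R.
Hypothesis rho_le1 : 0 < rho <= 1.
Notation tb := (taylor_bounded rho).

Lemma taylor_ext k M f g : (forall w, 0 < Cmod w <= rho -> f w = g w) -> tb k M f -> tb k M g.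
Proof.
case: k => [|k] e /=; first by move=> h w hw; rewrite -e //; apply: h.
by move=> [c [f1 [h1 h2 h3]]]; exists c, f1; split => // w hw; rewrite -e // h3.
Qed.

Lemma taylor_le k M M' f : M <= M' -> tb k M f -> tb k M' f.
Proof.
move=> le; elim: k f => [|k IH] f /=.
  by move=> h w hw; apply: Rle_trans le; apply: h.
move=> [c [f1 [h1 h2 h3]]]; exists c, f1; split => //; [lra|exact: IH].
Qed.

(** Only the innermost level changes: there [c + w * f1 w] becomes the remainder, of modulus at most
    [M + rho * M]. *)
Lemma taylor_down k M f : 0 <= M -> tb k.+1 M f -> tb k (2 * M) f.
Proof.
move=> M0; elim: k f => [|k IH] f.
  move=> [c [f1 [h1 h2 h3]]] w hw /=; rewrite h3 //.
  apply: (Rle_trans _ _ _ (Cmod_triangle _ _)); rewrite Cmod_mult.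
  by have := h2 w hw; have := Cmod_ge_0 (f1 w); nra.
move=> [c [f1 [h1 h2 h3]]]; exists c, f1; split => //; [lra|exact: IH].
Qed.

Lemma taylor_plus k M M' f g : tb k M f -> tb k M' g -> tb k (M + M') (fun w => f w + g w)%C.
Proof.
elim: k f g => [|k IH] f g /=.
  move=> h h' w hw; apply: (Rle_trans _ _ _ (Cmod_triangle _ _)).
  by apply: Rplus_le_compat; auto.
move=> [c [f1 [h1 h2 h3]]] [c' [f1' [h1' h2' h3']]].
exists (c + c')%C, (fun w => f1 w + f1' w)%C; split.
- by apply: (Rle_trans _ _ _ (Cmod_triangle _ _)); lra.
- exact: IH.
- by move=> w hw; rewrite h3 // h3' //; ring.
Qed.

Lemma taylor_scal k M f (a : C) : tb k M f -> tb k (Cmod a * M) (fun w => a * f w)%C.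
Proof.
have a0 := Cmod_ge_0 a.
elim: k f => [|k IH] f /=.
  by move=> h w hw; rewrite Cmod_mult; apply: Rmult_le_compat_l; auto.
move=> [c [f1 [h1 h2 h3]]].
exists (a * c)%C, (fun w => a * f1 w)%C; split.
- by rewrite Cmod_mult; apply: Rmult_le_compat_l.
- exact: IH.
- by move=> w hw; rewrite h3 //; ring.
Qed.

(** From [f g = c c' + w (f1 g + c f1')]. Demoting [g] by one order doubles its bound, and
    [2 * 4^k + 1 <= 4 * 4^k]. *)
Lemma taylor_mult k M M' f g : 0 <= M -> 0 <= M' ->
  tb k M f -> tb k M' g -> tb k (4 ^ k * (M * M')) (fun w => f w * g w)%C.
Proof.
move=> M0; elim: k f g M' => [|k IH] f g M' M0'.
  move=> /= h h' w hw; rewrite Cmod_mult Rmult_1_l.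
  by apply: Rmult_le_compat; (try exact: Cmod_ge_0); auto.
move=> [c [f1 [h1 h2 h3]]] hg.
have hgd := taylor_down M0' hg.
move: hg => [c' [f1' [h1' h2' h3']]].
have P : 0 <= M * M' by nra.
have p4 : 1 <= 4 ^ k by apply: pow_R1_Rle; lra.
exists (c * c')%C, (fun w => f1 w * g w + c * f1' w)%C; split.
- rewrite Cmod_mult; apply: (Rle_trans _ (M * M')).
    by apply: Rmult_le_compat => //; apply: Cmod_ge_0.
  by rewrite -tech_pow_Rmult; nra.
- apply: (@taylor_le _ (4 ^ k * (M * (2 * M')) + M * M')).
    by rewrite -tech_pow_Rmult; nra.
  apply: taylor_plus; first by apply: IH => //; lra.
  apply: (@taylor_le _ (Cmod c * M')); first by apply: Rmult_le_compat_r.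
  exact: taylor_scal.
- by move=> w hw; rewrite {1}h3 // {1 2}h3' //; ring.
Qed.

Lemma taylor_mulw k M f : 0 <= M -> tb k M f -> tb k.+1 M (fun w => w * f w)%C.
Proof.
move=> M0 h; exists (RtoC 0), f; split => //; first by rewrite Cmod_0.
by move=> w _; ring.
Qed.

Lemma taylor_const k M (c : C) : Cmod c <= M -> tb k M (fun _ => c).
Proof.
move=> h; have M0 : 0 <= M by have := Cmod_ge_0 c; lra.
have h0 j : tb j M (fun _ => 0).
  elim: j => [|j IH] /=; first by move=> w _; rewrite Cmod_0.
  exists (RtoC 0), (fun _ => RtoC 0); rewrite Cmod_0; split => // w _; ring.
case: k => [|k] //=.
by exists c, (fun _ => RtoC 0); split => // w _; ring.
Qed.

(** The coefficient of [w^i] is [L^(m+i) / (m+i)!]; the hypothesis bounds these coefficients and the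
    last remainder at once, through the orders [m] to [m + k]. *)
Lemma taylor_exprem k m (L M : R) :
  (forall j, (m <= j <= m + k)%N -> 2 ^ j * Rabs L ^ j * exp (Rabs L * rho) <= M) ->
  tb k M (fun w => exprem m (RtoC L * w) / w ^ m)%C.
Proof.
elim: k m => [|k IH] m h.
  move=> /= w [hw1 hw2].
  have w0 : w <> 0 by apply/Cmod_gt_0.
  rewrite Cmod_div; last exact: Cpow_nz.
  rewrite Cmod_pow; have p0 := pow_lt _ m hw1.
  apply/Rle_div_l => //.
  apply: (Rle_trans _ _ _ (exprem_bound _ _)).
  rewrite Cmod_mult Cmod_R Rpow_mult_distr.
  have h' := h m ltac:(lia).
  have e1 : exp (Rabs L * Cmod w) <= exp (Rabs L * rho).
    by apply: exp_le; apply: Rmult_le_compat_l => //; apply: Rabs_pos.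
  have q0 : 0 <= 2 ^ m * Rabs L ^ m by apply: Rmult_le_pos; apply: pow_le; [lra|apply: Rabs_pos].
  rewrite -Rmult_assoc (Rmult_assoc (_ * _)) (Rmult_comm (Cmod w ^ m)) -Rmult_assoc.
  apply: Rmult_le_compat_r; first lra.
  apply: Rle_trans h'; exact: Rmult_le_compat_l.
exists (RtoC (L ^ m * / INR (fact m))), (fun w => exprem m.+1 (RtoC L * w) / w ^ m.+1)%C; split.
- rewrite Cmod_R Rabs_mult -RPow_abs.
  apply: Rle_trans (h m ltac:(lia)).
  have a0 : 0 <= Rabs L ^ m by apply: pow_le; apply: Rabs_pos.
  have fp : 1 <= INR (fact m) by apply: (le_INR 1); have := lt_O_fact m; lia.
  have fi : Rabs (/ INR (fact m)) <= 1.
    rewrite Rabs_pos_eq; last by apply: Rlt_le; apply: Rinv_0_lt_compat; lra.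
    by rewrite -Rinv_1; apply: Rinv_le_contravar; lra.
  have t1 : 1 <= 2 ^ m by apply: pow_R1_Rle; lra.
  have e1 : 1 <= exp (Rabs L * rho).
    rewrite -exp_0; apply: exp_le; apply: Rmult_le_pos; [exact: Rabs_pos|lra].
  have : Rabs L ^ m * Rabs (/ INR (fact m)) <= Rabs L ^ m * 1 by apply: Rmult_le_compat_l.
  have : 1 * Rabs L ^ m <= 2 ^ m * Rabs L ^ m by apply: Rmult_le_compat_r.
  have : (2 ^ m * Rabs L ^ m) * 1 <= (2 ^ m * Rabs L ^ m) * exp (Rabs L * rho).
    by apply: Rmult_le_compat_l => //; nra.
  lra.
- by apply: IH => j hj; apply: h; lia.
- move=> w [hw1 hw2].
  have w0 : w <> 0 by apply/Cmod_gt_0.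
  have wm : (w ^ m)%C <> 0 by apply: Cpow_nz.
  rewrite [exprem m.+1 _]/= Cpow_mult_l RtoC_mult RtoC_pow Cpow_S; field; split => //.
Qed.
End Taylor.

(** Each factor [1 + t] is paid for with half of the exponent still available. *)
Lemma pow_le_exp n (eps : R) : 0 < eps ->
  exists K, 0 < K /\ forall t, 0 <= t -> (1 + t) ^ n <= K * exp (eps * t).
Proof.
elim: n eps => [|n IH] eps e0.
  exists 1; split; first lra; move=> t t0 /=; rewrite Rmult_1_l -exp_0.
  by apply: exp_le; nra.
have [K [K0 hK]] := IH (eps / 2) ltac:(lra).
have i0 : 0 < / eps by apply: Rinv_0_lt_compat.
exists (K * (1 + 2 * / eps)); split; first nra.
move=> t t0; rewrite -tech_pow_Rmult.
rewrite (_ : eps * t = eps / 2 * t + eps / 2 * t); last by field.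
rewrite exp_plus.
have h1 := hK t t0.
have h2 := exp_ineq1_le (eps / 2 * t).
have h3 : 1 + t <= (1 + 2 * / eps) * exp (eps / 2 * t).
  apply: (Rle_trans _ ((1 + 2 * / eps) * (1 + eps / 2 * t))); last first.
    by apply: Rmult_le_compat_l; lra.
  rewrite (_ : (1 + 2 * / eps) * (1 + eps / 2 * t) = 1 + t + 2 * / eps + eps / 2 * t); last by field; lra.
  nra.
rewrite (_ : _ * (_ * _) = ((1 + 2 * / eps) * exp (eps / 2 * t)) * (K * exp (eps / 2 * t))); last by ring.
by apply: Rmult_le_compat => //; [lra|apply: pow_le; lra].
Qed.

(** * Real sums of negative powers *)

Lemma ln_ge_1_inv (y : R) : 0 < y -> 1 - / y <= ln y.
Proof.
move=> y0; have := exp_ineq1_le (- ln y).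
by rewrite exp_Ropp exp_ln //; lra.
Qed.

Lemma Rpower_pos (x y : R) : 0 < Rpower x y.
Proof. exact: exp_pos. Qed.

Lemma zeta_partial_sum_le (s : R) : 1 < s ->
  forall N, sum_n (fun n => Rpower (INR n.+1) (- s)) N <= s / (s - 1).
Proof.
move=> s1 N.
have e0 : 0 < / (s - 1) by apply: Rinv_0_lt_compat; lra.
(* Strengthened so as to telescope: [(s - 1) (a + 1)^(-s)] is at most [a^(1-s) - (a + 1)^(1-s)], the
   discrete form of the comparison with an integral. *)
suff H : sum_n (fun n => Rpower (INR n.+1) (- s)) N <= s / (s - 1) - / (s - 1) * Rpower (INR N.+1) (- (s - 1)).
  by have := Rpower_pos (INR N.+1) (- (s - 1)); nra.
elim: N => [|N IH].
  rewrite sum_O /Rpower ln_1 !Rmult_0_r exp_0; apply: Req_le; field; lra.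
rewrite sum_Sn (S_INR N.+1); change plus with Rplus.
set a := INR N.+1 in IH *.
have a0 : 0 < a by apply: lt_0_INR; lia.
have key : (s - 1) * Rpower (a + 1) (- s) <= Rpower a (- (s - 1)) - Rpower (a + 1) (- (s - 1)).
  have -> : Rpower a (- (s - 1)) = Rpower (a + 1) (- (s - 1)) * exp ((s - 1) * ln ((a + 1) / a)).
    rewrite /Rpower -exp_plus ln_div; [|lra|lra]; congr exp; ring.
  have -> : Rpower (a + 1) (- s) = Rpower (a + 1) (- (s - 1)) * / (a + 1).
    rewrite -{3}(Rpower_1 (a + 1)); last lra.
    rewrite -Rpower_Ropp -Rpower_plus; congr Rpower; ring.
  have p := Rpower_pos (a + 1) (- (s - 1)).
  have h := exp_ineq1_le ((s - 1) * ln ((a + 1) / a)).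
  have h2 := @ln_ge_1_inv ((a + 1) / a) ltac:(apply: Rdiv_lt_0_compat; lra).
  have h3 : 1 - / ((a + 1) / a) = / (a + 1) by field; lra.
  rewrite h3 in h2.
  suff : (s - 1) * / (a + 1) <= exp ((s - 1) * ln ((a + 1) / a)) - 1 by nra.
  nra.
have k2 : Rpower (a + 1) (- s) <= / (s - 1) * (Rpower a (- (s - 1)) - Rpower (a + 1) (- (s - 1))).
  apply: (Rmult_le_reg_l (s - 1)); first lra.
  by rewrite -Rmult_assoc Rinv_r ?Rmult_1_l; lra.
lra.
Qed.

Lemma ex_series_zeta (s : R) : 1 < s -> ex_series (fun n => Rpower (INR n.+1) (- s)).
Proof.
move=> s1.
have [l hl] : ex_finite_lim_seq (sum_n (fun n => Rpower (INR n.+1) (- s))).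
  apply: (ex_finite_lim_seq_incr _ (s / (s - 1))); last exact: zeta_partial_sum_le.
  move=> n; rewrite sum_Sn; change plus with Rplus.
  by have := Rpower_pos (INR n.+2) (- s); lra.
by exists l.
Qed.

(** * Series of complex functions *)

Fixpoint csum (c : nat -> C) (N : nat) : C :=
  if N is N'.+1 then (csum c N' + c N')%C else RtoC 0.

Definition clim (u : nat -> C) (l : C) :=
  forall eps, 0 < eps -> exists N, forall n, (N <= n)%N -> Cmod (u n - l)%C < eps.

Lemma clim_le u l M : clim u l -> (forall n, Cmod (u n) <= M) -> Cmod l <= M.
Proof.
move=> h hM; have [//|lt] := Rle_lt_dec (Cmod l) M.
have [N hN] := h (Cmod l - M) ltac:(lra).
have := hN N (leqnn N); have := hM N.
have := Cmod_triangle (u N) (- (u N - l))%C.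
rewrite Cmod_opp (_ : (u N + - (u N - l)) = l)%C; last by ring.
lra.
Qed.

Lemma clim_affine u l (a b : C) : clim u l -> clim (fun n => a + b * u n)%C (a + b * l)%C.
Proof.
move=> h eps e0.
have b0 := Cmod_ge_0 b.
have [N hN] := h (eps / (Cmod b + 1)) ltac:(apply: Rdiv_lt_0_compat; lra).
exists N => n hn; rewrite (_ : (_ - _) = b * (u n - l))%C; last by ring.
rewrite Cmod_mult; have h1 := hN n hn.
have h2 : eps = eps / (Cmod b + 1) * (Cmod b + 1) by field; lra.
have := Cmod_ge_0 (u n - l)%C; nra.
Qed.

Lemma clim_plus u l u' l' : clim u l -> clim u' l' -> clim (fun n => u n + u' n)%C (l + l')%C.
Proof.
move=> h h' eps e0.
have [N hN] := h (eps / 2) ltac:(lra).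
have [N' hN'] := h' (eps / 2) ltac:(lra).
exists (N + N')%N => n hn.
rewrite (_ : (_ - _) = (u n - l) + (u' n - l'))%C; last by ring.
apply: (Rle_lt_trans _ _ _ (Cmod_triangle _ _)).
by have := hN n ltac:(lia); have := hN' n ltac:(lia); lra.
Qed.

Lemma clim_ext u v l : (forall n, u n = v n) -> clim u l -> clim v l.
Proof. by move=> e h eps e0; have [N hN] := h eps e0; exists N => n /hN; rewrite e. Qed.

(** [csum c N] has [N] terms, [sum_n] up to [N] has one more; hence the shift. *)
Lemma csum_Re c N : Re (csum c N.+1) = sum_n (fun n => Re (c n)) N.
Proof.
elim: N => [|N IH]; first by rewrite sum_O /= Rplus_0_l.
by rewrite sum_Sn -IH.
Qed.

Lemma csum_Im c N : Im (csum c N.+1) = sum_n (fun n => Im (c n)) N.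
Proof.
elim: N => [|N IH]; first by rewrite sum_O /= Rplus_0_l.
by rewrite sum_Sn -IH.
Qed.

Fixpoint rsum (M : nat -> R) (N : nat) : R := if N is N'.+1 then rsum M N' + M N' else 0.

Lemma rsumE M N : rsum M N.+1 = sum_n M N.
Proof. by elim: N => [|N IH]; [rewrite sum_O /= Rplus_0_l|rewrite sum_Sn -IH]. Qed.

Lemma csum_le c M N : (forall n, Cmod (c n) <= M n) -> Cmod (csum c N) <= rsum M N.
Proof.
move=> h; elim: N => [|N IH] /=; first by rewrite Cmod_0; lra.
by apply: (Rle_trans _ _ _ (Cmod_triangle _ _)); have := h N; lra.
Qed.

Lemma csum_diff_le c M N p : (forall n, Cmod (c n) <= M n) ->
  Cmod (csum c (N + p) - csum c N)%C <= rsum M (N + p) - rsum M N.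
Proof.
move=> h; elim: p => [|p IH].
  by rewrite addn0 (_ : (_ - _) = 0)%C ?Cmod_0; [lra|ring].
rewrite addnS /= (_ : (_ - _) = (csum c (N + p) - csum c N) + c (N + p)%N)%C; last by ring.
by apply: (Rle_trans _ _ _ (Cmod_triangle _ _)); have := h (N + p)%N; lra.
Qed.

Lemma rsum_lim M : ex_series M -> is_lim_seq (rsum M) (Series M).
Proof.
move=> h; apply/is_lim_seq_incr_1; apply: (is_lim_seq_ext (sum_n M)).
  by move=> n; rewrite rsumE.
exact: Series_correct.
Qed.

Lemma rsum_le_Series M N : (forall n, 0 <= M n) -> ex_series M -> rsum M N <= Series M.
Proof.
move=> h0 h; apply: (is_lim_seq_incr_compare _ _ (rsum_lim h)).
by move=> n /=; have := h0 n; lra.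
Qed.

Lemma csum_conv c M : (forall n, Cmod (c n) <= M n) -> ex_series M ->
  exists l, clim (csum c) l.
Proof.
move=> h hM.
have [a ha] : ex_series (fun n => Re (c n)).
  by apply: (@ex_series_le _ _ _ M) => // n; apply: Rle_trans (h n); apply: re_le_Cmod.
have [b hb] : ex_series (fun n => Im (c n)).
  by apply: (@ex_series_le _ _ _ M) => // n; apply: Rle_trans (h n); apply: im_le_Cmod.
exists (a, b) => eps e0.
have e2 : 0 < eps / 2 by lra.
have [N1 h1] := ha _ (locally_ball a (mkposreal _ e2)).
have [N2 h2] := hb _ (locally_ball b (mkposreal _ e2)).
exists (N1 + N2).+1 => -[|n] hn; first by [].
apply: (Rle_lt_trans _ _ _ (Cmod_le_ReIm _)).
rewrite ReB ImB csum_Re csum_Im.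
have := h1 n ltac:(lia); have := h2 n ltac:(lia).
move=> x1 x2; apply: (Rlt_le_trans _ (eps / 2 + eps / 2)); [exact: Rplus_lt_compat|lra].
Qed.

Lemma series_tail_le c M l N : (forall n, Cmod (c n) <= M n) -> (forall n, 0 <= M n) ->
  ex_series M -> clim (csum c) l -> Cmod (l - csum c N)%C <= Series M - rsum M N.
Proof.
move=> h h0 hM hl.
apply: (@clim_le (fun p => csum c (N + p) - csum c N)%C).
  move=> eps e0; have [N' hN'] := hl eps e0; exists N' => n hn.
  rewrite (_ : (_ - _) = csum c (N + n) - l)%C; last by ring.
  by apply: hN'; lia.
move=> p; apply: (Rle_trans _ _ _ (csum_diff_le N p h)).
by have := rsum_le_Series (N + p) h0 hM; lra.
Qed.

(** The coefficients [c n] sum to some [l], and [(F w - l) / w] is then the sum of the quotients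
    [f1 n w], to which the induction hypothesis applies. *)
Lemma taylor_series rho k (f : nat -> C -> C) F M : 0 < rho <= 1 ->
  (forall n, taylor_bounded rho k (M n) (f n)) -> (forall n, 0 <= M n) -> ex_series M ->
  (forall w, 0 < Cmod w <= rho -> clim (csum (fun n => f n w)) (F w)) ->
  taylor_bounded rho k (Series M) F.
Proof.
move=> hrho; elim: k f F => [|k IH] f F hf M0 hM hF.
  move=> w hw; apply: (clim_le (hF w hw)) => n.
  by apply: Rle_trans (rsum_le_Series n M0 hM); apply: csum_le => j; apply: hf.
have [c hc] : exists c : nat -> C, forall n, exists f1, [/\ Cmod (c n) <= M n, taylor_bounded rho k (M n) f1 &
      forall w, 0 < Cmod w <= rho -> f n w = (c n + w * f1 w)%C].
  by exists (fun n => proj1_sig (constructive_indefinite_description _ (hf n))) => n; case: constructive_indefinite_description.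
have [f1 hf1] : exists f1 : nat -> C -> C, forall n, [/\ Cmod (c n) <= M n, taylor_bounded rho k (M n) (f1 n) &
      forall w, 0 < Cmod w <= rho -> f n w = (c n + w * f1 n w)%C].
  by exists (fun n => proj1_sig (constructive_indefinite_description _ (hc n))) => n; case: constructive_indefinite_description.
have cM n : Cmod (c n) <= M n by have [] := hf1 n.
have [l hl] := csum_conv cM hM.
exists l, (fun w => (F w - l) / w)%C; split.
- apply: (clim_le hl) => n.
  by apply: Rle_trans (rsum_le_Series n M0 hM); apply: csum_le.
- apply: (IH f1) => // [n|w hw]; first by have [] := hf1 n.
  have w0 : w <> 0 by apply/Cmod_gt_0; case: hw.
  apply: (@clim_ext (fun N => 0 + / w * (csum (fun n => f n w) N + (0 + (-1) * csum c N)))%C).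
    elim=> [|n IHn]; first by rewrite /=; ring.
    rewrite /= -IHn; have [_ _ ->] := hf1 n => //; by field.
  rewrite (_ : (F w - l) / w = 0 + / w * (F w + (0 + (-1) * l)))%C; last by field.
  by apply: clim_affine; apply: clim_plus; [apply: hF|apply: clim_affine].
- move=> w hw; have w0 : w <> 0 by apply/Cmod_gt_0; case: hw.
  by field.
Qed.

(** * Continuity of complex curves *)

Definition ccont (f : R -> C) (t : R) :=
  continuous (fun u => Re (f u)) t /\ continuous (fun u => Im (f u)) t.

Lemma ccont_const c t : ccont (fun _ => c) t.
Proof. by split; apply: continuous_const. Qed.

Lemma ccont_plus f g t : ccont f t -> ccont g t -> ccont (fun u => f u + g u)%C t.
Proof. by move=> [a b] [c d]; split; apply: (@continuous_plus _ R_AbsRing R_NormedModule). Qed.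

Lemma ccont_mult f g t : ccont f t -> ccont g t -> ccont (fun u => f u * g u)%C t.
Proof.
move=> [a b] [c d]; split.
  by apply: (@continuous_minus _ R_AbsRing R_NormedModule); apply: (@continuous_mult _ R_AbsRing).
by apply: (@continuous_plus _ R_AbsRing R_NormedModule); apply: (@continuous_mult _ R_AbsRing).
Qed.

Lemma ccont_opp f t : ccont f t -> ccont (fun u => - f u)%C t.
Proof. by move=> [a b]; split; apply: (@continuous_opp _ R_AbsRing R_NormedModule). Qed.

Lemma ccont_minus f g t : ccont f t -> ccont g t -> ccont (fun u => f u - g u)%C t.
Proof. by move=> hf hg; apply: ccont_plus => //; apply: ccont_opp. Qed.

Lemma ccont_pow f n t : ccont f t -> ccont (fun u => f u ^ n)%C t.
Proof. by move=> hf; elim: n => [|n IH] /=; [apply: ccont_const|apply: ccont_mult]. Qed.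

Lemma ccont_ext f g t : (forall u, f u = g u) -> ccont f t -> ccont g t.
Proof.
by move=> e [a b]; split; [move: a|move: b]; apply: continuous_ext => u; rewrite e.
Qed.

Lemma ccont_inv (f : R -> C) t : f t <> 0 -> ccont f t -> ccont (fun u => / f u)%C t.
Proof.
move=> n0 [a b].
have d : Re (f t) ^ 2 + Im (f t) ^ 2 <> 0.
  rewrite -Cmod2_alt => h.
  have p := proj1 (Cmod_gt_0 _) n0; have := pow_lt _ 2 p; lra.
have cd : continuous (fun u => Re (f u) ^ 2 + Im (f u) ^ 2) t.
  apply: (@continuous_plus _ R_AbsRing R_NormedModule) => /=;
  by apply: (@continuous_mult _ R_AbsRing) => //; apply: (@continuous_mult _ R_AbsRing) => //; apply: continuous_const.
have ci : continuous (fun u => / (Re (f u) ^ 2 + Im (f u) ^ 2)) t.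
  by apply: continuous_comp cd _; apply: continuous_Rinv.
split.
  by apply: (@continuous_mult _ R_AbsRing).
apply: (@continuous_mult _ R_AbsRing) => //; exact: (@continuous_opp _ R_AbsRing R_NormedModule).
Qed.

Lemma ccont_cexp f t : ccont f t -> ccont (fun u => cexp (f u)) t.
Proof.
move=> [a b]; split.
  apply: (@continuous_mult _ R_AbsRing); first by apply: continuous_comp a _; apply: continuous_exp.
  by apply: continuous_comp b _; apply: continuous_cos.
apply: (@continuous_mult _ R_AbsRing); first by apply: continuous_comp a _; apply: continuous_exp.
by apply: continuous_comp b _; apply: continuous_sin.
Qed.

Lemma ccont_exprem k f t : ccont f t -> ccont (fun u => exprem k (f u)) t.
Proof.
move=> hf; elim: k => [|k IH] /=; first exact: ccont_cexp.
apply: ccont_minus => //; apply: ccont_mult; [exact: ccont_pow|exact: ccont_const].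
Qed.

Lemma ccont_csum (f : nat -> R -> C) N t : (forall n, ccont (f n) t) ->
  ccont (fun u => csum (fun n => f n u) N) t.
Proof.
by move=> h; elim: N => [|N IH] /=; [apply: ccont_const|apply: ccont_plus].
Qed.

(** The Weierstrass test: the tails of [M] bound the tails of the series uniformly on the whole
    line, so any ball around [t] serves, here of radius 1. *)
Lemma ccont_series (f : nat -> R -> C) (F : R -> C) M t :
  (forall n u, ccont (f n) u) -> (forall n u, Cmod (f n u) <= M n) -> (forall n, 0 <= M n) ->
  ex_series M -> (forall u, clim (csum (fun n => f n u)) (F u)) -> ccont F t.
Proof.
move=> hf hM M0 sM hF.
have tail eps : 0 < eps -> exists N, forall n u, (N <= n)%coq_nat -> Cmod (F u - csum (fun n => f n u) n)%C < eps.
  move=> e0; have [N hN] := rsum_lim sM (locally_ball (Series M) (mkposreal _ e0)).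
  exists N => n u hn; apply: (Rle_lt_trans _ (Series M - rsum M n)).
    exact: series_tail_le.
  have := hN n hn; rewrite /ball /= /AbsRing_ball /= /abs /minus /plus /opp /= => h.
  by apply: Rle_lt_trans h; rewrite -Rabs_Ropp; apply: Rle_trans (Rle_abs _); lra.
have B : Boule t (mkposreal 1 Rlt_0_1) t by rewrite /Boule /= Rminus_diag Rabs_R0; lra.
split.
  apply/continuity_pt_filterlim.
  apply: (@CVU_continuity (fun n u => Re (csum (fun n => f n u) n)) _ _ _ _ _ _ B).
    move=> eps e0; have [N hN] := tail eps e0; exists N => n u hn _.
    exact: Rle_lt_trans (re_le_Cmod (F u - csum (fun n => f n u) n)%C) (hN n u hn).
  by move=> n u _; apply/continuity_pt_filterlim; apply: (proj1 (@ccont_csum f n u (fun m => hf m u))).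
apply/continuity_pt_filterlim.
apply: (@CVU_continuity (fun n u => Im (csum (fun n => f n u) n)) _ _ _ _ _ _ B).
  move=> eps e0; have [N hN] := tail eps e0; exists N => n u hn _.
  exact: Rle_lt_trans (im_le_Cmod (F u - csum (fun n => f n u) n)%C) (hN n u hn).
by move=> n u _; apply/continuity_pt_filterlim; apply: (proj2 (@ccont_csum f n u (fun m => hf m u))).
Qed.

(** * Residues as limits of circle integrals *)

Lemma ReRp (a b c : R) : Re (RtoC a * (b, c))%C = a * b.
Proof. by rewrite /=; ring. Qed.
Lemma ImRp (a b c : R) : Im (RtoC a * (b, c))%C = a * c.
Proof. by rewrite /=; ring. Qed.

Definition circ (rho t : R) : C := (RtoC rho * (cos t, sin t))%C.

Lemma Cmod_circ rho t : 0 <= rho -> Cmod (circ rho t) = rho.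
Proof.
move=> h; rewrite Cmod_mult Cmod_R Rabs_pos_eq //.
rewrite /Cmod /= !Rmult_1_r; have := sin2_cos2 t; rewrite /Rsqr Rplus_comm => ->.
by rewrite sqrt_1 Rmult_1_r.
Qed.

Lemma circ_neq0 rho t : 0 < rho -> circ rho t <> 0.
Proof. by move=> h; apply/Cmod_gt_0; rewrite Cmod_circ; lra. Qed.

Lemma ccont_circ rho t : ccont (circ rho) t.
Proof.
apply: ccont_mult; first exact: ccont_const.
by split; [apply: continuous_cos|apply: continuous_sin].
Qed.

(** Integrability needs continuity along circles only. *)
Definition circ_cont (r0 : R) (f : C -> C) :=
  forall rho t, 0 < rho <= r0 -> ccont (fun u => f (circ rho u)) t.

(** [residue] is built from the total operations [lim] and [RInt]. Here the existence of the
    integrals and their convergence belong to the statement, so that sums and multiples can be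
    formed. *)
Definition is_res (f : C -> C) (l : C) := forall eps, 0 < eps ->
  exists r0, 0 < r0 /\ forall rho, 0 < rho < r0 ->
    exists I1 I2 : R, [/\
      is_RInt (fun t => Re (f (circ rho t) * (Ci * circ rho t))%C) 0 (2 * PI) I1,
      is_RInt (fun t => Im (f (circ rho t) * (Ci * circ rho t))%C) 0 (2 * PI) I2 &
      Cmod (/ (2 * PI * Ci) * (I1, I2) - l)%C < eps].

Lemma C2PiI_neq0 : (2 * PI * Ci)%C <> 0.
Proof.
apply/Cmod_gt_0; rewrite !Cmod_mult !Cmod_R Cmod_Ci.
have := PI_RGT_0 => h; rewrite !Rabs_pos_eq; lra.
Qed.

Lemma is_res_ext r0 f g l : 0 < r0 -> (forall w, 0 < Cmod w <= r0 -> f w = g w) ->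
  is_res f l -> is_res g l.
Proof.
move=> r00 e h eps e0; have [r1 [r10 h1]] := h eps e0.
exists (Rmin r0 r1); split; first exact: Rmin_pos.
move=> rho [p1 p2].
have [q1 q2] : rho < r0 /\ rho < r1.
  by have := Rmin_l r0 r1; have := Rmin_r r0 r1; lra.
have [I1 [I2 [a b c]]] := h1 rho (conj p1 q2).
have E t : f (circ rho t) = g (circ rho t) by apply: e; rewrite Cmod_circ; lra.
exists I1, I2; split => //.
  by apply: is_RInt_ext a => t _; rewrite E.
by apply: is_RInt_ext b => t _; rewrite E.
Qed.

Lemma is_res_plus f g l l' : is_res f l -> is_res g l' ->
  is_res (fun w => f w + g w)%C (l + l')%C.
Proof.
move=> h h' eps e0.
have [r1 [r10 h1]] := h (eps / 2) ltac:(lra).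
have [r2 [r20 h2]] := h' (eps / 2) ltac:(lra).
exists (Rmin r1 r2); split; first exact: Rmin_pos.
move=> rho [p1 p2].
have [q1 q2] : rho < r1 /\ rho < r2.
  by have := Rmin_l r1 r2; have := Rmin_r r1 r2; lra.
have [I1 [I2 [a b c]]] := h1 rho (conj p1 q1).
have [J1 [J2 [a' b' c']]] := h2 rho (conj p1 q2).
exists (I1 + J1), (I2 + J2); split.
- by apply: is_RInt_ext (is_RInt_plus _ _ _ _ _ _ a a') => t _; rewrite !ReImE /plus /=; ring.
- by apply: is_RInt_ext (is_RInt_plus _ _ _ _ _ _ b b') => t _; rewrite !ReImE /plus /=; ring.
- rewrite (_ : (_ - _) = (/ (2 * PI * Ci) * (I1, I2) - l) + (/ (2 * PI * Ci) * (J1, J2) - l'))%C.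
    by apply: (Rle_lt_trans _ _ _ (Cmod_triangle _ _)); lra.
  by rewrite (_ : (I1 + J1, I2 + J2) = ((I1, I2) + (J1, J2))%C) //; ring.
Qed.

Lemma is_res_scal (c : C) f l : is_res f l -> is_res (fun w => c * f w)%C (c * l)%C.
Proof.
move=> h eps e0.
have c0 := Cmod_ge_0 c.
have [r1 [r10 h1]] := h (eps / (Cmod c + 1)) ltac:(apply: Rdiv_lt_0_compat; lra).
exists r1; split => // rho hrho.
have [I1 [I2 [a b d]]] := h1 rho hrho.
exists (Re (c * (I1, I2))%C), (Im (c * (I1, I2))%C); split.
- apply: (is_RInt_ext (fun t => minus (scal (Re c) (Re (f (circ rho t) * (Ci * circ rho t))%C)) (scal (Im c) (Im (f (circ rho t) * (Ci * circ rho t))%C)))).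
    move=> t _; rewrite -[X in _ = Re X]Cmult_assoc !(ReM c) /minus /plus /opp /scal /= /mult /=; ring.
  rewrite ReM; apply: (@is_RInt_minus R_NormedModule); exact: is_RInt_scal.
- apply: (is_RInt_ext (fun t => plus (scal (Re c) (Im (f (circ rho t) * (Ci * circ rho t))%C)) (scal (Im c) (Re (f (circ rho t) * (Ci * circ rho t))%C)))).
    move=> t _; rewrite -[X in _ = Im X]Cmult_assoc !(ImM c) /minus /plus /opp /scal /= /mult /=; ring.
  rewrite ImM; apply: (@is_RInt_plus R_NormedModule); exact: is_RInt_scal.
- rewrite (_ : (Re _, Im _) = (c * (I1, I2))%C) //.
  rewrite (_ : (_ - _) = c * (/ (2 * PI * Ci) * (I1, I2) - l))%C; last by ring.
  rewrite Cmod_mult.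
  have h2 : eps = eps / (Cmod c + 1) * (Cmod c + 1) by field; lra.
  by have := Cmod_ge_0 (/ (2 * PI * Ci) * (I1, I2) - l)%C; nra.
Qed.

(** The length of the circle tends to 0, so a bounded integrand contributes nothing in the limit. *)
Lemma is_res_bounded r0 M f : 0 < r0 -> circ_cont r0 f ->
  (forall w, 0 < Cmod w <= r0 -> Cmod (f w) <= M) -> is_res f 0.
Proof.
move=> r00 cf hM eps e0.
set M' := Rabs M + 1.
have M'0 : 0 < M' by have := Rabs_pos M; rewrite /M'; lra.
have P := PI_RGT_0.
(* The 2 in [2 * M'] pays for bounding real and imaginary parts separately. *)
exists (Rmin r0 (eps / (2 * M'))); split.
  by apply: Rmin_pos => //; apply: Rdiv_lt_0_compat; lra.
move=> rho [p1 p2].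
have [q1 q2] : rho < r0 /\ rho < eps / (2 * M').
  by have := Rmin_l r0 (eps / (2 * M')); have := Rmin_r r0 (eps / (2 * M')); lra.
have cc t : ccont (fun u => f (circ rho u) * (Ci * circ rho u))%C t.
  apply: ccont_mult; first by apply: cf; lra.
  by apply: ccont_mult; [exact: ccont_const|exact: ccont_circ].
have [I1 h1] : ex_RInt (fun t => Re (f (circ rho t) * (Ci * circ rho t))%C) 0 (2 * PI).
  by apply: (@ex_RInt_continuous R_CompleteNormedModule) => t _; apply: (proj1 (cc t)).
have [I2 h2] : ex_RInt (fun t => Im (f (circ rho t) * (Ci * circ rho t))%C) 0 (2 * PI).
  by apply: (@ex_RInt_continuous R_CompleteNormedModule) => t _; apply: (proj2 (cc t)).
exists I1, I2; split => //.
have bd t : Cmod (f (circ rho t) * (Ci * circ rho t))%C <= M' * rho.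
  rewrite Cmod_mult (Cmod_mult Ci) Cmod_Ci Cmod_circ; last lra.
  rewrite Rmult_1_l; apply: Rmult_le_compat_r; first lra.
  have := hM (circ rho t); rewrite Cmod_circ; last lra.
  by move=> /(_ ltac:(lra)); have := Rle_abs M; rewrite /M'; lra.
have cI : is_RInt (fun _ : R => M' * rho) 0 (2 * PI) (2 * PI * (M' * rho)).
  by have := @is_RInt_const R_NormedModule 0 (2 * PI) (M' * rho); rewrite /scal /= /mult /= Rminus_0_r.
have b1 : Rabs I1 <= 2 * PI * (M' * rho).
  apply: (@norm_RInt_le R_NormedModule _ _ _ _ _ _ _ _ h1 cI); first lra.
  by move=> t _; apply: Rle_trans (bd t); apply: re_le_Cmod.
have b2 : Rabs I2 <= 2 * PI * (M' * rho).
  apply: (@norm_RInt_le R_NormedModule _ _ _ _ _ _ _ _ h2 cI); first lra.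
  by move=> t _; apply: Rle_trans (bd t); apply: im_le_Cmod.
have -> : (/ (2 * PI * Ci) * (I1, I2) - 0 = / (2 * PI * Ci) * (I1, I2))%C by ring.
rewrite Cmod_mult Cmod_inv; last exact: C2PiI_neq0.
rewrite !Cmod_mult !Cmod_R Cmod_Ci !Rabs_pos_eq; try lra.
have b3 := Cmod_le_ReIm (I1, I2).
have q3 : rho * (2 * M') < eps by apply/Rlt_div_r => //; lra.
apply: (Rle_lt_trans _ (/ (2 * PI * 1) * (2 * (2 * PI * (M' * rho))))).
  apply: Rmult_le_compat_l; first by apply: Rlt_le; apply: Rinv_0_lt_compat; lra.
  by apply: (Rle_trans _ _ _ b3); rewrite (_ : 2 * _ = 2 * PI * (M' * rho) + 2 * PI * (M' * rho)); [apply: Rplus_le_compat|ring].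
rewrite (_ : _ * _ = rho * (2 * M')) //; field; lra.
Qed.

Lemma circ_inv_pow rho t n : 0 < rho ->
  (/ circ rho t ^ n)%C = (RtoC (/ rho ^ n) * (cos (INR n * t), Ropp (sin (INR n * t))))%C.
Proof.
move=> r0; elim: n => [|n IH].
  rewrite /= Rmult_0_l cos_0 sin_0; apply: C_ext; rewrite /=; field.
have cn := @circ_neq0 rho t r0.
have -> : (/ circ rho t ^ n.+1 = / circ rho t * / circ rho t ^ n)%C.
  by rewrite Cpow_S; field; split => //; apply: Cpow_nz.
rewrite IH.
rewrite (_ : (/ circ rho t)%C = (RtoC (/ rho) * (cos t, Ropp (sin t)))%C); last first.
  have E : (circ rho t * (RtoC (/ rho) * (cos t, Ropp (sin t))) = 1)%C.
    have := sin2_cos2 t; rewrite /Rsqr => sc.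
    apply: C_ext; rewrite /=; last by field; lra.
    rewrite (_ : _ - _ = sin t * sin t + cos t * cos t) //; field; lra.
  by rewrite -[LHS]Cmult_1_r -E; field.
rewrite S_INR Rmult_plus_distr_r Rmult_1_l cos_plus sin_plus.
have pn : rho ^ n <> 0 by apply: pow_nonzero; lra.
by apply: C_ext; rewrite /=; field; lra.
Qed.

Lemma is_derive_scaled_cos (q c t : R) : c <> 0 ->
  is_derive (fun t : R => - (q * / c * cos (c * t))) t (q * sin (c * t)).
Proof. by move=> c0; auto_derive => //; field. Qed.

Lemma is_derive_scaled_sin (q c t : R) : c <> 0 ->
  is_derive (fun t : R => q * / c * sin (c * t)) t (q * cos (c * t)).
Proof. by move=> c0; auto_derive => //; field. Qed.

(** Exponent 0 is the bounded case and exponent 1 gives the value 1. Beyond that, the factor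
    [rho^(-n)] blows up, so the integral has to vanish exactly on each circle; it does, since the
    integrands have primitives of period [2 * PI]. *)
Lemma is_res_pow n : exists l, is_res (fun w => / w ^ n)%C l.
Proof.
case: n => [|n].
  exists (RtoC 0); apply: (@is_res_bounded 1 1); first lra.
    by move=> rho t h; apply: ccont_const.
  by move=> w _ /=; rewrite Cmod_inv ?Cmod_1; [lra|move=> []; lra].
have E rho t : 0 < rho -> (/ circ rho t ^ n.+1 * (Ci * circ rho t))%C = (RtoC (/ rho ^ n) * (sin (INR n * t), cos (INR n * t)))%C.
  move=> r0; have cn := @circ_neq0 rho t r0.
  rewrite (_ : _ * _ = Ci * / circ rho t ^ n)%C; last first.
    by rewrite Cpow_S; field; split => //; apply: Cpow_nz.
  rewrite circ_inv_pow //; apply: C_ext; rewrite /=; ring.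
have P := PI_RGT_0.
case: n E => [|n] E.
  exists (RtoC 1) => eps e0; exists 1; split; first lra; move=> rho [r0 _].
  exists 0, (2 * PI); split.
  - apply: (is_RInt_ext (fun _ => 0)).
      by move=> t _; rewrite E // /= Rmult_0_l sin_0 cos_0; field.
    by have := @is_RInt_const R_NormedModule 0 (2 * PI) 0; rewrite /scal /= /mult /= Rmult_0_r.
  - apply: (is_RInt_ext (fun _ => 1)).
      by move=> t _; rewrite E // /= Rmult_0_l sin_0 cos_0; field.
    by have := @is_RInt_const R_NormedModule 0 (2 * PI) 1; rewrite /scal /= /mult /= Rmult_1_r Rminus_0_r.
  - rewrite (_ : (0, 2 * PI) = (2 * PI * Ci)%C); last by apply: C_ext; rewrite /=; ring.
    rewrite Cinv_l; last exact: C2PiI_neq0.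
    by rewrite (_ : (_ - _) = 0)%C ?Cmod_0 //; ring.
exists (RtoC 0) => eps e0; exists 1; split; first lra; move=> rho [r0 _].
have n0 : INR n.+1 <> 0 by apply: not_0_INR.
have rn : rho ^ n.+1 <> 0 by apply: pow_nonzero; lra.
have s2 : sin (INR n.+1 * (2 * PI)) = 0.
  by rewrite -sin_0 -(sin_period 0 n.+1); congr sin; ring.
have c2 : cos (INR n.+1 * (2 * PI)) = 1.
  by rewrite -cos_0 -(cos_period 0 n.+1); congr cos; ring.
exists 0, 0; split.
- apply: (is_RInt_ext (fun t : R => / rho ^ n.+1 * sin (INR n.+1 * t))).
    by move=> t _; rewrite E // ReRp.
  have := @is_RInt_derive R_CompleteNormedModule (fun t : R => - (/ rho ^ n.+1 * / INR n.+1 * cos (INR n.+1 * t))) (fun t : R => / rho ^ n.+1 * sin (INR n.+1 * t)) 0 (2 * PI).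
  rewrite c2 Rmult_0_r cos_0 (_ : minus _ _ = 0); last by rewrite /minus /plus /opp /=; ring.
  apply => t _.
    exact: is_derive_scaled_cos.
  apply: (@continuous_mult _ R_AbsRing); first exact: continuous_const.
  by apply: (continuous_comp (fun t => INR n.+1 * t) sin); [apply: (@continuous_mult _ R_AbsRing); [exact: continuous_const|exact: continuous_id]|apply: continuous_sin].
- apply: (is_RInt_ext (fun t : R => / rho ^ n.+1 * cos (INR n.+1 * t))).
    by move=> t _; rewrite E // ImRp.
  have := @is_RInt_derive R_CompleteNormedModule (fun t : R => / rho ^ n.+1 * / INR n.+1 * sin (INR n.+1 * t)) (fun t : R => / rho ^ n.+1 * cos (INR n.+1 * t)) 0 (2 * PI).
  rewrite s2 (Rmult_0_r (INR n.+1)) sin_0 (_ : minus _ _ = 0); last by rewrite /minus /plus /opp /=; ring.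
  apply => t _.
    exact: is_derive_scaled_sin.
  apply: (@continuous_mult _ R_AbsRing); first exact: continuous_const.
  by apply: (continuous_comp (fun t => INR n.+1 * t) cos); [apply: (@continuous_mult _ R_AbsRing); [exact: continuous_const|exact: continuous_id]|apply: continuous_cos].
- rewrite (_ : (0, 0) = RtoC 0) // (_ : (_ - _) = 0)%C ?Cmod_0 //; ring.
Qed.

Lemma is_res_taylor rho m M f : 0 < rho <= 1 -> taylor_bounded rho m M f -> circ_cont rho f ->
  exists l, is_res (fun w => f w / w ^ m)%C l.
Proof.
move=> hr; elim: m f => [|m IH] f.
  move=> h cf; exists (RtoC 0); apply: (@is_res_ext rho f); first lra.
    by move=> w _ /=; field.
  by apply: (@is_res_bounded rho M) => //; lra.
move=> [c [f1 [h1 h2 h3]]] cf.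
(* [f1] is replaced by an explicit quotient, because continuity on circles is known for [f] but not
   for the witness [f1]. *)
set f2 := (fun w => (f w - c) / w)%C.
have e2 w : 0 < Cmod w <= rho -> f1 w = f2 w.
  by move=> hw; rewrite /f2 h3 //; field; apply/Cmod_gt_0; case: hw.
have [l hl] : exists l, is_res (fun w => f2 w / w ^ m)%C l.
  apply: IH; first exact: taylor_ext h2.
  move=> r t hrr; apply: ccont_mult.
    by apply: ccont_minus; [apply: cf|apply: ccont_const].
  by apply: ccont_inv; [apply: circ_neq0; lra|apply: ccont_circ].
have [l' hl'] := is_res_pow m.+1.
exists (c * l' + l)%C.
apply: (@is_res_ext rho _ _ _ _ _ (is_res_plus (is_res_scal c hl') hl)); first lra.
move=> w [w1 w2]; have w0 : w <> 0 by apply/Cmod_gt_0.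
rewrite /f2 Cpow_S; field; split => //; exact: Cpow_nz.
Qed.

(** A filter converging to [l] is Cauchy, so [lim] returns a genuine limit of it, which uniqueness
    identifies with [l]. *)
Lemma C_lim_eq (F : (C -> Prop) -> Prop) (l : C) : ProperFilter F ->
  (forall eps, 0 < eps -> F (fun z => Cmod (z - l)%C < eps)) ->
  @lim C_R_CompleteNormedModule F = l.
Proof.
move=> PF h.
have loc : filter_le F (@locally C_R_CompleteNormedModule l).
  move=> P [e he]; apply: (filter_imp _ _ _ (h e (cond_pos e))) => z hz; apply: he.
  by apply: C_NormedModule_mixin_compat1.
apply: (@is_filter_lim_unique _ C_R_NormedModule F) => //.
move=> P [e he]; refine (filter_imp _ _ _ (@complete_cauchy C_R_CompleteNormedModule F PF _ e)); first by move=> z; exact: he.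
by move=> eps; exists l; apply: loc; exists eps.
Qed.

Lemma is_res_residue f (z0 l : C) : is_res (fun w => f (z0 + w)%C) l -> residue f z0 = l.
Proof.
move=> h; apply: C_lim_eq => eps e0.
have [r0 [r00 hr]] := h eps e0.
exists (mkposreal _ r00) => rho hb r1.
have hrho : 0 < rho < r0.
  by move: hb; rewrite /ball /= /AbsRing_ball /= /abs /minus /plus /opp /= Ropp_0 Rplus_0_r Rabs_pos_eq; lra.
have [I1 [I2 [a b c]]] := hr rho hrho.
rewrite /filtermap /circle_integral (_ : @RInt C_R_CompleteNormedModule _ _ _ = ((I1, I2) : C)) //.
apply: (@is_RInt_unique C_R_CompleteNormedModule).
apply: (@is_RInt_fct_extend_pair R_NormedModule R_NormedModule).
  apply: is_RInt_ext a => t _.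
  by rewrite (_ : Ci * circ rho t = Ci * rho * (cos t, sin t))%C //; rewrite /circ; ring.
apply: is_RInt_ext b => t _.
by rewrite (_ : Ci * circ rho t = Ci * rho * (cos t, sin t))%C //; rewrite /circ; ring.
Qed.

(** * The main term of the divisor sum *)

Definition log_step (i : nat) : R := ln (INR i.+2) - ln (INR i.+1).

(* For [n = i + 2] this is [n^(-s) - \int_(n-1)^n u^(-s) du] at [s = 1 + w]. *)
Definition zeta_term (i : nat) (w : C) : C :=
  (cexp (RtoC (- ln (INR i.+2)) * w)
   * (RtoC (/ INR i.+2) - exprem 1 (RtoC (log_step i) * w) / w))%C.

Lemma log_step_bounds i :
  [/\ / INR i.+2 <= log_step i, log_step i <= / INR i.+1 & 0 < log_step i <= 1].
Proof.
have p1 : 1 <= INR i.+1 by apply: (le_INR 1); lia.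
have e : INR i.+2 = INR i.+1 + 1 by rewrite (S_INR i.+1).
have p2 : 0 < / INR i.+2 by apply: Rinv_0_lt_compat; lra.
have lo : / INR i.+2 <= log_step i.
  rewrite /log_step -ln_div; [|lra|lra].
  have := @ln_ge_1_inv (INR i.+2 / INR i.+1) ltac:(apply: Rdiv_lt_0_compat; lra).
  rewrite (_ : 1 - _ = / INR i.+2) //; rewrite e; field; lra.
have hi : log_step i <= / INR i.+1.
  have := @ln_ge_1_inv (INR i.+1 / INR i.+2) ltac:(apply: Rdiv_lt_0_compat; lra).
  rewrite ln_div; [|lra|lra]; rewrite /log_step.
  rewrite (_ : 1 - _ = - / INR i.+1); last by rewrite e; field; lra.
  lra.
have := Rinv_le_contravar 1 (INR i.+1) Rlt_0_1 p1; rewrite Rinv_1.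
by split => //; lra.
Qed.

(** With [n = i + 2], the exponential factor costs [n^(1/4)] on the disc of radius [1/4] and its
    powers of [ln n] at most another [n^(1/4)], up to a constant. The bracket is of size [n^(-2)],
    which leaves the summable exponent [-3/2]. *)
Lemma zeta_term_taylor k : exists K, 0 <= K /\ forall i,
  taylor_bounded (/ 4) k.+1 (K * Rpower (INR i.+2) (- (3 / 2))) (zeta_term i).
Proof.
have hr : 0 < / 4 <= 1 by lra.
have [A [A0 hA]] := @pow_le_exp k.+1 (/ 4) ltac:(lra).
(* The factors are [2^(k+2)] from [exprem_bound], [exp 1] above [exp (h / 4)], and 4 from
   [h <= 2 / n]. *)
set B := 2 ^ k.+2 * exp 1 * 4.
have e1 : 1 < exp 1 by have := exp_ineq1_le 1; lra.
have t1 : 1 <= 2 ^ k.+2 by apply: pow_R1_Rle; lra.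
have B2 : 2 <= B by rewrite /B; nra.
exists (4 ^ k.+1 * ((2 ^ k.+1 * A) * B)); split.
  by do !(apply: Rmult_le_pos); (try apply: pow_le); try lra.
move=> i; have [lo hi [h0 h1]] := log_step_bounds i.
have p1 : 1 <= INR i.+1 by apply: (le_INR 1); lia.
have e : INR i.+2 = INR i.+1 + 1 by rewrite (S_INR i.+1).
set n := INR i.+2 in lo e *; set h := log_step i in lo hi h0 h1 *.
have n2 : 2 <= n by lra.
have L0 : 0 <= ln n by rewrite -ln_1; apply: ln_le; lra.
have i0 : 0 < / n by apply: Rinv_0_lt_compat; lra.
have him : / INR i.+1 <= 2 * / n.
  rewrite (_ : 2 * / n = / (n / 2)); last by field; lra.
  by apply: Rinv_le_contravar; lra.
set M1 := 2 ^ k.+1 * A * Rpower n (/ 2).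
set M2 := B * (/ n * / n).
have M10 : 0 <= M1.
  by do !(apply: Rmult_le_pos); (try apply: pow_le); try lra; apply: Rlt_le (Rpower_pos _ _).
have M20 : 0 <= M2 by rewrite /M2; nra.
have T1 : taylor_bounded (/ 4) k.+1 M1 (fun w => cexp (RtoC (- ln n) * w))%C.
  apply: (@taylor_ext _ k.+1 _ (fun w => exprem 0 (RtoC (- ln n) * w) / w ^ 0)%C).
    by move=> w _ /=; field.
  apply: taylor_exprem => // j hj.
  rewrite Rabs_Ropp Rabs_pos_eq //.
  have a1 : 2 ^ j <= 2 ^ k.+1 by apply: Rle_pow; [lra|lia].
  have a2 : ln n ^ j <= (1 + ln n) ^ k.+1.
    apply: (Rle_trans _ ((1 + ln n) ^ j)); first by apply: pow_incr; lra.
    by apply: Rle_pow; [lra|lia].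
  have a3 := hA (ln n) L0.
  rewrite /M1 (_ : Rpower n (/ 2) = exp (/ 4 * ln n) * exp (ln n * / 4)); last first.
    by rewrite /Rpower -exp_plus; congr exp; field.
  rewrite -[X in _ <= X]Rmult_assoc.
  apply: Rmult_le_compat_r; first exact: Rlt_le (exp_pos _).
  rewrite Rmult_assoc; apply: Rmult_le_compat => //; [apply: pow_le; lra|exact: pow_le|lra].
have T2 : taylor_bounded (/ 4) k.+1 M2 (fun w => RtoC (/ n) - exprem 1 (RtoC h * w) / w)%C.
  (* The summand [1/n] and the integral [h] agree to leading order, so the constant coefficient is
     [O(n^(-2))]; the higher ones carry at least [h^2]. *)
  exists (RtoC (/ n - h)), (fun w => RtoC (-1) * (exprem 2 (RtoC h * w) / w ^ 2))%C; split.
  - rewrite Cmod_R -Rabs_Ropp Rabs_pos_eq; last lra.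
    apply: (Rle_trans _ (2 * (/ n * / n))); last first.
      by rewrite /M2; apply: Rmult_le_compat_r => //; nra.
    apply: (Rle_trans _ (/ INR i.+1 - / n)); first lra.
    rewrite (_ : / INR i.+1 - / n = / INR i.+1 * / n); last by rewrite e; field; lra.
    nra.
  - apply: (@taylor_le _ _ (Cmod (RtoC (-1)) * M2)).
      by rewrite Cmod_R Rabs_Ropp Rabs_R1; lra.
    apply: taylor_scal.
    apply: taylor_exprem => // j hj.
    rewrite Rabs_pos_eq; last lra.
    have a1 : 2 ^ j <= 2 ^ k.+2 by apply: Rle_pow; [lra|lia].
    have a2 : h ^ j <= 4 * (/ n * / n).
      rewrite (_ : j = (2 + (j - 2))%coq_nat)%N; last lia.
      rewrite pow_add.
      have b1 : h ^ (j - 2) <= 1 by rewrite -(pow1 (j - 2)); apply: pow_incr; lra.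
      have b2 : 0 <= h ^ (j - 2) by apply: pow_le; lra.
      have b3 : h ^ 2 <= 4 * (/ n * / n) by rewrite /=; nra.
      have b4 : 0 <= h ^ 2 by apply: pow_le; lra.
      nra.
    have a3 : exp (h * / 4) <= exp 1 by apply: exp_le; lra.
    rewrite /M2 /B (_ : 2 ^ k.+2 * exp 1 * 4 * (/ n * / n) = (2 ^ k.+2 * (4 * (/ n * / n))) * exp 1); last by ring.
    apply: Rmult_le_compat => //.
    + by apply: Rmult_le_pos; apply: pow_le; lra.
    + exact: Rlt_le (exp_pos _).
    + by apply: Rmult_le_compat => //; apply: pow_le; lra.
  - move=> w [w1 w2]; have w0 : w <> 0 by apply/Cmod_gt_0.
    rewrite (_ : exprem 2 _ = exprem 1 (RtoC h * w) - (RtoC h * w) ^ 1 * RtoC (/ INR (fact 1)))%C //.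
    rewrite [fact 1]/= [INR 1]/= Rinv_1 RtoC_minus.
    by set E := exprem 1 _; rewrite /=; field.
have T3 := taylor_mult hr M10 M20 T1 T2.
apply: taylor_le T3; apply: Req_le.
have -> : Rpower n (- (3 / 2)) = Rpower n (/ 2) * (/ n * / n).
  rewrite -{3 4}(Rpower_1 n); last lra.
  rewrite -Rpower_Ropp -!Rpower_plus; congr Rpower; lra.
by rewrite /M1 /M2; ring.
Qed.

Lemma ex_series_zeta_bound K : ex_series (fun i => K * Rpower (INR i.+2) (- (3 / 2))).
Proof.
apply: (@ex_series_scal R_AbsRing R_NormedModule K (fun i => Rpower (INR i.+2) (- (3 / 2)))).
have := @ex_series_zeta (3 / 2) ltac:(lra).
by move/ex_series_incr_1.
Qed.

Lemma zeta_term_bounded : exists K, 0 <= K /\ forall i w, 0 < Cmod w <= / 4 ->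
  Cmod (zeta_term i w) <= K * Rpower (INR i.+2) (- (3 / 2)).
Proof.
have [K [K0 hK]] := zeta_term_taylor 0.
exists (2 * K); split; first lra.
move=> i w hw; rewrite Rmult_assoc.
have p : 0 <= K * Rpower (INR i.+2) (- (3 / 2)).
  by apply: Rmult_le_pos => //; apply: Rlt_le (Rpower_pos _ _).
have hr : 0 < / 4 <= 1 by lra.
exact: (taylor_down hr p (hK i)).
Qed.

Lemma zeta_remainder_ex : exists H : C -> C, forall w, 0 < Cmod w <= / 4 ->
  clim (csum (zeta_term^~ w)) (H w).
Proof.
have [K [K0 hK]] := zeta_term_bounded.
have h w : exists l, 0 < Cmod w <= / 4 -> clim (csum (zeta_term^~ w)) l.
  have [hw|n] := classic (0 < Cmod w <= / 4); last by exists (RtoC 0).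
  have [l hl] := csum_conv (fun i => hK i w hw) (ex_series_zeta_bound K).
  by exists l.
exists (fun w => proj1_sig (constructive_indefinite_description _ (h w))) => w.
by case: constructive_indefinite_description.
Qed.

(** [zeta_term] is the increment of the approximants, and the approximant of index 0 is
    [1 + 1 / w]. *)
Lemma zeta_approxE (w : C) N : w <> 0 ->
  zeta_approx (1 + w)%C N = (1 + / w + csum (zeta_term^~ w) N)%C.
Proof.
move=> w0; rewrite /zeta_approx.
have Ew : (1 - (1 + w) = - w)%C by ring.
have E1 n : cpow (INR n.+1) (1 - (1 + w))%C = cexp (RtoC (- ln (INR n.+1)) * w)%C.
  by rewrite Ew cpowE; congr cexp; rewrite RtoC_opp; ring.
have E2 n : cpow (INR n.+1) (- (1 + w))%C = (RtoC (/ INR n.+1) * cexp (RtoC (- ln (INR n.+1)) * w))%C.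
  have p : 0 < INR n.+1 by apply: lt_0_INR; lia.
  rewrite cpowE (_ : - (1 + w) * ln (INR n.+1) = RtoC (- ln (INR n.+1)) + RtoC (- ln (INR n.+1)) * w)%C.
    rewrite cexpD; congr Cmult; rewrite /cexp !ReImE exp_Ropp exp_ln // cos_0 sin_0.
    by apply: C_ext; rewrite /= ?Rmult_1_r ?Rmult_0_r.
  by rewrite RtoC_opp; ring.
elim: N => [|N IH].
  rewrite sum_O E1 E2 Ew ln_1 (_ : RtoC (- 0) * w = 0)%C; last by rewrite RtoC_opp; ring.
  rewrite (_ : cexp 0 = 1); last by apply: C_ext; rewrite /= exp_0 ?cos_0 ?sin_0; ring.
  by rewrite /= Rinv_1; field.
rewrite sum_Sn; change (@plus C_AbelianMonoid) with Cplus.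
rewrite [csum _ _]/= Cplus_assoc -IH.
rewrite !E1 E2 Ew /zeta_term.
have -> : exprem 1 (RtoC (log_step N) * w)%C = (cexp (RtoC (log_step N) * w) - 1)%C.
  by rewrite /= Rinv_1; ring.
have -> : cexp (RtoC (- ln (INR N.+1)) * w)%C = (cexp (RtoC (- ln (INR N.+2)) * w) * cexp (RtoC (log_step N) * w))%C.
  rewrite -cexpD; congr cexp; rewrite /log_step RtoC_minus !RtoC_opp; ring.
by field.
Qed.

Lemma zetaE (H : C -> C) (w : C) : w <> 0 -> clim (csum (zeta_term^~ w)) (H w) ->
  zeta (1 + w)%C = (1 + / w + H w)%C.
Proof.
move=> w0 h; apply: C_lim_eq => eps e0.
have [N hN] := h eps e0; exists N => n hn.
rewrite zeta_approxE //.
have -> : (1 + / w + csum (zeta_term^~ w) n - (1 + / w + H w) = csum (zeta_term^~ w) n - H w)%C by field.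
by apply: hN; lia.
Qed.

(** [1 / (1 + w) = 1 - w / (1 + w)] reproduces the function up to sign, so one bound serves every
    order. *)
Lemma taylor_inv1w k : taylor_bounded (/ 4) k 2 (fun w => / (1 + w))%C.
Proof.
have n0 (w : C) : 0 < Cmod w <= / 4 -> / 2 <= Cmod (1 + w)%C.
  move=> hw; have := Cmod_triangle (1 + w)%C (- w)%C; rewrite Cmod_opp.
  by have -> : (1 + w + - w = 1)%C; [ring|rewrite Cmod_1; lra].
have nz (w : C) : 0 < Cmod w <= / 4 -> (1 + w)%C <> 0.
  by move=> /n0 h; apply/Cmod_gt_0; lra.
elim: k => [|k IH].
  move=> w hw /=; rewrite Cmod_inv; last exact: nz.
  rewrite -(Rinv_inv 2); apply: Rinv_le_contravar; first lra.
  exact: n0.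
exists (RtoC 1), (fun w => RtoC (-1) * (/ (1 + w)))%C; split.
- rewrite Cmod_1; lra.
- apply: (@taylor_le _ _ (Cmod (RtoC (-1)) * 2)); first by rewrite Cmod_R Rabs_Ropp Rabs_R1; lra.
  exact: taylor_scal.
- by move=> w hw; field; apply: nz.
Qed.

Lemma taylor_pow rho k M f n : 0 < rho <= 1 -> 0 <= M -> taylor_bounded rho k M f ->
  exists M', 0 <= M' /\ taylor_bounded rho k M' (fun w => f w ^ n)%C.
Proof.
move=> hr M0 h; elim: n => [|n [M' [M0' h']]].
  by exists 1; split; [lra|apply: taylor_const; rewrite Cmod_1; lra].
exists (4 ^ k * (M * M')); split; last exact: (taylor_mult hr M0 M0' h h').
by do !(apply: Rmult_le_pos) => //; apply: pow_le; lra.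
Qed.

Lemma zeta_pow_taylor k : exists (f : C -> C) (M : R),
  [/\ taylor_bounded (/ 4) k M f, circ_cont (/ 4) f &
      forall w, 0 < Cmod w <= / 4 -> (zeta (1 + w) ^ k / (1 + w) = f w / w ^ k)%C].
Proof.
have hr : 0 < / 4 <= 1 by lra.
have [H hH] := zeta_remainder_ex.
have [K [K0 hK]] := zeta_term_taylor k.
set Mi := fun i => K * Rpower (INR i.+2) (- (3 / 2)).
have Mi0 i : 0 <= Mi i by apply: Rmult_le_pos => //; apply: Rlt_le (Rpower_pos _ _).
have TH := taylor_series hr hK Mi0 (ex_series_zeta_bound K) hH.
have S0 : 0 <= Series Mi by apply: Rle_trans (rsum_le_Series 0 Mi0 (ex_series_zeta_bound K)); rewrite /=; lra.
(* [Phi w] is [w * zeta (1 + w)]: the pole is removed, and the power [k] leaves [w^k] in the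
   denominator. *)
set Phi := (fun w : C => 1 + w * (1 + H w))%C.
have TPhi : taylor_bounded (/ 4) k (1 + 2 * (1 + 2 * Series Mi)) Phi.
  apply: taylor_plus; first by apply: taylor_const; rewrite Cmod_1; lra.
  apply: (taylor_down hr); first lra.
  apply: taylor_mulw; first lra.
  apply: taylor_plus; first by apply: taylor_const; rewrite Cmod_1; lra.
  exact: (taylor_down hr).
have cH : circ_cont (/ 4) H.
  move=> rho t hrho.
  have hm u : 0 < Cmod (circ rho u) <= / 4 by rewrite Cmod_circ; lra.
  have [K' [K0' hK']] := zeta_term_bounded.
  apply: (@ccont_series (fun i u => zeta_term i (circ rho u)) _ (fun i => K' * Rpower (INR i.+2) (- (3 / 2)))).
  - move=> i u; apply: ccont_mult.
      by apply: ccont_cexp; apply: ccont_mult; [apply: ccont_const|apply: ccont_circ].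
    apply: ccont_minus; first exact: ccont_const.
    apply: ccont_mult.
      by apply: ccont_exprem; apply: ccont_mult; [apply: ccont_const|apply: ccont_circ].
    by apply: ccont_inv; [apply: circ_neq0; lra|apply: ccont_circ].
  - by move=> i u; apply: hK'.
  - by move=> i; apply: Rmult_le_pos => //; apply: Rlt_le (Rpower_pos _ _).
  - exact: ex_series_zeta_bound.
  - by move=> u; apply: hH.
have P0 : 0 <= 1 + 2 * (1 + 2 * Series Mi) by lra.
have [M' [M0' TP]] := taylor_pow k hr P0 TPhi.
exists (fun w => Phi w ^ k * / (1 + w))%C, (4 ^ k * (M' * 2)); split.
- by apply: taylor_mult => //; [lra|apply: taylor_inv1w].
- move=> rho t hrho.
  have hm u : 0 < Cmod (circ rho u) <= / 4 by rewrite Cmod_circ; lra.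
  apply: ccont_mult.
    apply: ccont_pow; apply: ccont_plus; first exact: ccont_const.
    apply: ccont_mult; first exact: ccont_circ.
    by apply: ccont_plus; [exact: ccont_const|exact: cH].
  apply: ccont_inv; last by apply: ccont_plus; [exact: ccont_const|exact: ccont_circ].
  apply/Cmod_gt_0; have := Cmod_triangle (1 + circ rho t)%C (- circ rho t)%C; rewrite Cmod_opp.
  have -> : (1 + circ rho t + - circ rho t = 1)%C by ring.
  by rewrite Cmod_1; have := hm t; lra.
- move=> w hw; have w0 : w <> 0 by apply/Cmod_gt_0; case: hw.
  rewrite (zetaE w0 (hH w hw)).
  have -> : (1 + / w + H w = Phi w * / w)%C by rewrite /Phi; field.
  rewrite Cpow_mult_l Cpow_inv // /Cdiv; ring.
Qed.

(** Write [x^(1+w) = x exp(t w)] with [t = ln x]. The term [(t w)^j / j!] lowers the pole order by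
    [j], so its residue is [t^j / j!] times a number [l j] free of [x]. The exponential remainder of
    order [k + 1] cancels the pole and leaves a bounded function, of residue 0. *)
Lemma main_term_poly k : exists p : nat -> R, forall x, 0 < x ->
  main_term k.+1 x = x * sum_f_R0 (fun j => p j * ln x ^ j) k.
Proof.
have [f [M [Tf cf Ef]]] := zeta_pow_taylor k.+1.
have hr : 0 < / 4 <= 1 by lra.
(* [is_res_taylor] wants a Taylor order equal to the pole order, so all lower orders are derived
   first. *)
have Td j : (j <= k.+1)%N -> exists M', taylor_bounded (/ 4) (k.+1 - j) M' f.
  elim: j => [|j IH] hj; first by exists M; rewrite subn0.
  have [M' h] := IH (ltnW hj).
  exists (2 * Rabs M').
  rewrite (_ : k.+1 - j = (k.+1 - j.+1).+1)%N in h; last lia.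
  apply: (taylor_down hr (Rabs_pos _)); apply: taylor_le h; exact: Rle_abs.
have [l hl] : exists l : nat -> C, forall j, (j <= k.+1)%N -> is_res (fun w => f w / w ^ (k.+1 - j))%C (l j).
  have h j : exists l, (j <= k.+1)%N -> is_res (fun w => f w / w ^ (k.+1 - j))%C l.
    have [hj|n] := boolP (j <= k.+1)%N; last by exists (RtoC 0).
    have [M' h] := Td j hj.
    by have [l hl] := is_res_taylor hr h cf; exists l.
  exists (fun j => proj1_sig (constructive_indefinite_description _ (h j))) => j.
  by case: constructive_indefinite_description.
exists (fun j => / INR (fact j) * Re (l j)) => x x0.
set t := ln x.
(* [cexp] minus [exprem j] is the Taylor polynomial with [j] terms; its residues are collected one
   term at a time. *)
have part j : (j <= k.+1)%N -> is_res (fun w => f w / w ^ k.+1 * (cexp (RtoC t * w) - exprem j (RtoC t * w)))%C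
    (csum (fun i => RtoC (t ^ i * / INR (fact i)) * l i)%C j).
  elim: j => [|j IH] hj.
    apply: (@is_res_bounded 1 0); first lra.
      move=> rho u h; apply: (@ccont_ext (fun _ => RtoC 0)); last exact: ccont_const.
      by move=> v /=; ring.
    by move=> w _ /=; rewrite (_ : _ * _ = 0)%C ?Cmod_0; [lra|ring].
  have := is_res_plus (IH (ltnW hj)) (is_res_scal (RtoC (t ^ j * / INR (fact j))) (hl j (ltnW hj))).
  apply: (@is_res_ext 1); first lra.
  move=> w [w1 _]; have w0 : w <> 0 by apply/Cmod_gt_0.
  rewrite [exprem j.+1 _]/= Cpow_mult_l RtoC_mult RtoC_pow.
  have -> : (w ^ k.+1 = w ^ j * w ^ (k.+1 - j))%C.
    by rewrite -Cpow_add_r; congr Cpow; lia.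
  by field; split; apply: Cpow_nz.
have rem : is_res (fun w => f w / w ^ k.+1 * exprem k.+1 (RtoC t * w))%C 0.
  have [M' Tf0] := Td k.+1 (leqnn _); rewrite subnn in Tf0.
  have Te := @taylor_exprem (/ 4) hr 0 k.+1 t (2 ^ k.+1 * Rabs t ^ k.+1 * exp (Rabs t * / 4)).
  apply: (@is_res_bounded (/ 4) (Rabs M' * (2 ^ k.+1 * Rabs t ^ k.+1 * exp (Rabs t * / 4)))); first lra.
    move=> rho u hrho; apply: ccont_mult.
      apply: ccont_mult; first exact: cf.
      apply: ccont_inv; first by apply: Cpow_nz; apply: circ_neq0; lra.
      by apply: ccont_pow; apply: ccont_circ.
    by apply: ccont_exprem; apply: ccont_mult; [apply: ccont_const|apply: ccont_circ].
  move=> w hw; have w0 : w <> 0 by apply/Cmod_gt_0; case: hw.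
  have -> : (f w / w ^ k.+1 * exprem k.+1 (RtoC t * w) = f w * (exprem k.+1 (RtoC t * w) / w ^ k.+1))%C.
    by field; apply: Cpow_nz.
  rewrite Cmod_mult; apply: Rmult_le_compat; try exact: Cmod_ge_0.
    by apply: Rle_trans (Rle_abs M'); apply: Tf0.
  apply: Te => // j hj; rewrite (_ : j = k.+1); [exact: Rle_refl|lia].
have tot : is_res (fun w => zeta (1 + w) ^ k.+1 * cpow x (1 + w) / (1 + w))%C
   (RtoC x * (csum (fun i => RtoC (t ^ i * / INR (fact i)) * l i) k.+1 + 0))%C.
  have := is_res_scal (RtoC x) (is_res_plus (part k.+1 (leqnn _)) rem).
  apply: (@is_res_ext (/ 4)); first lra.
  move=> w hw; have w0 : w <> 0 by apply/Cmod_gt_0; case: hw.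
  have -> : cpow x (1 + w)%C = (RtoC x * cexp (RtoC t * w))%C.
    rewrite cpowE (_ : (1 + w) * ln x = RtoC t + RtoC t * w)%C; last by rewrite /t; ring.
    rewrite cexpD; congr Cmult; rewrite /cexp !ReImE /t exp_ln // cos_0 sin_0.
    by apply: C_ext; rewrite /=; ring.
  have -> : (zeta (1 + w) ^ k.+1 * (RtoC x * cexp (RtoC t * w)) / (1 + w) = RtoC x * ((zeta (1 + w) ^ k.+1 / (1 + w)) * cexp (RtoC t * w)))%C.
    by rewrite /Cdiv; ring.
  by rewrite Ef // /Cdiv; ring.
rewrite /main_term (is_res_residue tot) Cplus_0_r ReM ReR ImR Rmult_0_l Rminus_0_r csum_Re sum_n_Reals.
congr (_ * _); apply: PartSum.sum_eq => i _.
by rewrite ReM ReR ImR; ring.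
Qed.

(** * The Moebius expansion of the coprimality conditions *)

HB.instance Definition _ := Monoid.isComLaw.Build R 0 Rplus
  (fun x y z => esym (Rplus_assoc x y z)) Rplus_comm Rplus_0_l.
HB.instance Definition _ := Monoid.isComLaw.Build R 1 Rmult
  (fun x y z => esym (Rmult_assoc x y z)) Rmult_comm Rmult_1_l.
HB.instance Definition _ := Monoid.isMulLaw.Build R 0 Rmult Rmult_0_l Rmult_0_r.
HB.instance Definition _ := Monoid.isAddLaw.Build R Rmult Rplus
  (fun x y z => Rmult_plus_distr_r x y z) (fun x y z => Rmult_plus_distr_l x y z).

Section RealBigops.
Context {I : Type}.
Implicit Types (s : seq I) (P : pred I).

Lemma INR_sum s P (F : I -> nat) :
  INR (\sum_(i <- s | P i) F i)%N = \big[Rplus/0]_(i <- s | P i) INR (F i).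
Proof. by apply: (big_morph INR) => // x y; apply: plus_INR. Qed.

Lemma INR_prod s P (F : I -> nat) :
  INR (\prod_(i <- s | P i) F i)%N = \big[Rmult/1]_(i <- s | P i) INR (F i).
Proof. by apply: (big_morph INR) => // x y; apply: mult_INR. Qed.

Lemma Rsum_le s P (F G : I -> R) : (forall i, P i -> F i <= G i) ->
  \big[Rplus/0]_(i <- s | P i) F i <= \big[Rplus/0]_(i <- s | P i) G i.
Proof.
move=> h; apply: (big_ind2 Rle) => //; first exact: Rle_refl.
by move=> *; apply: Rplus_le_compat.
Qed.

Lemma Rsum_ge0 s P (F : I -> R) : (forall i, P i -> 0 <= F i) ->
  0 <= \big[Rplus/0]_(i <- s | P i) F i.
Proof.
move=> h; apply: (big_ind (Rle 0)) => //; first exact: Rle_refl.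
by move=> *; apply: Rplus_le_le_0_compat.
Qed.

Lemma Rprod_ge0 s P (F : I -> R) : (forall i, P i -> 0 <= F i) ->
  0 <= \big[Rmult/1]_(i <- s | P i) F i.
Proof.
move=> h; apply: (big_ind (Rle 0)) => //; first exact: Rle_0_1.
by move=> *; apply: Rmult_le_pos.
Qed.

Lemma Rprod_le s P (F G : I -> R) : (forall i, P i -> 0 <= F i <= G i) ->
  \big[Rmult/1]_(i <- s | P i) F i <= \big[Rmult/1]_(i <- s | P i) G i.
Proof.
move=> h; suff [] : 0 <= \big[Rmult/1]_(i <- s | P i) F i <= \big[Rmult/1]_(i <- s | P i) G i by [].
apply: (big_ind2 (fun x y => 0 <= x <= y)) => //; first by lra.
by move=> x y x' y' [? ?] [? ?]; split; [apply: Rmult_le_pos|apply: Rmult_le_compat].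
Qed.

Lemma Rabs_sum_le s P (F : I -> R) :
  Rabs (\big[Rplus/0]_(i <- s | P i) F i) <= \big[Rplus/0]_(i <- s | P i) Rabs (F i).
Proof.
apply: (big_ind2 (fun x y => Rabs x <= y)) => [|x x' y y' h h'|i _]; last exact: Rle_refl.
  by rewrite Rabs_R0; lra.
by apply: (Rle_trans _ _ _ (Rabs_triang _ _)); lra.
Qed.

Lemma Rabs_prod s P (F : I -> R) :
  Rabs (\big[Rmult/1]_(i <- s | P i) F i) = \big[Rmult/1]_(i <- s | P i) Rabs (F i).
Proof. by apply: (big_morph Rabs) => [x y|]; [apply: Rabs_mult|apply: Rabs_R1]. Qed.

Lemma Rsum_const_mul s P (F : I -> R) c :
  \big[Rplus/0]_(i <- s | P i) (c * F i) = c * \big[Rplus/0]_(i <- s | P i) F i.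
Proof. by rewrite big_distrr. Qed.

End RealBigops.

Notation bR b := (INR (nat_of_bool b)).

Lemma bRM b c : bR (b && c) = bR b * bR c.
Proof. by case: b; case: c; rewrite /=; ring. Qed.

Lemma bR_forall (I : finType) (P : pred I) : bR [forall i, P i] = \big[Rmult/1]_i bR (P i).
Proof.
case: forallP => h; first by rewrite big1 // => i _; rewrite h.
have [i /negbTE hi] : exists i, ~~ P i.
  by apply/existsP; rewrite -negb_forall; apply/forallP.
by rewrite (bigD1 i) //= hi Rmult_0_l.
Qed.

Lemma INR_card (I : finType) (P : pred I) : INR #|[set i | P i]| = \big[Rplus/0]_i bR (P i).
Proof.
rewrite -sum1_card INR_sum big_mkcond /=; apply: eq_bigr => i _.
by rewrite inE; case: (P i).
Qed.

Definition squarefree (n : nat) : bool := all (fun p => logn p n == 1%N) (primes n).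

Definition mu (n : nat) : R := if squarefree n then (-1) ^ size (primes n) else 0.

Lemma mu_le1 n : Rabs (mu n) <= 1.
Proof.
rewrite /mu; case: ifP => _; first by rewrite pow_1_abs; lra.
by rewrite Rabs_R0; lra.
Qed.

Lemma mu_mul_prime p e : prime p -> (0 < e)%N ->
  mu (p * e)%N = if (p %| e)%N then 0 else - mu e.
Proof.
move=> pp e0; have p0 := prime_gt0 pp.
case: ifP => hp.
  rewrite /mu; case: ifP => // /allP /(_ p).
  rewrite primesM // primes_prime // inE eqxx => /(_ isT).
  rewrite lognM // logn_prime // eqxx => /eqP [].
  by have := @pfactor_dvdn p 1 e pp e0; rewrite expn1 hp; case: (logn p e).
have pe : perm_eq (primes (p * e)) (p :: primes e).
  apply: uniq_perm; first exact: primes_uniq.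
    by rewrite /= primes_uniq mem_primes hp !andbF.
  by move=> q; rewrite primesM // primes_prime // !inE.
rewrite /mu /squarefree (perm_all _ pe) (perm_size pe) /=.
rewrite lognM // logn_prime // eqxx (_ : logn p e = 0%N); last first.
  by have := @pfactor_dvdn p 1 e pp e0; rewrite expn1 hp; case: (logn p e).
rewrite addn0 eqxx andTb.
rewrite (_ : all _ _ = all (fun q => logn q e == 1%N) (primes e)); last first.
  apply: eq_in_all => q hq; rewrite lognM // logn_prime //.
  case: (q =P p) => [E|] //; by move: hq; rewrite E mem_primes hp !andbF.
by case: ifP => _; ring.
Qed.

(** Fix a prime [p] dividing [n]. Divisors [p * e] with [p] not dividing [e] contribute [- mu e] and
    cancel the divisors prime to [p], which are the same for [n] and [n / p]; all other terms
    vanish. *)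
Lemma sum_mu_divisors n : (0 < n)%N ->
  \big[Rplus/0]_(d <- divisors n) mu d = bR (n == 1%N).
Proof.
move=> n0; case: (n =P 1%N) => [->|n1].
  by rewrite (_ : divisors 1 = [:: 1%N]) // big_seq1 /mu /squarefree.
have n2 : (1 < n)%N by lia.
have pp := pdiv_prime n2; set p := pdiv n in pp.
have p0 := prime_gt0 pp.
have pn : (p %| n)%N := pdiv_dvd n.
have q0 : (0 < n %/ p)%N by rewrite divn_gt0 // dvdn_leq.
rewrite (bigID (fun d => p %| d)%N) /= -big_filter.
have pe : perm_eq [seq d <- divisors n | p %| d]%N [seq (p * e)%N | e <- divisors (n %/ p)].
  apply: uniq_perm; first by rewrite filter_uniq // divisors_uniq.
    rewrite map_inj_in_uniq ?divisors_uniq // => x y _ _ /eqP.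
    by rewrite eqn_pmul2l // => /eqP.
  move=> d; rewrite mem_filter -dvdn_divisors //; apply/andP/mapP.
    move=> [/dvdnP [e ->] h]; exists e; last by rewrite mulnC.
    by rewrite -dvdn_divisors // dvdn_divRL.
  move=> [e]; rewrite -dvdn_divisors // => h ->.
  by rewrite dvdn_mulr // mulnC -dvdn_divRL.
rewrite (perm_big _ pe) /= big_map.
rewrite (eq_big_seq (fun e => if (p %| e)%N then 0 else - mu e)); last first.
  move=> e; rewrite -dvdn_divisors // => h; apply: mu_mul_prime => //.
  exact: dvdn_gt0 h.
rewrite (_ : \big[Rplus/0]_(e <- _) _ = \big[Rplus/0]_(e <- divisors (n %/ p) | ~~ (p %| e)%N) (- mu e)); last first.
  by rewrite [RHS]big_mkcond /=; apply: eq_bigr => e _; case: (_ %| _)%N.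
have -> : \big[Rplus/0]_(e <- divisors (n %/ p) | ~~ (p %| e)%N) (- mu e) = - \big[Rplus/0]_(e <- divisors (n %/ p) | ~~ (p %| e)%N) mu e.
  by apply/esym/(big_morph Ropp) => [x y|]; ring.
have pe2 : perm_eq [seq d <- divisors n | ~~ (p %| d)]%N [seq d <- divisors (n %/ p) | ~~ (p %| d)]%N.
  apply: uniq_perm; try by rewrite filter_uniq // divisors_uniq.
  move=> d; rewrite !mem_filter -!dvdn_divisors //; case: (boolP (p %| d)%N) => //= hd.
  rewrite -{1}(divnK pn) mulnC Gauss_dvdr //.
  by rewrite coprime_sym prime_coprime.
rewrite -(big_filter (divisors n)) -(big_filter (divisors (n %/ p))) (perm_big _ pe2) /=.
ring.
Qed.

(** Puts the identity over a fixed range, since all coprimality conditions are expanded over one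
    common box. *)
Lemma sum_mu_ord N n : (0 < n <= N)%N ->
  \big[Rplus/0]_(d < N) (mu d.+1 * bR (d.+1 %| n)%N) = bR (n == 1%N).
Proof.
move=> /andP[n0 nN]; rewrite -sum_mu_divisors //.
rewrite -(big_mkord xpredT (fun d => mu d.+1 * bR (d.+1 %| n)%N)).
have -> : \big[Rplus/0]_(0 <= d < N) (mu d.+1 * bR (d.+1 %| n)%N) = \big[Rplus/0]_(1 <= d < N.+1) (mu d * bR (d %| n)%N).
  by rewrite big_add1.
rewrite (_ : \big[Rplus/0]_(1 <= d < N.+1) _ = \big[Rplus/0]_(1 <= d < N.+1 | (d %| n)%N) mu d); last first.
  by rewrite [RHS]big_mkcond /=; apply: eq_bigr => d _; case: (_ %| _)%N => /=; ring.
rewrite -big_filter; apply: perm_big; apply: uniq_perm.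
- by rewrite filter_uniq // iota_uniq.
- exact: divisors_uniq.
- move=> d; rewrite mem_filter mem_index_iota -dvdn_divisors //.
  case: (boolP (d %| n)%N) => //= h; have := dvdn_gt0 n0 h; have := dvdn_leq n0 h; lia.
Qed.

Section ConflictFormula.
Variables r k : nat.

(* Pairs of matrix entries that have to be coprime. *)
Definition conflict : finType :=
  {e : ('I_r * 'I_k) * ('I_r * 'I_k) | (e.2.1 < e.1.1)%N && (e.1.2 < e.2.2)%N}.

Definition touches (e : conflict) (a : 'I_r * 'I_k) := ((val e).1 == a) || ((val e).2 == a).

(** An entry must be divisible by [d e] for each conflict [e] it takes part in, that is, by their
    lcm. *)
Definition entry_lcm (d : conflict -> nat) (i : 'I_r) (j : 'I_k) : nat :=
  \big[lcmn/1%N]_(e | touches e (i, j)) d e.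

Definition row_lcm (d : conflict -> nat) (i : 'I_r) : nat := (\prod_(j < k) entry_lcm d i j)%N.

Lemma biglcm_dvd (I : finType) (P : pred I) (F : I -> nat) m :
  (\big[lcmn/1%N]_(i | P i) F i %| m)%N = [forall i, P i ==> (F i %| m)%N].
Proof.
rewrite -big_andE; apply: (big_morph (fun x => x %| m)%N) => [x y|]; last exact: dvd1n.
by rewrite dvdn_lcm.
Qed.

Lemma biglcm_gt0 (I : finType) (P : pred I) (F : I -> nat) : (forall i, P i -> 0 < F i)%N ->
  (0 < \big[lcmn/1%N]_(i | P i) F i)%N.
Proof. by move=> h; apply: (big_ind (fun x => 0 < x)%N) => // x y; rewrite lcmn_gt0 => -> ->. Qed.

Lemma entry_lcm_gt0 d i j : (forall e, 0 < d e)%N -> (0 < entry_lcm d i j)%N.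
Proof. by move=> h; apply: biglcm_gt0. Qed.

(** For fixed [d] the remaining conditions concern single entries and single rows, so the count
    factors over rows. That [N] may exceed [X] later lets [N] grow while [x] is fixed. *)
Lemma sum_tau_conflict X N : (X <= N)%N ->
  INR (\sum_(n : {ffun 'I_r -> 'I_X}) tau k (\prod_(i < r) (n i).+1))%N =
  \big[Rplus/0]_(d : {ffun conflict -> 'I_N})
    ((\big[Rmult/1]_e mu (d e).+1)
     * \big[Rmult/1]_(i < r) INR (\sum_(1 <= n < (X %/ row_lcm (fun e => (d e).+1) i).+1) tau k n)%N).
Proof.
move=> XN; rewrite sum_tau_mat INR_card.
pose g (m : nat_mat r k X) (a : 'I_r * 'I_k) : nat := (m a.1 a.2).+1.
have cop (m : nat_mat r k X) : bR (mat_coprime m) =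
   \big[Rplus/0]_(d : {ffun conflict -> 'I_N}) \big[Rmult/1]_e
      (mu (d e).+1 * bR ((d e).+1 %| gcdn (g m (val e).1) (g m (val e).2))%N).
  rewrite -(bigA_distr_bigA (fun e (c : 'I_N) => mu c.+1 * bR (c.+1 %| gcdn (g m (val e).1) (g m (val e).2))%N)).
  rewrite (_ : mat_coprime m = [forall e : conflict, coprime (g m (val e).1) (g m (val e).2)]).
    rewrite bR_forall; apply: eq_bigr => e _; rewrite sum_mu_ord //.
    rewrite gcdn_gt0 /=; apply: leq_trans XN; apply: leq_trans (ltn_ord (m (val e).1.1 (val e).1.2)).
    by apply: dvdn_leq => //; apply: dvdn_gcdl.
  apply/idP/forallP => [/forallP h [[[i' j] [i l]] hc]|h].
    have /forallP/(_ i')/forallP/(_ j)/forallP/(_ l)/implyP := h i.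
    by apply.
  apply/forallP => i; apply/forallP => i'; apply/forallP => j; apply/forallP => l.
  apply/implyP => hc.
  exact: (h (exist _ ((i', j), (i, l)) hc : conflict)).
under eq_bigr do rewrite bRM cop big_distrl /=.
rewrite exchange_big /=; apply: eq_bigr => d _.
set d1 := (fun e => (d e).+1).
pose F (i : 'I_r) (t : {ffun 'I_k -> 'I_X}) : R :=
  bR ([forall j, (entry_lcm d1 i j %| (t j).+1)%N] && (\prod_(j < k) (t j).+1 <= X)%N).
have step (m : nat_mat r k X) : \big[Rmult/1]_e
      (mu (d e).+1 * bR ((d e).+1 %| gcdn (g m (val e).1) (g m (val e).2))%N)
      * bR [forall i, (\prod_(j < k) (m i j).+1 <= X)%N]
    = (\big[Rmult/1]_e mu (d e).+1) * \big[Rmult/1]_i F i (m i).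
  rewrite big_split /= Rmult_assoc; congr Rmult.
  rewrite -!bR_forall -bRM; congr (INR (nat_of_bool _)).
  apply/andP/forallP => [[/forallP h1 /forallP h2] i|h].
    rewrite h2 andbT; apply/forallP => j; rewrite biglcm_dvd; apply/forallP => e.
    apply/implyP => /orP[] /eqP E.
      by apply: dvdn_trans (h1 e) _; rewrite E; apply: dvdn_gcdl.
    by apply: dvdn_trans (h1 e) _; rewrite E; apply: dvdn_gcdr.
  split; apply/forallP => x; last by have /andP[] := h x.
  rewrite dvdn_gcd; apply/andP; split.
    have /andP[/forallP/(_ (val x).1.2) + _] := h (val x).1.1.
    rewrite biglcm_dvd => /forallP/(_ x)/implyP; apply.
    by rewrite /touches -surjective_pairing eqxx.
  have /andP[/forallP/(_ (val x).2.2) + _] := h (val x).2.1.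
  rewrite biglcm_dvd => /forallP/(_ x)/implyP; apply.
  by rewrite /touches -surjective_pairing eqxx orbT.
under eq_bigr do rewrite step.
rewrite Rsum_const_mul; congr Rmult.
rewrite -(bigA_distr_bigA F); apply: eq_bigr => i _.
rewrite /row_lcm -card_divisible_tuples; last by move=> j; apply: entry_lcm_gt0.
by rewrite INR_card.
Qed.

End ConflictFormula.

(** * Convergence of the singular series *)

(** A divisor [c] of [a * b] is the product of [gcd(c, a)], a divisor of [a], and the cofactor
    [c / gcd(c, a)], which divides [b]. *)
Lemma size_divisors_mul a b : (0 < a)%N -> (0 < b)%N ->
  (size (divisors (a * b)) <= size (divisors a) * size (divisors b))%N.
Proof.
move=> a0 b0.
have -> : (size (divisors a) * size (divisors b) = size [seq (x * y)%N | x <- divisors a, y <- divisors b])%N.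
  by rewrite size_allpairs.
apply: uniq_leq_size; first exact: divisors_uniq.
move=> c; rewrite -dvdn_divisors ?muln_gt0 ?a0 // => hc.
have g0 : (0 < gcdn c a)%N by rewrite gcdn_gt0 a0 orbT.
have [y hy] := dvdnP (dvdn_gcdl c a).
have [z hz] := dvdnP (dvdn_gcdr c a).
have cop : coprime y z.
  by rewrite /coprime -(eqn_pmul2r g0) mul1n muln_gcdl -hy -hz eqxx.
apply/allpairsP; exists (gcdn c a, y); split => /=.
- by rewrite -dvdn_divisors // dvdn_gcdr.
- rewrite -dvdn_divisors //.
  move: hc g0 hy hz; move: (gcdn c a) => g hc g0 hy hz.
  by move: hc; rewrite hy hz mulnAC dvdn_pmul2r // Gauss_dvdr.
- by rewrite mulnC.
Qed.

Lemma size_divisors_count B R : (0 < R <= B)%N ->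
  size (divisors R) = (\sum_(a < B) (a.+1 %| R))%N.
Proof.
move=> /andP[R0 RB].
rewrite -(big_mkord xpredT (fun a => (a.+1 %| R : nat))) /=.
have -> : (\sum_(0 <= a < B) (a.+1 %| R) = \sum_(1 <= a < B.+1) (a %| R))%N by rewrite big_add1.
rewrite (_ : \sum_(1 <= a < B.+1) _ = \sum_(1 <= a < B.+1 | a %| R) 1)%N; last first.
  by rewrite [RHS]big_mkcond /=; apply: eq_bigr => a _; case: (_ %| _)%N.
rewrite -big_filter sum1_size; apply: perm_size; apply: uniq_perm.
- exact: divisors_uniq.
- by rewrite filter_uniq // iota_uniq.
- move=> d; rewrite mem_filter mem_index_iota -dvdn_divisors //.
  case: (boolP (d %| R)%N) => //= h; have := dvdn_gt0 R0 h; have := dvdn_leq R0 h; lia.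
Qed.

Lemma bR_ge0 (b : bool) : 0 <= bR b.
Proof. by case: b => /=; lra. Qed.

Lemma bR_le (b c : bool) : (b -> c) -> bR b <= bR c.
Proof. by case: b; case: c => /= h; try lra; have := h isT. Qed.

(** Each divisor [a] of [n] gives the pair [(a, n / a)], both at most [B]; the full square of pairs
    only adds nonnegative terms. *)
Lemma sum_divisors_mul_le B (F : nat -> R) : (forall n, 0 <= F n) ->
  \big[Rplus/0]_(n < B) (INR (size (divisors n.+1)) * F n.+1) <=
  \big[Rplus/0]_(a < B) \big[Rplus/0]_(b < B) F (a.+1 * b.+1)%N.
Proof.
move=> F0.
apply: (Rle_trans _ (\big[Rplus/0]_(n < B) \big[Rplus/0]_(a < B) \big[Rplus/0]_(b < B) (bR (a.+1 * b.+1 == n.+1)%N * F (a.+1 * b.+1)%N))).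
  apply: Rsum_le => n _; rewrite (@size_divisors_count B); last by have := ltn_ord n; lia.
  rewrite INR_sum big_distrl /=; apply: Rsum_le => a _.
  case: (boolP (a.+1 %| n.+1)%N) => h; last first.
    rewrite Rmult_0_l; apply: Rsum_ge0 => b _; apply: Rmult_le_pos => //; exact: bR_ge0.
  have [q hq] := dvdnP h.
  have q1 : (q.-1 < B)%N by have := ltn_ord n; nia.
  rewrite (bigD1 (Ordinal q1)) //=.
  have -> : (a.+1 * q.-1.+1 = n.+1)%N by rewrite prednK; nia.
  rewrite eqxx Rmult_1_l.
  set S := \big[Rplus/0]_(i < B | _) _.
  suff : 0 <= S by lra.
  by apply: Rsum_ge0 => b _; apply: Rmult_le_pos => //; exact: bR_ge0.
rewrite exchange_big /=; apply: Rsum_le => a _.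
rewrite exchange_big /=; apply: Rsum_le => b _.
rewrite -big_distrl /= -[X in _ <= X]Rmult_1_l; apply: Rmult_le_compat_r => //.
rewrite -INR_sum sum_ord_eqS //; case: (_ <= _)%N => /=; lra.
Qed.

(* [tau] is submultiplicative, so the sum with exponent [m + 1] is at most the square of
   the sum with exponent [m]. *)
Lemma sum_divisors_pow_bounded (s : R) m : 1 < s -> exists K, 0 <= K /\ forall B,
  \big[Rplus/0]_(n < B) (INR (size (divisors n.+1)) ^ m * Rpower (INR n.+1) (- s)) <= K.
Proof.
move=> s1; elim: m => [|m [K [K0 IH]]].
  exists (s / (s - 1)); split; first by apply: Rlt_le; apply: Rdiv_lt_0_compat; lra.
  case=> [|B]; first by rewrite big_ord0; apply: Rlt_le; apply: Rdiv_lt_0_compat; lra.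
  apply: Rle_trans (zeta_partial_sum_le s1 B); apply: Req_le.
  elim: B => [|B IH]; first by rewrite big_ord_recl big_ord0 sum_O /=; ring.
  by rewrite big_ord_recr IH sum_Sn /= Rmult_1_l.
exists (K * K); split; first exact: Rmult_le_pos.
move=> B; pose F n := INR (size (divisors n)) ^ m * Rpower (INR n) (- s).
have F0 n : 0 <= F n.
  by apply: Rmult_le_pos; [apply: pow_le; apply: pos_INR|apply: Rlt_le (Rpower_pos _ _)].
have Fmul a b : F (a.+1 * b.+1)%N <= F a.+1 * F b.+1.
  rewrite /F mult_INR -Rpower_mult_distr; [|apply: lt_0_INR; lia|apply: lt_0_INR; lia].
  rewrite (_ : forall x y z t, x * y * (z * t) = (x * z) * (y * t)); last by move=> *; ring.
  apply: Rmult_le_compat_r; first by apply: Rmult_le_pos; apply: Rlt_le (Rpower_pos _ _).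
  rewrite -Rpow_mult_distr; apply: pow_incr; split; first exact: pos_INR.
  by rewrite -mult_INR; apply: le_INR; apply/leP; apply: size_divisors_mul.
apply: (Rle_trans _ (\big[Rplus/0]_(n < B) (INR (size (divisors n.+1)) * F n.+1))).
  by apply: Rsum_le => n _; rewrite /F /= Rmult_assoc; exact: Rle_refl.
apply: (Rle_trans _ _ _ (sum_divisors_mul_le B F0)).
apply: (Rle_trans _ (\big[Rplus/0]_(a < B) \big[Rplus/0]_(b < B) (F a.+1 * F b.+1))).
  by apply: Rsum_le => a _; apply: Rsum_le => b _; apply: Fmul.
rewrite -big_distrlr /=; apply: Rmult_le_compat; [by apply: Rsum_ge0|by apply: Rsum_ge0|exact: IH|exact: IH].
Qed.

Lemma lcm_sum_bounded (E : finType) (s : R) : 1 < s -> exists K, 0 <= K /\ forall N,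
  \big[Rplus/0]_(d : {ffun E -> 'I_N}) Rpower (INR (\big[lcmn/1%N]_e (d e).+1)) (- s) <= K.
Proof.
move=> s1; have [K [K0 hK]] := sum_divisors_pow_bounded #|E| s1.
exists K; split => // N.
pose l (d : {ffun E -> 'I_N}) : nat := \big[lcmn/1%N]_e (d e).+1.
have l0 d : (0 < l d)%N by apply: biglcm_gt0.
(* A common bound for the lcms in the box makes grouping by their value a finite sum. *)
set B := (\max_(d : {ffun E -> 'I_N}) l d)%N.
have lB d : (l d <= B)%N by apply: leq_bigmax.
apply: Rle_trans (hK B).
apply: (Rle_trans _ (\big[Rplus/0]_(d : {ffun E -> 'I_N}) \big[Rplus/0]_(n < B) (bR (l d == n.+1) * Rpower (INR n.+1) (- s)))).
  apply: Rsum_le => d _.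
  have h : ((l d).-1 < B)%N by have := l0 d; have := lB d; lia.
  have Eh : (Ordinal h).+1 = l d by rewrite /= prednK.
  rewrite (bigD1 (Ordinal h)) // Eh eqxx Rmult_1_l.
  set S := \big[Rplus/0]_(i < B | _) _.
  rewrite -[X in X <= _]Rplus_0_r; apply: Rplus_le_compat; first exact: Rle_refl.
  by apply: Rsum_ge0 => b _; apply: Rmult_le_pos; [exact: bR_ge0|exact: Rlt_le (Rpower_pos _ _)].
rewrite exchange_big /=; apply: Rsum_le => n _.
rewrite -big_distrl /=; apply: Rmult_le_compat_r; first exact: Rlt_le (Rpower_pos _ _).
apply: (Rle_trans _ (\big[Rplus/0]_(d : {ffun E -> 'I_N}) \big[Rmult/1]_e bR ((d e).+1 %| n.+1)%N)).
  apply: Rsum_le => d _; rewrite -bR_forall; apply: bR_le => /eqP <-.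
  have := dvdnn (l d); rewrite {1}/l biglcm_dvd => /forallP h.
  by apply/forallP => e; have := h e.
rewrite -(bigA_distr_bigA (fun (e : E) (c : 'I_N) => bR (c.+1 %| n.+1)%N)) /=.
rewrite -INR_sum big_const -Monoid.iteropE /=.
have : (\sum_(c < N) (c.+1 %| n.+1) <= size (divisors n.+1))%N.
  rewrite (@size_divisors_count (maxn N n.+1)); last lia.
  rewrite -!(big_mkord xpredT (fun c => (c.+1 %| n.+1 : nat))).
  rewrite [X in (_ <= X)%N](big_cat_nat (n := N)) //=; [exact: leq_addr|exact: leq_maxl].
move=> /leP /le_INR; move: (INR _) (pos_INR (\sum_(c < N) (c.+1 %| n.+1))%N) => x x0 xy.
have -> : iterop #|E| Rmult x 1 = x ^ #|E|.
  by rewrite Monoid.iteropE; elim: #|E| => //= j ->.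
exact: pow_incr.
Qed.

(** With [a = x g], [b = y g] and [x], [y] coprime, the lcm is [x y g]; after division by [g^2] only
    the coprime squares of [x] and [y] remain. *)
Lemma sqr_lcm_dvd a b P : (0 < a)%N -> (a ^ 2 %| P)%N -> (b ^ 2 %| P)%N -> (lcmn a b ^ 2 %| P)%N.
Proof.
move=> a0; have g0 : (0 < gcdn a b)%N by rewrite gcdn_gt0 a0.
have [x hx] := dvdnP (dvdn_gcdl a b).
have [y hy] := dvdnP (dvdn_gcdr a b).
have cop : coprime x y.
  by rewrite /coprime -(eqn_pmul2r g0) mul1n muln_gcdl -hx -hy eqxx.
have E := muln_lcm_gcd a b.
move: (gcdn a b) g0 hx hy E => g g0 hx hy E.
have -> : lcmn a b = (x * y * g)%N.
  by apply/eqP; rewrite -(eqn_pmul2r g0) E hx hy -[X in _ == X]mulnA mulnACA.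
rewrite hx hy !expnMn.
move=> /dvdnP [q ->]; rewrite mulnA !dvdn_pmul2r ?expn_gt0 ?g0 // => h.
by rewrite Gauss_dvd ?coprimeXl ?coprimeXr // h dvdn_mull.
Qed.

Section RowBound.
Variables r k : nat.
Variable d : conflict r k -> nat.
Hypothesis d0 : forall e, (0 < d e)%N.
Let Rl := \big[lcmn/1%N]_e d e.

Lemma row_lcm_gt0 i : (0 < row_lcm d i)%N.
Proof. by apply: prodn_cond_gt0 => j _; apply: entry_lcm_gt0. Qed.

Lemma dvd_row_lcm e (a : 'I_r * 'I_k) : touches e a -> (d e %| row_lcm d a.1)%N.
Proof.
move=> h; apply: dvdn_trans (dvdn_prod_I (entry_lcm d a.1) a.2).
have := dvdnn (entry_lcm d a.1 a.2); rewrite {1}/entry_lcm biglcm_dvd => /forallP/(_ e)/implyP.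
by apply; rewrite -surjective_pairing.
Qed.

Lemma conflict_rows (e : conflict r k) : (val e).1.1 != (val e).2.1.
Proof. by have /andP[h _] := valP e; apply/eqP => E; rewrite E ltnn in h. Qed.

(** The two entries of a conflict lie in different rows, so at least one of them avoids row [i0]. *)
Lemma lcm_dvd_other_rows i0 : (Rl %| \prod_(i | i != i0) row_lcm d i)%N.
Proof.
rewrite biglcm_dvd; apply/forallP => e /=.
have [E|ne] := eqVneq (val e).1.1 i0.
  have ne : (val e).2.1 != i0 by rewrite -E eq_sym conflict_rows.
  rewrite (bigD1 (val e).2.1) //=; apply: dvdn_mulr; apply: dvd_row_lcm.
  by rewrite /touches eqxx orbT.
rewrite (bigD1 (val e).1.1) //=; apply: dvdn_mulr; apply: dvd_row_lcm.
by rewrite /touches eqxx.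
Qed.

(** Both rows met by a conflict [e] have moduli divisible by [d e], so its square divides the
    product; [sqr_lcm_dvd] passes this to the lcm. *)
Lemma sqr_lcm_dvd_rows : (Rl ^ 2 %| \prod_i row_lcm d i)%N.
Proof.
suff [] : (Rl ^ 2 %| \prod_i row_lcm d i)%N /\ (0 < Rl)%N by [].
apply: (big_ind (fun x => (x ^ 2 %| \prod_i row_lcm d i)%N /\ (0 < x)%N)).
- by rewrite exp1n dvd1n.
- by move=> x y [hx x0] [hy y0]; rewrite lcmn_gt0 x0 y0; split => //; apply: sqr_lcm_dvd.
- move=> e _; split => //.
  rewrite (bigD1 (val e).1.1) //= (bigD1 (val e).2.1) /=; last by rewrite eq_sym conflict_rows.
  rewrite mulnA; apply: dvdn_mulr; rewrite -mulnn; apply: dvdn_mul; apply: dvd_row_lcm.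
    by rewrite /touches eqxx.
  by rewrite /touches eqxx orbT.
Qed.

(** Weight [delta] on the square bound and weight [sigma - delta], nonnegative by hypothesis, on the
    bound over the other rows add up to the exponent [sigma + delta]. *)
Lemma row_lcm_power_le i0 (delta sigma : R) : 0 < delta <= sigma ->
  Rpower (INR (row_lcm d i0)) (- delta) * Rpower (INR (\prod_(i | i != i0) row_lcm d i)%N) (- sigma)
  <= Rpower (INR Rl) (- (sigma + delta)).
Proof.
move=> [de0 ds].
have R0 : (0 < Rl)%N by apply: biglcm_gt0.
have u0 := row_lcm_gt0 i0.
have v0 : (0 < \prod_(i | i != i0) row_lcm d i)%N by apply: prodn_cond_gt0 => i _; apply: row_lcm_gt0.
have h1 := dvdn_leq v0 (lcm_dvd_other_rows i0).
have h2 : (Rl ^ 2 <= row_lcm d i0 * \prod_(i | i != i0) row_lcm d i)%N.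
  apply: dvdn_leq; first by rewrite muln_gt0 u0.
  by have := sqr_lcm_dvd_rows; rewrite (bigD1 i0).
move: u0 v0 R0 h1 h2; move: (row_lcm d i0) (\prod_(i | _) _)%N Rl => u v q u0 v0 q0 h1 h2.
have P n : (0 < n)%N -> 0 < INR n by move=> h; apply: lt_0_INR; lia.
have l1 : ln (INR q) <= ln (INR v) by apply: ln_le; [exact: P|apply: le_INR; lia].
have l2 : 2 * ln (INR q) <= ln (INR u) + ln (INR v).
  rewrite -ln_mult; [|exact: P|exact: P].
  rewrite (_ : 2 * ln (INR q) = ln (INR q * INR q)); last by rewrite ln_mult; [ring|exact: P|exact: P].
  rewrite -!mult_INR; apply: ln_le; first by apply: P; lia.
  by apply: le_INR; apply/leP; rewrite -mulnn in h2.
rewrite /Rpower -exp_plus; apply: exp_le.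
nra.
Qed.

End RowBound.

Lemma row_lcm_sum_bounded r k (delta sigma : R) : 0 < delta <= sigma -> 1 < sigma + delta ->
  exists K, 0 <= K /\ forall N (i0 : 'I_r),
  \big[Rplus/0]_(d : {ffun conflict r k -> 'I_N})
    (Rpower (INR (row_lcm (fun e => (d e).+1) i0)) (- delta)
     * Rpower (INR (\prod_(i | i != i0) row_lcm (fun e => (d e).+1) i)%N) (- sigma)) <= K.
Proof.
move=> hd hs; have [K [K0 hK]] := lcm_sum_bounded (conflict r k) hs.
exists K; split => // N i0; apply: Rle_trans (hK N); apply: Rsum_le => d _.
exact: row_lcm_power_le.
Qed.

(** * Polynomials and interpolation at integers *)

Fixpoint peval (s : seq R) (t : R) : R := if s is c :: s' then c + t * peval s' t else 0.

Lemma peval_sum s t : peval s t = \big[Rplus/0]_(i < size s) (nth 0 s i * t ^ i).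
Proof.
elim: s => [|c s IH] /=; first by rewrite big_ord0.
rewrite big_ord_recl IH -Rsum_const_mul [nth 0 _ ord0]/= [t ^ _]/= Rmult_1_r; congr Rplus.
by apply: eq_bigr => i _; rewrite lift0 /=; ring.
Qed.

Lemma sum_f_R0E (f : nat -> R) n : sum_f_R0 f n = \big[Rplus/0]_(i < n.+1) f i.
Proof.
elim: n => [|n IH]; first by rewrite big_ord_recl big_ord0 /= Rplus_0_r.
by rewrite big_ord_recr -IH.
Qed.

Lemma peval_mkseq (c : nat -> R) n t :
  peval (mkseq c n.+1) t = sum_f_R0 (fun i => c i * t ^ i) n.
Proof.
rewrite peval_sum size_mkseq sum_f_R0E; apply: eq_bigr => i _.
by rewrite nth_mkseq.
Qed.

(** [n] counts coefficients, so the degree is below [n]; a fixed length lets coefficients of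
    different polynomials be compared. *)
Definition is_poly (n : nat) (f : R -> R) := exists s, size s = n /\ forall t, f t = peval s t.

Lemma is_poly_const n c : is_poly n.+1 (fun _ => c).
Proof.
exists (c :: nseq n 0); rewrite /= size_nseq; split => // t.
have -> : peval (nseq n 0) t = 0 by elim: n => //= n ->; ring.
by ring.
Qed.

Lemma is_poly_plus n f g : is_poly n f -> is_poly n g -> is_poly n (fun t => f t + g t).
Proof.
move=> [s [hs es]] [u [hu eu]].
exists (mkseq (fun i => nth 0 s i + nth 0 u i) n); rewrite size_mkseq; split => // t.
rewrite es eu !peval_sum size_mkseq hs hu -big_split /=; apply: eq_bigr => i _.
by rewrite nth_mkseq //; ring.
Qed.

Lemma is_poly_scal n f c : is_poly n f -> is_poly n (fun t => c * f t).
Proof.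
move=> [s [hs es]].
exists (mkseq (fun i => c * nth 0 s i) n); rewrite size_mkseq; split => // t.
rewrite es !peval_sum size_mkseq hs -Rsum_const_mul; apply: eq_bigr => i _.
by rewrite nth_mkseq //; ring.
Qed.

Lemma is_poly_mulX n f : is_poly n f -> is_poly n.+1 (fun t => t * f t).
Proof.
by move=> [s [hs es]]; exists (0 :: s); rewrite /= hs; split => // t; rewrite es /=; ring.
Qed.

Lemma is_poly_ext n f g : (forall t, f t = g t) -> is_poly n f -> is_poly n g.
Proof. by move=> e [s [hs es]]; exists s; split => // t; rewrite -e. Qed.

Lemma is_poly_S n f : is_poly n f -> is_poly n.+1 f.
Proof.
move=> [s [hs es]]; exists (rcons s 0); rewrite size_rcons hs; split => // t.
by rewrite es; elim: s {hs es} => [|c s IH] /=; [ring|rewrite IH].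
Qed.

Lemma is_poly_le n m f : (n <= m)%N -> is_poly n f -> is_poly m f.
Proof.
by move=> h; rewrite -(subnK h); elim: (m - n)%N => // j IH /IH; apply: is_poly_S.
Qed.

Lemma is_poly_mult n m f g : is_poly n.+1 f -> is_poly m.+1 g ->
  is_poly (n + m).+1 (fun t => f t * g t).
Proof.
move=> [s [hs es]] hg; apply: (@is_poly_ext _ (fun t => peval s t * g t)).
  by move=> t; rewrite es.
elim: n s hs {es f} => [|n IH] [|c s] //= [hs].
  move: hs => /size0nil ->; rewrite add0n.
  by apply: is_poly_ext (is_poly_scal c hg) => t /=; ring.
apply: (@is_poly_ext _ (fun t => c * g t + t * (peval s t * g t))); first by move=> t; ring.
apply: is_poly_plus; last by apply: is_poly_mulX; rewrite addSn; apply: IH.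
by apply: (@is_poly_le m.+1); [lia|apply: is_poly_scal].
Qed.

Lemma is_poly_shift s c : is_poly (size s) (fun t => peval s (t - c)).
Proof.
elim: s => [|a s IH] /=; first by exists [::].
apply: (@is_poly_ext _ (fun t => a + (t * peval s (t - c) + (- c) * peval s (t - c)))).
  by move=> t; ring.
apply: is_poly_plus; first exact: is_poly_const.
apply: is_poly_plus; first exact: is_poly_mulX.
by apply: is_poly_S; apply: is_poly_scal.
Qed.

Lemma is_poly_sum n (I : finType) (F : I -> R -> R) : (forall i, is_poly n.+1 (F i)) ->
  is_poly n.+1 (fun t => \big[Rplus/0]_i F i t).
Proof.
move=> h; elim: (index_enum I) => [|i s IH].
  by apply: is_poly_ext (is_poly_const n 0) => t; rewrite big_nil.
apply: (@is_poly_ext _ (fun t => F i t + \big[Rplus/0]_(i <- s) F i t)).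
  by move=> t; rewrite big_cons.
exact: is_poly_plus.
Qed.

Lemma is_poly_prod n r (F : 'I_r -> R -> R) : (forall i, is_poly n.+1 (F i)) ->
  is_poly (r * n).+1 (fun t => \big[Rmult/1]_i F i t).
Proof.
elim: r F => [|r IH] F h.
  by rewrite mul0n; apply: is_poly_ext (is_poly_const 0 1) => t; rewrite big_ord0.
apply: (@is_poly_ext _ (fun t => F ord0 t * \big[Rmult/1]_(i < r) F (lift ord0 i) t)).
  by move=> t; rewrite big_ord_recl.
by rewrite mulSn; apply: is_poly_mult => //; apply: IH.
Qed.

Lemma poly_growth s : exists B, 0 <= B /\ forall t, Rabs (peval s t) <= B * (1 + Rabs t) ^ (size s).-1.
Proof.
elim: s => [|c s [B [B0 IH]]]; first by exists 0; split; [lra|move=> t /=; rewrite Rabs_R0; lra].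
exists (Rabs c + B); split; first by have := Rabs_pos c; lra.
move=> t /=; have a0 := Rabs_pos t.
apply: (Rle_trans _ _ _ (Rabs_triang _ _)); rewrite Rabs_mult.
case: s IH => [|c' s] IH.
  by rewrite /= Rabs_R0; lra.
have := IH t; rewrite (_ : (size (c' :: s)).-1 = size s) //.
set q := (1 + Rabs t) ^ size s => h.
have -> : (1 + Rabs t) ^ (size s).+1 = (1 + Rabs t) * q by [].
have q1 : 1 <= q by apply: pow_R1_Rle; lra.
have c0 := Rabs_pos c.
have h2 : Rabs t * Rabs (peval (c' :: s) t) <= Rabs t * (B * q) by apply: Rmult_le_compat_l.
have h3 : Rabs c * 1 <= Rabs c * ((1 + Rabs t) * q) by apply: Rmult_le_compat_l => //; nra.
have h4 : 0 <= B * q by nra.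
nra.
Qed.

Lemma INRD (m n : nat) : INR (m + n)%N = INR m + INR n.
Proof. exact: plus_INR. Qed.

Lemma INRM (m n : nat) : INR (m * n)%N = INR m * INR n.
Proof. exact: mult_INR. Qed.

(** * Interpolation with rational weights *)

Definition is_rat (x : R) := exists p q m : nat, x = (INR p - INR q) / INR m.+1.

Lemma is_rat_nat n : is_rat (INR n).
Proof. by exists n, 0%N, 0%N; rewrite /=; field. Qed.

Lemma INR_S_neq0 n : INR n.+1 <> 0.
Proof. exact: not_0_INR. Qed.
Arguments INR_S_neq0 : clear implicits.

Lemma is_rat_plus x y : is_rat x -> is_rat y -> is_rat (x + y).
Proof.
move=> [p [q [m ->]]] [p' [q' [m' ->]]].
exists (p * m'.+1 + p' * m.+1)%N, (q * m'.+1 + q' * m.+1)%N, (m * m' + m + m')%N.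
have -> : (m * m' + m + m').+1 = (m.+1 * m'.+1)%N by lia.
have := INR_S_neq0 m; have := INR_S_neq0 m'; move: m.+1 m'.+1 => a b b0 a0.
by rewrite !INRD !INRM; field.
Qed.

Lemma is_rat_mult x y : is_rat x -> is_rat y -> is_rat (x * y).
Proof.
move=> [p [q [m ->]]] [p' [q' [m' ->]]].
exists (p * p' + q * q')%N, (p * q' + q * p')%N, (m * m' + m + m')%N.
have -> : (m * m' + m + m').+1 = (m.+1 * m'.+1)%N by lia.
have := INR_S_neq0 m; have := INR_S_neq0 m'; move: m.+1 m'.+1 => a b b0 a0.
by rewrite !INRD !INRM; field.
Qed.

Lemma is_rat_opp x : is_rat x -> is_rat (- x).
Proof.
move=> [p [q [m ->]]]; exists q, p, m; field; exact: INR_S_neq0.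
Qed.

Lemma is_rat_inv_nat n : is_rat (/ INR n.+1).
Proof. by exists 1%N, 0%N, n; rewrite [INR 1]/= [INR 0]/= /Rdiv; ring. Qed.

Lemma is_rat_INR_sub (i j : nat) : i <> j -> is_rat (/ (INR i - INR j)).
Proof.
move=> ne; have [h|h] := leqP i j.
  have -> : / (INR i - INR j) = - / INR (j - i).-1.+1.
    rewrite prednK; last lia.
    rewrite minus_INR; last lia.
    have : INR i < INR j by apply: lt_INR; lia.
    by move=> ?; field; lra.
  by apply: is_rat_opp; apply: is_rat_inv_nat.
have -> : / (INR i - INR j) = / INR (i - j).-1.+1.
  by rewrite prednK ?minus_INR //; lia.
exact: is_rat_inv_nat.
Qed.

(** Functionals on polynomials of degree at most [L] that combine the values at [1, ..., L + 1],
    with weights that do not depend on the polynomial. *)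
Definition rat_eval_span (L : nat) (phi : seq R -> R) := exists w : nat -> R,
  (forall j, is_rat (w j)) /\
  forall s, size s = L.+1 -> phi s = \big[Rplus/0]_(j < L.+1) (w j * peval s (INR j.+1)).

Section Span.
Variable L : nat.

Lemma span_ext phi psi : (forall s, size s = L.+1 -> phi s = psi s) ->
  rat_eval_span L phi -> rat_eval_span L psi.
Proof. by move=> e [w [h1 h2]]; exists w; split => // s hs; rewrite -e // h2. Qed.

Lemma span_plus phi psi : rat_eval_span L phi -> rat_eval_span L psi ->
  rat_eval_span L (fun s => phi s + psi s).
Proof.
move=> [w [h1 h2]] [w' [h1' h2']]; exists (fun j => w j + w' j); split.
  by move=> j; apply: is_rat_plus.
move=> s hs; rewrite h2 // h2' // -big_split /=; apply: eq_bigr => j _; ring.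
Qed.

Lemma span_scal phi c : is_rat c -> rat_eval_span L phi -> rat_eval_span L (fun s => c * phi s).
Proof.
move=> hc [w [h1 h2]]; exists (fun j => c * w j); split.
  by move=> j; apply: is_rat_mult.
move=> s hs; rewrite h2 // -Rsum_const_mul; apply: eq_bigr => j _; ring.
Qed.

Lemma span_eval i : (i < L.+1)%N -> rat_eval_span L (fun s => peval s (INR i.+1)).
Proof.
move=> hi; exists (fun j => INR (j == i)); split; first by move=> j; apply: is_rat_nat.
move=> s hs; rewrite (bigD1 (Ordinal hi)) // big1 => [|j hj].
  by rewrite Monoid.mulm1 eqxx Rmult_1_l.
by rewrite (_ : (j == i :> nat) = false) ?Rmult_0_l //; apply: negbTE.
Qed.

Lemma span_sum n (F : nat -> seq R -> R) : (forall j, (j < n)%N -> rat_eval_span L (F j)) ->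
  rat_eval_span L (fun s => \big[Rplus/0]_(j < n) F j s).
Proof.
elim: n => [|n IH] h.
  exists (fun=> 0); split; first by move=> j; apply: (is_rat_nat 0).
  by move=> s _; rewrite big_ord0 big1 // => j _; ring.
apply: (@span_ext (fun s => \big[Rplus/0]_(j < n) F j s + F n s)).
  by move=> s _; rewrite big_ord_recr.
by apply: span_plus; [apply: IH => j hj; apply: h; lia|apply: h].
Qed.

End Span.

(** Synthetic division: the quotient of [s(t) - s(a)] by [t - a]. *)
Fixpoint pquot (a : R) (s : seq R) : seq R :=
  if s is _ :: ((_ :: _) as s') then peval s' a :: pquot a s' else [::].

Lemma size_pquot a s : size (pquot a s) = (size s).-1.
Proof. by elim: s => [|c [|c' s] IH] //=; rewrite IH. Qed.

Lemma pquotE a s t : peval s t = peval s a + (t - a) * peval (pquot a s) t.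
Proof.
elim: s => [|c s IH]; first by rewrite /=; ring.
case: s IH => [|c' s] IH; first by rewrite /=; ring.
change (c + t * peval (c' :: s) t = c + a * peval (c' :: s) a
  + (t - a) * (peval (c' :: s) a + t * peval (pquot a (c' :: s)) t)).
by rewrite IH; ring.
Qed.

Lemma nth_pquot a s i :
  nth 0 s i = (if i is i'.+1 then nth 0 (pquot a s) i' else peval s a) - a * nth 0 (pquot a s) i.
Proof.
elim: s i => [|c s IH] [|i].
- by rewrite /=; ring.
- by rewrite /= !nth_nil; ring.
- by case: s {IH} => [|c' s] /=; ring.
- case: s IH => [|c' s] IH; first by rewrite /= !nth_nil; ring.
  by rewrite [LHS](IH i); case: i => [|i] /=; ring.
Qed.

(** Newton interpolation: dividing by [t - a] at the last node [a] lowers the degree, and the values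
    of the quotient at the other nodes are divided differences of [s]. [nth_pquot] then returns from
    quotient coefficients to those of [s]. *)
Lemma coef_span L l : rat_eval_span L (fun s => nth 0 s l).
Proof.
elim: L l => [|L IH] l.
  case: l => [|l].
    apply: span_ext (@span_eval 0 0 isT) => -[|c [|c' s]] //= _; ring.
  exists (fun=> 0); split; first by move=> j; apply: (is_rat_nat 0).
  by move=> [|c [|c' s]] // _; rewrite big1 /= ?nth_nil // => j _; ring.
set a := INR L.+2.
have Q i : rat_eval_span L.+1 (fun s => nth 0 (pquot a s) i).
  have [w [w1 w2]] := IH i.
  apply: (@span_ext _ (fun s => \big[Rplus/0]_(j < L.+1) (w j * (/ (INR j.+1 - a) * (peval s (INR j.+1) + (INR 0 - INR 1) * peval s a))))).
    move=> s hs; rewrite w2; last by rewrite size_pquot hs.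
    apply: eq_bigr => j _; rewrite (pquotE a s (INR j.+1)).
    have ja : INR j.+1 < a by apply: lt_INR; have := ltn_ord j; lia.
    rewrite [INR 0]/= [INR 1]/=; field; lra.
  apply: (@span_sum _ _ (fun j s => w j * (/ (INR j.+1 - a) * (peval s (INR j.+1) + (INR 0 - INR 1) * peval s a)))).
  move=> j hj; apply: span_scal => //; apply: span_scal; first by apply: is_rat_INR_sub; lia.
  apply: span_plus; first by apply: span_eval; lia.
  apply: span_scal; last exact: span_eval.
  by exists 0%N, 1%N, 0%N; rewrite /=; field.
apply: (@span_ext _ (fun s => (if l is l'.+1 then nth 0 (pquot a s) l' else peval s a) + (- a) * nth 0 (pquot a s) l)).
  by move=> s _; rewrite [RHS](nth_pquot a); ring.
apply: span_plus; last by apply: span_scal => //; apply: is_rat_opp; apply: is_rat_nat.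
by case: l => [|l] //; apply: span_eval.
Qed.

(** * The main term *)

Section BoxSum.
Variable E : finType.

(** Boxes of different sides have different types; summands are therefore functions of families of
    natural numbers, the same for every [N]. *)
Definition box_pt N (d : {ffun E -> 'I_N}) : {ffun E -> nat} := [ffun e => d e : nat].

Definition boxsum N (f : {ffun E -> nat} -> R) : R := \big[Rplus/0]_(d : {ffun E -> 'I_N}) f (box_pt d).

Lemma boxsum_le_S N f : (forall d, 0 <= f d) -> boxsum N f <= boxsum N.+1 f.
Proof.
move=> f0.
pose w (d : {ffun E -> 'I_N}) : {ffun E -> 'I_N.+1} := [ffun e => widen_ord (leqnSn N) (d e)].
have wi : injective w.
  move=> d d' h; apply/ffunP => e; apply: val_inj.
  by have := congr1 (fun g : {ffun E -> 'I_N.+1} => val (g e)) h; rewrite /= !ffunE.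
have -> : boxsum N f = \big[Rplus/0]_(d in w @: setT) f (box_pt d).
  rewrite big_imset /=; last by move=> d d' _ _; apply: wi.
  apply: eq_big => [d|d _]; first by rewrite inE.
  by congr f; apply/ffunP => e; rewrite !ffunE.
rewrite /boxsum [X in _ <= X](bigID (fun d => d \in w @: setT)) /=.
rewrite -[X in X <= _]Rplus_0_r. apply: Rplus_le_compat; last exact: Rsum_ge0.
by apply: Req_le; apply: eq_bigl.
Qed.

(** The sums of [|f|] and of [|f| - f] increase with the box and are bounded; [f] is their
    difference. *)
Lemma boxsum_conv f K : (forall N, boxsum N (fun d => Rabs (f d)) <= K) ->
  ex_finite_lim_seq (fun N => boxsum N f).
Proof.
move=> hK.
have h1 : ex_finite_lim_seq (fun N => boxsum N (fun d => Rabs (f d))).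
  by apply: (ex_finite_lim_seq_incr _ K) => // N; apply: boxsum_le_S => d; apply: Rabs_pos.
have h2 : ex_finite_lim_seq (fun N => boxsum N (fun d => Rabs (f d) - f d)).
  apply: (ex_finite_lim_seq_incr _ (2 * K)) => N.
    by apply: boxsum_le_S => d; have := Rle_abs (f d); lra.
  apply: (Rle_trans _ (2 * boxsum N (fun d => Rabs (f d)))); last by have := hK N; lra.
  rewrite -Rsum_const_mul; apply: Rsum_le => d _.
  by have := Rabs_maj2 (f (box_pt d)); lra.
have [l1 hl1] := h1; have [l2 hl2] := h2.
exists (l1 - l2); apply: is_lim_seq_ext (is_lim_seq_minus' _ _ _ _ hl1 hl2) => N.
have -> : boxsum N (fun d => Rabs (f d)) = boxsum N f + boxsum N (fun d => Rabs (f d) - f d).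
  by rewrite /boxsum -big_split /=; apply: eq_bigr => d _; ring.
ring.
Qed.
End BoxSum.

(** * Floors and the exact truncated expansion *)

Lemma nat_floor_spec x : 0 <= x -> INR (nat_floor x) <= x < INR (nat_floor x) + 1.
Proof.
move=> x0; rewrite /nat_floor.
have [h1 h2] := base_Int_part x.
have z0 : (0 <= Int_part x)%Z.
  suff : (-1 < Int_part x)%Z by lia.
  by apply: lt_IZR; lra.
by rewrite INR_IZR_INZ Z2Nat.id //; lra.
Qed.

Lemma nat_floor_unique x n : INR n <= x < INR n + 1 -> nat_floor x = n.
Proof.
move=> h; have x0 : 0 <= x by have := pos_INR n; lra.
have h' := nat_floor_spec x0.
have a : (nat_floor x < n.+1)%coq_nat by apply: INR_lt; rewrite S_INR; lra.
have b : (n < (nat_floor x).+1)%coq_nat by apply: INR_lt; rewrite S_INR; lra.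
lia.
Qed.

Lemma nat_floor_div x n : 0 <= x -> (0 < n)%N -> nat_floor (x / INR n) = (nat_floor x %/ n)%N.
Proof.
move=> x0 n0; have h := nat_floor_spec x0.
have np : 0 < INR n by apply: lt_0_INR; lia.
apply: nat_floor_unique; split.
  apply/Rle_div_r => //; rewrite -INRM; apply: Rle_trans (proj1 h).
  by apply: le_INR; apply/leP; apply: leq_trunc_div.
apply/Rlt_div_l => //; rewrite -S_INR -INRM.
apply: (Rlt_le_trans _ _ _ (proj2 h)); rewrite -S_INR; apply: le_INR; apply/leP.
by rewrite -ltn_divLR.
Qed.

Lemma nat_floor_lt1 y : 0 <= y < 1 -> nat_floor y = 0%N.
Proof. by move=> h; apply: nat_floor_unique => /=; lra. Qed.

Lemma tau_sum_lt1 k y : 0 <= y < 1 -> tau_sum k y = 0%N.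
Proof. by move=> h; rewrite /tau_sum nat_floor_lt1 // big_geq. Qed.

Lemma tau_sum_mono k x y : 0 <= x <= y -> (tau_sum k x <= tau_sum k y)%N.
Proof.
move=> [x0 xy].
have h : (nat_floor x <= nat_floor y)%N.
  have := nat_floor_spec x0; have := @nat_floor_spec y ltac:(lra) => h1 h2.
  suff : (nat_floor x < (nat_floor y).+1)%coq_nat by lia.
  by apply: INR_lt; rewrite S_INR; lra.
rewrite /tau_sum [X in (_ <= X)%N](big_cat_nat (n := (nat_floor x).+1)) //=; exact: leq_addr.
Qed.

Lemma tau_prod_sum_box r k x N : 0 <= x -> (nat_floor x <= N)%N ->
  INR (tau_prod_sum r k x) = boxsum N (fun d : {ffun conflict r k -> nat} =>
    (\big[Rmult/1]_e mu (d e).+1) * \big[Rmult/1]_(i < r) INR (tau_sum k (x / INR (row_lcm (fun e => (d e).+1) i)))).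
Proof.
move=> x0 hN; rewrite /tau_prod_sum (sum_tau_conflict _ _ hN); apply: eq_bigr => d _.
have E i : row_lcm (fun e => (d e).+1) i = row_lcm (fun e => (box_pt d e).+1) i.
  by apply: eq_bigr => j _; apply: eq_bigr => e _; rewrite ffunE.
congr Rmult; first by apply: eq_bigr => e _; rewrite ffunE.
apply: eq_bigr => i _; rewrite /tau_sum nat_floor_div //; last by apply: row_lcm_gt0.
by rewrite E.
Qed.

(** Factors are exchanged one at a time. [A i] bounds the size of both factors, and [be i] is the
    error relative to [A i]. *)
Lemma Rprod_diff_le (I : Type) (s : seq I) (a b A be : I -> R) :
  (forall i, Rabs (a i) <= A i) -> (forall i, Rabs (b i) <= A i) ->
  (forall i, Rabs (a i - b i) <= A i * be i) ->
  Rabs (\big[Rmult/1]_(i <- s) a i - \big[Rmult/1]_(i <- s) b i) <=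
  (\big[Rmult/1]_(i <- s) A i) * \big[Rplus/0]_(i <- s) be i.
Proof.
move=> ha hb hd.
have A0 i : 0 <= A i by apply: Rle_trans (ha i); apply: Rabs_pos.
elim: s => [|i s IH]; first by rewrite !big_nil Rminus_diag Rabs_R0; lra.
rewrite !big_cons /=.
set pa := \big[Rmult/1]_(_ <- s) a _; set pb := \big[Rmult/1]_(_ <- s) b _.
set pA := \big[Rmult/1]_(_ <- s) A _; set sb := \big[Rplus/0]_(_ <- s) _.
rewrite (_ : a i * pa - b i * pb = (a i - b i) * pa + b i * (pa - pb)); last by ring.
apply: (Rle_trans _ _ _ (Rabs_triang _ _)); rewrite !Rabs_mult.
have hpa : Rabs pa <= pA by rewrite /pa Rabs_prod; apply: Rprod_le => j _; split => //; apply: Rabs_pos.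
have h1 : Rabs (a i - b i) * Rabs pa <= (A i * be i) * pA.
  by apply: Rmult_le_compat => //; apply: Rabs_pos.
have h2 : Rabs (b i) * Rabs (pa - pb) <= A i * (pA * sb).
  by apply: Rmult_le_compat => //; apply: Rabs_pos.
rewrite (_ : A i * pA * (be i + sb) = A i * be i * pA + A i * (pA * sb)); [lra|ring].
Qed.

Lemma is_lim_seq_Rscal (u : nat -> R) (a l : R) :
  is_lim_seq u l -> is_lim_seq (fun n => a * u n) (a * l).
Proof. exact: (is_lim_seq_scal_l u a l). Qed.

Section MainTerm.
Variables (r k : nat) (P : seq R).
Hypothesis r1 : (0 < r)%N.
Hypothesis sP : size P = k.

Definition log_poly (y : R) : R := y * peval P (ln y).

Definition row_modulus (d : {ffun conflict r k -> nat}) (i : 'I_r) : R := INR (row_lcm (fun e => (d e).+1) i).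

Lemma row_ge1 d i : 1 <= row_modulus d i.
Proof. by apply: (le_INR 1); apply/leP; apply: row_lcm_gt0. Qed.

Definition main_box_term (x : R) (d : {ffun conflict r k -> nat}) : R :=
  (\big[Rmult/1]_e mu (d e).+1) * \big[Rmult/1]_(i < r) log_poly (x / row_modulus d i).

Definition main_box_sum (x : R) (N : nat) : R := boxsum N (main_box_term x).

Lemma mu_prod_le1 (d : {ffun conflict r k -> nat}) : Rabs (\big[Rmult/1]_e mu (d e).+1) <= 1.
Proof.
suff [] : 0 <= Rabs (\big[Rmult/1]_e mu (d e).+1) <= 1 by [].
rewrite Rabs_prod; apply: (big_ind (fun x => 0 <= x <= 1)) => [|x y hx hy|e _].
- lra.
- nra.
- by split; [apply: Rabs_pos|apply: mu_le1].
Qed.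

(** The variables separate through [1 + |ln x - ln L| <= (1 + ln x)(1 + ln L)], and each power of a
    logarithm is absorbed into an [eps]-power. The case [x < L] is included, as boxes of any size
    require. *)
Lemma log_poly_bound eps : 0 < eps -> exists A, 0 < A /\ forall x L, 1 <= x -> 1 <= L ->
  Rabs (log_poly (x / L)) <= A * Rpower x (1 + eps) * Rpower L (- (1 - eps)).
Proof.
move=> e0; have [B [B0 hB]] := poly_growth P.
have [C [C0 hC]] := @pow_le_exp (size P).-1 eps e0.
exists ((B + 1) * (C * C)); split; first by do !(apply: Rmult_lt_0_compat); lra.
move=> x L x1 L1.
have lx : 0 <= ln x by rewrite -ln_1; apply: ln_le; lra.
have lL : 0 <= ln L by rewrite -ln_1; apply: ln_le; lra.
rewrite /log_poly Rabs_mult Rabs_pos_eq; last by apply: Rlt_le; apply: Rdiv_lt_0_compat; lra.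
have h1 : Rabs (peval P (ln (x / L))) <= B * (C * exp (eps * ln x) * (C * exp (eps * ln L))).
  apply: (Rle_trans _ _ _ (hB _)); apply: Rmult_le_compat_l => //.
  apply: (Rle_trans _ (((1 + ln x) * (1 + ln L)) ^ (size P).-1)).
    apply: pow_incr; split; first by have := Rabs_pos (ln (x / L)); lra.
    rewrite ln_div; [|lra|lra].
    have : Rabs (ln x - ln L) <= ln x + ln L by apply: Rabs_le; lra.
    nra.
  rewrite Rpow_mult_distr; apply: Rmult_le_compat; try (apply: pow_le; lra); exact: hC.
have ex := exp_pos (eps * ln x); have eL := exp_pos (eps * ln L).
have -> : Rpower x (1 + eps) = x * exp (eps * ln x).
  by rewrite Rpower_plus Rpower_1; last lra.
have -> : Rpower L (- (1 - eps)) = / L * exp (eps * ln L).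
  rewrite (_ : - (1 - eps) = - 1 + eps); last by ring.
  by rewrite Rpower_plus Rpower_Ropp Rpower_1; last lra.
have xL : 0 < x / L by apply: Rdiv_lt_0_compat; lra.
apply: (Rle_trans _ (x / L * ((B + 1) * (C * exp (eps * ln x) * (C * exp (eps * ln L)))))).
  apply: Rmult_le_compat_l; first lra.
  apply: (Rle_trans _ _ _ h1); apply: Rmult_le_compat_r; last lra.
  by do !(apply: Rmult_le_pos); lra.
apply: Req_le; field; lra.
Qed.

Lemma prod_row_power (d : {ffun conflict r k -> nat}) (i0 : 'I_r) c s :
  \big[Rmult/1]_(i | i != i0) (c * Rpower (row_modulus d i) s) =
  c ^ r.-1 * Rpower (INR (\prod_(i | i != i0) row_lcm (fun e => (d e).+1) i)%N) s.
Proof.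
rewrite big_split /=; congr Rmult.
  rewrite big_const; have -> : #|[pred i | i != i0]| = r.-1.
    by rewrite cardC1 card_ord.
  by elim: r.-1 => //= n ->.
have : (forall i, 0 < INR (row_lcm (fun e => (d e).+1) i)) by move=> i; have := row_ge1 d i; rewrite /row_modulus; lra.
rewrite /row_modulus => p; rewrite INR_prod.
suff [] : 0 < \big[Rmult/1]_(i | i != i0) INR (row_lcm (fun e => (d e).+1) i) /\ 
  \big[Rmult/1]_(i | i != i0) Rpower (INR (row_lcm (fun e => (d e).+1) i)) s = Rpower (\big[Rmult/1]_(i | i != i0) INR (row_lcm (fun e => (d e).+1) i)) s by [].
apply: (big_ind2 (fun x y => 0 < x /\ y = Rpower x s)) => [|x y x' y' [hx ->] [hx' ->]|i _].
- by split; [lra|rewrite /Rpower ln_1 Rmult_0_r exp_0].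
- by split; [nra|rewrite Rpower_mult_distr].
- by split.
Qed.

(** With both exponents equal to [3/4] their sum exceeds 1, and the missing [1/4] leaves room for
    the logarithms in the main term. *)
Lemma rows_bounded : exists K, 0 <= K /\ forall N,
  boxsum N (fun d => \big[Rmult/1]_(i < r) Rpower (row_modulus d i) (- (3 / 4))) <= K.
Proof.
have [K [K0 hK]] := @row_lcm_sum_bounded r k (3 / 4) (3 / 4) ltac:(lra) ltac:(lra).
exists K; split => // N; apply: Rle_trans (hK N (Ordinal r1)); apply: Rsum_le => d _.
rewrite (bigD1 (Ordinal r1)) //=.
have := @prod_row_power (box_pt d) (Ordinal r1) 1 (- (3 / 4)).
under eq_bigr do rewrite Rmult_1_l; move=> ->; rewrite pow1 Rmult_1_l /row_modulus.
have E i : row_lcm (fun e => (box_pt d e).+1) i = row_lcm (fun e => (d e).+1) i.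
  by apply: eq_bigr => j _; apply: eq_bigr => e _; rewrite ffunE.
rewrite E (eq_bigr _ (fun i _ => E i)); exact: Rle_refl.
Qed.

Lemma main_box_sum_conv x : 1 <= x -> ex_finite_lim_seq (main_box_sum x).
Proof.
move=> x1; have [A [A0 hA]] := @log_poly_bound (/ 4) ltac:(lra).
have [K [K0 hK]] := rows_bounded.
set c := A * Rpower x (1 + / 4).
have c0 : 0 <= c by apply: Rmult_le_pos; [lra|apply: Rlt_le (Rpower_pos _ _)].
apply: (@boxsum_conv _ _ (c ^ r * K)) => N.
apply: (Rle_trans _ (c ^ r * boxsum N (fun d => \big[Rmult/1]_(i < r) Rpower (row_modulus d i) (- (3 / 4))))); last first.
  by apply: Rmult_le_compat_l => //; apply: pow_le.
rewrite -Rsum_const_mul; apply: Rsum_le => d _.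
rewrite /main_box_term Rabs_mult -[X in _ <= X]Rmult_1_l.
apply: Rmult_le_compat; try exact: Rabs_pos; first exact: mu_prod_le1.
have -> : c ^ r = \big[Rmult/1]_(i < r) c.
  by rewrite big_const card_ord; elim: r => //= n ->.
rewrite -big_split /= Rabs_prod; apply: Rprod_le => i _; split; first exact: Rabs_pos.
have -> : - (3 / 4) = - (1 - / 4) by lra.
by apply: hA => //; apply: row_ge1.
Qed.

Lemma main_box_sum_poly N : (0 < k)%N -> exists s, size s = (r * (k - 1)).+1 /\
  forall x, 0 < x -> main_box_sum x N = x ^ r * peval s (ln x).
Proof.
move=> k0.
have [s [hs es]] : is_poly (r * (k - 1)).+1 (fun t => boxsum N (fun d =>
    (\big[Rmult/1]_e mu (d e).+1) * \big[Rmult/1]_(i < r) (/ row_modulus d i * peval P (t - ln (row_modulus d i))))).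
  apply: is_poly_sum => d; apply: is_poly_scal; apply: is_poly_prod => i.
  apply: is_poly_scal; have := is_poly_shift P (ln (row_modulus (box_pt d) i)).
  by rewrite (_ : size P = (k - 1).+1) // sP; lia.
exists s; split => // x x0; rewrite -es -Rsum_const_mul; apply: eq_bigr => d _.
rewrite /main_box_term (_ : x ^ r = \big[Rmult/1]_(i < r) x); last first.
  by rewrite big_const card_ord; elim: r => //= n ->.
rewrite -[RHS]Rmult_assoc [_ * \big[Rmult/1]_e _]Rmult_comm Rmult_assoc -big_split /=.
congr Rmult; apply: eq_bigr => i _; have := row_ge1 (box_pt d) i => h.
by rewrite /log_poly ln_div; [rewrite /Rdiv; ring|lra|lra].
Qed.

Lemma is_lim_seq_bigsum n (u : nat -> nat -> R) (l : nat -> R) :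
  (forall j, is_lim_seq (u j) (l j)) ->
  is_lim_seq (fun N => \big[Rplus/0]_(j < n) u j N) (\big[Rplus/0]_(j < n) l j).
Proof.
move=> h; elim: n => [|n IH].
  by rewrite big_ord0; apply: is_lim_seq_ext (is_lim_seq_const 0) => N; rewrite big_ord0.
rewrite big_ord_recr /=; apply: is_lim_seq_ext (is_lim_seq_plus' _ _ _ _ IH (h n)) => N.
by rewrite big_ord_recr.
Qed.

(** For each [N] the truncated sum is [x^r] times a polynomial in [ln x] of fixed degree.
    Convergence at [L + 1] points forces each coefficient to converge, by [coef_span], and hence the
    limit has the same shape. *)
Lemma main_box_sum_limit : (0 < k)%N -> exists c : nat -> R, forall x, 1 <= x ->
  is_lim_seq (main_box_sum x) (x ^ r * sum_f_R0 (fun l => c l * ln x ^ l) (r * (k - 1))).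
Proof.
move=> k0; set L := (r * (k - 1))%N.
have [s hs] : exists s : nat -> seq R, forall N, size (s N) = L.+1 /\ forall x, 0 < x -> main_box_sum x N = x ^ r * peval (s N) (ln x).
  exists (fun N => proj1_sig (constructive_indefinite_description _ (main_box_sum_poly N k0))) => N.
  by case: constructive_indefinite_description.
have ev j : exists l : R, is_lim_seq (fun N => peval (s N) (INR j.+1)) l.
  (* At [x = exp (j + 1)] the logarithm is an interpolation node. *)
  have x1 : 1 <= exp (INR j.+1) by rewrite -exp_0; apply: exp_le; apply: pos_INR.
  have [l hl] := main_box_sum_conv x1.
  exists (/ exp (INR j.+1) ^ r * l).
  apply: (is_lim_seq_ext (fun N => / exp (INR j.+1) ^ r * main_box_sum (exp (INR j.+1)) N)); last exact: is_lim_seq_Rscal.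
  move=> N; have [_ ->] := hs N; last exact: exp_pos.
  rewrite ln_exp -Rmult_assoc Rinv_l ?Rmult_1_l //; apply: pow_nonzero.
  by have := exp_pos (INR j.+1); lra.
have co l : exists c : R, is_lim_seq (fun N => nth 0 (s N) l) c.
  have [w [_ hw]] := coef_span L l.
  have [v hv] : exists v : nat -> R, forall j, is_lim_seq (fun N => peval (s N) (INR j.+1)) (v j).
    exists (fun j => proj1_sig (constructive_indefinite_description _ (ev j))) => j.
    by case: constructive_indefinite_description.
  exists (\big[Rplus/0]_(j < L.+1) (w j * v j)).
  apply: (is_lim_seq_ext (fun N => \big[Rplus/0]_(j < L.+1) (w j * peval (s N) (INR j.+1)))).
    by move=> N; rewrite hw //; have [] := hs N.
  apply: (@is_lim_seq_bigsum L.+1 (fun j N => w j * peval (s N) (INR j.+1)) (fun j => w j * v j)) => j.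
  exact: is_lim_seq_Rscal.
exists (fun l => proj1_sig (constructive_indefinite_description _ (co l))) => x x1.
apply: (is_lim_seq_ext (fun N => x ^ r * \big[Rplus/0]_(l < L.+1) (nth 0 (s N) l * ln x ^ l))).
  move=> N; have [sz ->] := hs N; last lra.
  by rewrite peval_sum sz.
apply: is_lim_seq_Rscal; rewrite sum_f_R0E.
apply: (@is_lim_seq_bigsum L.+1 (fun l N => nth 0 (s N) l * ln x ^ l)
  (fun l => proj1_sig (constructive_indefinite_description _ (co l)) * ln x ^ l)) => l.
set v := proj1_sig _; rewrite (Rmult_comm v).
apply: (is_lim_seq_ext (fun N => ln x ^ l * nth 0 (s N) l)); first by move=> N; apply: Rmult_comm.
by apply: is_lim_seq_Rscal; rewrite /v; case: constructive_indefinite_description.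
Qed.

End MainTerm.

(** * The error term and the exponent alpha *)

Lemma Rpower_le1 x a b : 1 <= x -> a <= b -> Rpower x a <= Rpower x b.
Proof. by move=> [h|<-] ab; [apply: Rle_Rpower; lra|rewrite /Rpower ln_1 !Rmult_0_r; lra]. Qed.

Lemma Rpower_base1 a : Rpower 1 a = 1.
Proof. by rewrite /Rpower ln_1 Rmult_0_r exp_0. Qed.

Lemma Rpower_ge1 x a : 1 <= x -> 0 <= a -> 1 <= Rpower x a.
Proof. by move=> hx ha; rewrite -(Rpower_O x); [apply: Rpower_le1|lra]. Qed.

Lemma Rpower_div x L a : 0 < x -> 0 < L -> Rpower (x / L) a = Rpower x a * Rpower L (- a).
Proof. by move=> hx hL; rewrite /Rpower ln_div // -exp_plus; congr exp; ring. Qed.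

Lemma Rsum_minus (I : Type) (s : seq I) (p : pred I) (F G : I -> R) :
  \big[Rplus/0]_(i <- s | p i) F i - \big[Rplus/0]_(i <- s | p i) G i =
  \big[Rplus/0]_(i <- s | p i) (F i - G i).
Proof.
rewrite /Rminus big_split /=; congr Rplus.
by apply: (big_morph Ropp) => [a b|]; ring.
Qed.

(** Rankin's trick: a tuple with product at most [x] has weight [(x / product)^(1 + eps) >= 1], and
    the sum of the weights factors into [k] bounded sums. *)
Lemma tau_sum_bound k eps : 0 < eps -> exists C, 0 < C /\ forall x, 1 <= x ->
  INR (tau_sum k x) <= C * Rpower x (1 + eps).
Proof.
move=> e0; have [K [K0 hK]] := @sum_divisors_pow_bounded (1 + eps) 0 ltac:(lra).
exists ((K + 1) ^ k); split; first by apply: pow_lt; lra.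
move=> x x1; set X := nat_floor x.
have [hX _] := @nat_floor_spec x ltac:(lra).
rewrite /tau_sum (@sum_tau_shift k X) // INR_card.
apply: (Rle_trans _ (\big[Rplus/0]_(t : {ffun 'I_k -> 'I_X}) (Rpower x (1 + eps) * \big[Rmult/1]_(j < k) Rpower (INR (t j).+1) (- (1 + eps))))).
  apply: Rsum_le => t _; case: leqP => h; last first.
    by apply: Rmult_le_pos; [exact: Rlt_le (Rpower_pos _ _)|apply: Rprod_ge0 => j _; exact: Rlt_le (Rpower_pos _ _)].
  have p : 0 < INR (\prod_(j < k) (t j).+1)%N by apply: lt_0_INR; apply/ltP; apply: prodn_cond_gt0.
  have -> : \big[Rmult/1]_(j < k) Rpower (INR (t j).+1) (- (1 + eps)) = Rpower (INR (\prod_(j < k) (t j).+1)%N) (- (1 + eps)).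
    rewrite INR_prod.
    suff [] : 0 < \big[Rmult/1]_(j < k) INR (t j).+1 /\ \big[Rmult/1]_(j < k) Rpower (INR (t j).+1) (- (1 + eps)) = Rpower (\big[Rmult/1]_(j < k) INR (t j).+1) (- (1 + eps)) by [].
    apply: (big_ind2 (fun x y => 0 < x /\ y = Rpower x (- (1 + eps)))) => [|u y u' y' [hx ->] [hx' ->]|i _].
    - by split; [lra|rewrite Rpower_base1].
    - by split; [nra|rewrite Rpower_mult_distr].
    - by split => //; apply: lt_0_INR; lia.
  rewrite -Rpower_div //; last lra.
  apply: Rpower_ge1; last lra.
  apply/Rle_div_r => //; rewrite Rmult_1_l; apply: Rle_trans hX; apply: le_INR; exact/leP.
rewrite Rsum_const_mul Rmult_comm; apply: Rmult_le_compat_r; first exact: Rlt_le (Rpower_pos _ _).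
rewrite -(bigA_distr_bigA (fun (j : 'I_k) (c : 'I_X) => Rpower (INR c.+1) (- (1 + eps)))) /=.
rewrite big_const card_ord.
have h : \big[Rplus/0]_(c < X) Rpower (INR c.+1) (- (1 + eps)) <= K.
  by apply: Rle_trans (hK X); apply: Req_le; apply: eq_bigr => c _; rewrite pow_O Rmult_1_l.
have h0 : 0 <= \big[Rplus/0]_(c < X) Rpower (INR c.+1) (- (1 + eps)).
  by apply: Rsum_ge0 => c _; exact: Rlt_le (Rpower_pos _ _).
move: h h0; move: (\big[Rplus/0]_(c < X) _) => q h h0.
have -> : iter k (Rmult q) 1 = q ^ k by elim: k => //= n ->.
by apply: pow_incr; lra.
Qed.

(** Dropping the coprimality conditions only enlarges the set of matrices and makes the rows
    independent. *)
Lemma tau_prod_sum_le r k x : (tau_prod_sum r k x <= tau_sum k x ^ r)%N.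
Proof.
set X := nat_floor x; rewrite /tau_prod_sum sum_tau_mat /tau_sum (@sum_tau_shift k X) //.
apply/leP; apply: INR_le; rewrite INR_card.
have -> : INR (#|[set t : {ffun 'I_k -> 'I_X} | (\prod_(j < k) (t j).+1 <= X)%N]| ^ r)%N =
   \big[Rmult/1]_(i < r) \big[Rplus/0]_(t : {ffun 'I_k -> 'I_X}) bR (\prod_(j < k) (t j).+1 <= X)%N.
  rewrite -INR_card big_const card_ord; move: #|_| => c.
  by elim: r => //= n <-; rewrite expnS INRM.
rewrite (bigA_distr_bigA (fun (i : 'I_r) (t : {ffun 'I_k -> 'I_X}) => bR (\prod_(j < k) (t j).+1 <= X)%N)).
apply: Rsum_le => m _; rewrite -bR_forall; apply: bR_le => /andP[_ h]; exact: h.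
Qed.

Section ErrorBound.
Variables (r k : nat) (P : seq R) (delta KD : R).
Hypothesis r1 : (0 < r)%N.
Hypothesis hdelta : 0 < delta < 1.
Hypothesis hD : forall y, 0 < y -> Rabs (INR (tau_sum k y) - log_poly P y) <= KD * Rpower y delta.

Lemma KD_ge0 : 0 <= KD.
Proof.
have := hD Rlt_0_1; rewrite Rpower_base1 Rmult_1_r.
by have := Rabs_pos (INR (tau_sum k 1) - log_poly P 1); lra.
Qed.

(** Below 1 the sum is empty; from 1 on, [y^delta <= y] puts the error under the size of the main
    term. *)
Lemma tau_sum_div_bound eps : 0 < eps -> exists A, 0 < A /\ forall x L, 1 <= x -> 1 <= L ->
  Rabs (INR (tau_sum k (x / L))) <= A * Rpower x (1 + eps) * Rpower L (- (1 - eps)).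
Proof.
move=> e0; have [A [A0 hA]] := log_poly_bound P e0; have K0 := KD_ge0.
exists (A + KD); split; first lra.
move=> x L x1 L1.
have p := Rpower_pos x (1 + eps); have p' := Rpower_pos L (- (1 - eps)).
have xL : 0 < x / L by apply: Rdiv_lt_0_compat; lra.
have [h|h] := Rlt_le_dec (x / L) 1.
  rewrite tau_sum_lt1 ?Rabs_R0; last lra.
  by do !(apply: Rmult_le_pos); lra.
have h1 := hA x L x1 L1; have h2 := hD xL.
have h3 : Rpower (x / L) delta <= Rpower x (1 + eps) * Rpower L (- (1 - eps)).
  apply: (Rle_trans _ (Rpower (x / L) 1)); first by apply: Rpower_le1; lra.
  rewrite Rpower_div; [|lra|lra].
  by apply: Rmult_le_compat; try (exact: Rlt_le (Rpower_pos _ _)); apply: Rpower_le1; lra.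
have h4 := Rabs_triang (INR (tau_sum k (x / L)) - log_poly P (x / L)) (log_poly P (x / L)).
rewrite (_ : INR (tau_sum k (x / L)) - log_poly P (x / L) + log_poly P (x / L) = INR (tau_sum k (x / L))) in h4; last by ring.
apply: (Rle_trans _ _ _ h4).
have h5 : KD * Rpower (x / L) delta <= KD * (Rpower x (1 + eps) * Rpower L (- (1 - eps))) by apply: Rmult_le_compat_l.
lra.
Qed.

(** Exchanging row [i0] costs [(x / Lam_i0)^delta], while each other row costs
    [x^(1+e) Lam_i^(-(1-e))]. Summed over [d] this is [x^(delta + (r-1)(1+e))] times a convergent
    sum. The constant does not depend on [N]. *)
Lemma tau_prod_sum_error eps : 0 < eps -> exists C, forall x N, 1 <= x -> (nat_floor x <= N)%N ->
  Rabs (INR (tau_prod_sum r k x) - main_box_sum r k P x N) <= C * Rpower x (INR r - 1 + delta + eps).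
Proof.
move=> e0.
have rp : 0 < INR r by apply: lt_0_INR; lia.
have er : 0 < eps / INR r by apply: Rdiv_lt_0_compat.
(* [delta / 2] makes the exponents [1 - e] and [delta] add up to more than 1, [1 - delta] keeps
   [delta <= 1 - e], and [eps / r] keeps the total loss in the power of [x] below [eps]. *)
set e := Rmin (Rmin (delta / 2) (1 - delta)) (eps / INR r).
have [e1 [e2 e3]] : e <= delta / 2 /\ (e <= 1 - delta /\ e <= eps / INR r).
  by have := Rmin_l (Rmin (delta / 2) (1 - delta)) (eps / INR r); have := Rmin_r (Rmin (delta / 2) (1 - delta)) (eps / INR r); have := Rmin_l (delta / 2) (1 - delta); have := Rmin_r (delta / 2) (1 - delta); rewrite -/e; lra.
have ep : 0 < e by apply: Rmin_pos => //; apply: Rmin_pos; lra.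
have [A1 [A10 hA1]] := log_poly_bound P ep.
have [A2 [A20 hA2]] := tau_sum_div_bound ep.
have [K [K0 hK]] := @row_lcm_sum_bounded r k delta (1 - e) ltac:(lra) ltac:(lra).
have KD0 := KD_ge0.
set A := A1 + A2.
exists (INR r * (KD * A ^ r.-1 * K)) => x N x1 hN.
have x0 : 0 <= x by lra.
rewrite (tau_prod_sum_box _ _ x0 hN).
set c := A * Rpower x (1 + e).
have c0 : 0 < c by apply: Rmult_lt_0_compat; [rewrite /A; lra|exact: Rpower_pos].
have step (d : {ffun conflict r k -> nat}) :
  Rabs ((\big[Rmult/1]_e mu (d e).+1) * \big[Rmult/1]_(i < r) INR (tau_sum k (x / INR (row_lcm (fun e => (d e).+1) i))) - main_box_term P x d)
  <= \big[Rplus/0]_(i0 < r) (KD * Rpower x delta * c ^ r.-1 *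
      (Rpower (INR (row_lcm (fun e => (d e).+1) i0)) (- delta)
     * Rpower (INR (\prod_(i | i != i0) row_lcm (fun e => (d e).+1) i)%N) (- (1 - e)))).
  rewrite /main_box_term -Rmult_minus_distr_l Rabs_mult -[X in _ <= X]Rmult_1_l.
  apply: Rmult_le_compat; try exact: Rabs_pos; first exact: mu_prod_le1.
  pose Ai i := c * Rpower (row_modulus d i) (- (1 - e)).
  (* [Bi] is the absolute error in row [i]; its quotient by [Ai] is the relative error that
     [Rprod_diff_le] expects. *)
  pose Bi i := KD * Rpower x delta * Rpower (row_modulus d i) (- delta).
  have Ai0 i : 0 < Ai i by apply: Rmult_lt_0_compat => //; exact: Rpower_pos.
  apply: (Rle_trans _ ((\big[Rmult/1]_(i < r) Ai i) * \big[Rplus/0]_(i < r) (Bi i / Ai i))).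
    have R1 i := row_ge1 d i.
    have mono L : 1 <= L -> forall A', 0 < A' <= A -> A' * Rpower x (1 + e) * Rpower L (- (1 - e)) <= c * Rpower L (- (1 - e)).
      move=> _ A' hA'; rewrite /c; apply: Rmult_le_compat_r; first exact: Rlt_le (Rpower_pos _ _).
      apply: Rmult_le_compat_r; [exact: Rlt_le (Rpower_pos _ _)|lra].
    apply: Rprod_diff_le => i.
    - apply: (Rle_trans _ _ _ (hA2 x (row_modulus d i) x1 (R1 i))); apply: mono => //; rewrite /A; lra.
    - apply: (Rle_trans _ _ _ (hA1 x (row_modulus d i) x1 (R1 i))); apply: mono => //; rewrite /A; lra.
    - have -> : Ai i * (Bi i / Ai i) = Bi i by field; have := Ai0 i; lra.
      rewrite /Bi Rmult_assoc -Rpower_div; [|lra|by have := R1 i; lra].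
      apply: hD; apply: Rdiv_lt_0_compat; [lra|by have := R1 i; rewrite /row_modulus; lra].
  rewrite big_distrr /=; apply: Rsum_le => i0 _.
  rewrite (bigD1 i0) //= (prod_row_power d i0 c) /Bi /row_modulus.
  have swap q y V U a : 0 < a -> a * (q * V) * (KD * y * U / a) = KD * y * q * (U * V).
    by move=> a0; field; lra.
  apply: Req_le; exact: swap (Ai0 i0).
rewrite /main_box_sum /boxsum.
rewrite Rsum_minus.
apply: (Rle_trans _ _ _ (Rabs_sum_le _ _ _)).
apply: Rle_trans; first by apply: Rsum_le => d _; exact: (step (box_pt d)).
rewrite exchange_big /=.
apply: (Rle_trans _ (\big[Rplus/0]_(i0 < r) (KD * Rpower x delta * c ^ r.-1 * K))).
  apply: Rsum_le => i0 _; rewrite Rsum_const_mul; apply: Rmult_le_compat_l.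
    by do !(apply: Rmult_le_pos) => //; [exact: Rlt_le (Rpower_pos _ _)|apply: pow_le; lra].
  apply: Rle_trans (hK N i0); apply: Req_le; apply: eq_bigr => d _.
  have E i : row_lcm (fun e => (box_pt d e).+1) i = row_lcm (fun e => (d e).+1) i.
    by apply: eq_bigr => j _; apply: eq_bigr => f _; rewrite ffunE.
  by rewrite E (eq_bigr _ (fun i _ => E i)).
rewrite big_const card_ord.
have -> : forall q n, iter n (Rplus q) 0 = INR n * q.
  by move=> q; elim=> [|n IH]; [rewrite /=; ring|rewrite iterS IH S_INR; ring].
rewrite [X in _ <= X]Rmult_assoc; apply: Rmult_le_compat_l; first lra.
have -> : c ^ r.-1 = A ^ r.-1 * Rpower x ((1 + e) * INR r.-1).
  by rewrite /c Rpow_mult_distr -Rpower_mult -(Rpower_pow r.-1 (Rpower x (1 + e))) //; exact: Rpower_pos.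
have -> : KD * Rpower x delta * (A ^ r.-1 * Rpower x ((1 + e) * INR r.-1)) * K =
   KD * A ^ r.-1 * K * Rpower x (delta + (1 + e) * INR r.-1) by rewrite Rpower_plus; ring.
apply: Rmult_le_compat_l.
  by do !(apply: Rmult_le_pos) => //; apply: pow_le; rewrite /A; lra.
apply: Rpower_le1 => //.
have r1' : INR r.-1 = INR r - 1.
  by rewrite -{2}(prednK r1) S_INR; ring.
rewrite r1'.
have h : e * (INR r - 1) <= eps.
  have : e * INR r <= eps by apply/Rle_div_r.
  by nra.
lra.
Qed.

End ErrorBound.

(** * The infimum of the admissible exponents *)

Section Alpha.
Variables (k : nat) (P : seq R).
Hypothesis k0 : (0 < k)%N.
Hypothesis mainP : forall x, 0 < x -> main_term k x = log_poly P x.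

(** The arguments [x / Lam_i] fall below any fixed bound, even below 1. On [[1, x1)] both parts are
    bounded; on [(0, 1)] the sum is empty and the logarithms in the main term cost at most
    [y^(-(1 - delta))]. *)
Lemma Delta_bigO_global delta : 0 < delta < 1 -> Delta_bigO k delta ->
  exists K, forall y, 0 < y -> Rabs (INR (tau_sum k y) - log_poly P y) <= K * Rpower y delta.
Proof.
move=> hd [K1 [x0 h]].
have [B [B0 hB]] := poly_growth P.
have [C [C0 hC]] := @pow_le_exp (size P).-1 (1 - delta) ltac:(lra).
set x1 := Rmax x0 1.
have [x11 x10] : 1 <= x1 /\ x0 <= x1 by split; [apply: Rmax_r|apply: Rmax_l].
have lx1 : 0 <= ln x1 by rewrite -ln_1; apply: ln_le; lra.
set K2 := INR (tau_sum k x1) + x1 * (B * (1 + ln x1) ^ (size P).-1).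
have K20 : 0 <= K2.
  apply: Rplus_le_le_0_compat; first exact: pos_INR.
  by do !(apply: Rmult_le_pos); try lra; apply: pow_le; lra.
exists (Rabs K1 + K2 + B * C) => y y0.
have p := Rpower_pos y delta.
have BC : 0 <= B * C by nra.
have a0 := Rabs_pos K1.
have [ya|ya] := Rle_lt_dec x1 y.
  have := h y y0 ltac:(lra); rewrite /Delta_tau mainP // => h1.
  apply: (Rle_trans _ _ _ h1); apply: Rmult_le_compat_r; first lra.
  by have := Rle_abs K1; lra.
have [yb|yb] := Rle_lt_dec 1 y.
  have q : 1 <= Rpower y delta by apply: Rpower_ge1; lra.
  have ly : 0 <= ln y <= ln x1 by split; [rewrite -ln_1; apply: ln_le; lra|apply: ln_le; lra].
  suff : Rabs (INR (tau_sum k y) - log_poly P y) <= K2 by nra.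
  apply: (Rle_trans _ _ _ (Rabs_triang _ _)); rewrite Rabs_Ropp.
  apply: Rplus_le_compat.
    rewrite Rabs_pos_eq; last exact: pos_INR.
    by apply: le_INR; apply/leP; apply: tau_sum_mono; lra.
  rewrite /log_poly Rabs_mult Rabs_pos_eq; last lra.
  apply: Rmult_le_compat; [lra|exact: Rabs_pos|lra|].
  apply: (Rle_trans _ _ _ (hB _)); apply: Rmult_le_compat_l => //.
  by apply: pow_incr; rewrite Rabs_pos_eq; lra.
rewrite tau_sum_lt1; last lra.
rewrite Rminus_0_l Rabs_Ropp /log_poly Rabs_mult Rabs_pos_eq; last lra.
have ly : ln y < 0 by rewrite -ln_1; apply: ln_increasing.
have h1 : Rabs (peval P (ln y)) <= B * (C * exp ((1 - delta) * - ln y)).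
  apply: (Rle_trans _ _ _ (hB _)); apply: Rmult_le_compat_l => //.
  by rewrite Rabs_left //; apply: hC; lra.
have -> : Rpower y delta = y * exp ((1 - delta) * - ln y).
  by rewrite -{2}(exp_ln y) // -exp_plus /Rpower; congr exp; ring.
have ee := exp_pos ((1 - delta) * - ln y).
apply: (Rle_trans _ (y * (B * (C * exp ((1 - delta) * - ln y))))); first by apply: Rmult_le_compat_l; lra.
have : 0 <= y * exp ((1 - delta) * - ln y) by nra.
nra.
Qed.

Lemma tau_gt0 n : (0 < n)%N -> (0 < tau k n)%N.
Proof.
move=> n0; rewrite /tau card_gt0; apply/set0Pn.
exists [ffun j => if j == Ordinal k0 then inord n else inord 1].
rewrite inE (bigD1 (Ordinal k0)) //= ffunE eqxx inordK // big1 ?muln1 // => j hj.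
by rewrite ffunE (negbTE hj) inordK.
Qed.

Lemma log_poly_continuous y : 0 < y -> continuity_pt (log_poly P) y.
Proof.
move=> y0; apply: continuity_pt_mult; first exact: derivable_continuous_pt (derivable_pt_id y).
apply: (continuity_pt_comp ln (peval P)).
  exact: (derivable_continuous_pt ln y (exist _ (/ y) (derivable_pt_lim_ln y y0))).
elim: P => [|c s IH] /=; first by apply: continuity_pt_const => a b.
apply: continuity_pt_plus; first by apply: continuity_pt_const => a b.
by apply: continuity_pt_mult => //; exact: derivable_continuous_pt (derivable_pt_id _).
Qed.

(* [Delta] jumps by [tau k n >= 1] at every integer while the main term is continuous. *)
Lemma Delta_bigO_ge0 a : Delta_bigO k a -> 0 <= a.
Proof.
move=> [K [x0 h]]; have [//|an] := Rle_lt_dec 0 a.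
have K0 := Rabs_pos K.
(* From [exp T] on, [|K| y^a] is below [1/3]. Two values of the error term and the variation of the
   main term, each below [1/3], cannot produce a jump of at least 1. *)
set T := ln (6 * Rabs K + 1) / - a.
have [n [n1 n2 n3]] : exists n : nat, [/\ 1 < INR n, x0 < INR n - 1 & exp T < INR n - 1].
  have [n hn] := INR_archimed 1 (Rabs x0 + exp T + 2) Rlt_0_1.
  rewrite Rmult_1_r in hn.
  exists n; have := exp_pos T; have := Rle_abs x0; have := Rabs_pos x0; split; lra.
have small y : INR n - 1 <= y -> Rabs (Delta_tau k y) < / 3.
  move=> hy; have eT := exp_pos T.
  have y0 : 0 < y by lra.
  apply: (Rle_lt_trans _ _ _ (h y y0 ltac:(lra))).
  have ly : T <= ln y by rewrite -(ln_exp T); apply: ln_le; lra.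
  have : Rpower y a <= / (6 * Rabs K + 1).
    have -> : / (6 * Rabs K + 1) = exp (a * T).
      rewrite /T (_ : a * _ = - ln (6 * Rabs K + 1)); last by field; lra.
      by rewrite exp_Ropp exp_ln //; lra.
    by apply: exp_le; nra.
  have p := Rpower_pos y a => hp.
  apply: (Rle_lt_trans _ (Rabs K * / (6 * Rabs K + 1))).
    apply: (Rle_trans _ (Rabs K * Rpower y a)); first by apply: Rmult_le_compat_r; [lra|exact: Rle_abs].
    by apply: Rmult_le_compat_l.
  apply: (Rmult_lt_reg_r (6 * Rabs K + 1)); first lra.
  by rewrite Rmult_assoc Rinv_l; lra.
have np : 0 < INR n by lra.
have [al [al0 hal]] := @log_poly_continuous (INR n) np (/ 3) ltac:(lra).
set t := Rmin (al / 2) (/ 2).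
have [t0 [t1 t2]] : 0 < t /\ (t < al /\ t < 1).
  by have := Rmin_l (al / 2) (/ 2); have := Rmin_r (al / 2) (/ 2); rewrite -/t; split; [apply: Rmin_pos; lra|lra].
have hM : Rabs (log_poly P (INR n - t) - log_poly P (INR n)) < / 3.
  have := hal (INR n - t); rewrite /dist /= /R_dist; apply; split.
    by split => //; lra.
  rewrite (_ : INR n - t - INR n = - t); last by ring.
  by rewrite Rabs_Ropp Rabs_pos_eq; lra.
have s1 := small (INR n) ltac:(lra); have s2 := small (INR n - t) ltac:(lra).
rewrite /Delta_tau !mainP in s1 s2; try lra.
have n0 : (0 < n)%N by apply/ltP; apply: INR_lt; rewrite /=; lra.
have f1 : nat_floor (INR n) = n by apply: nat_floor_unique; lra.
have f2 : nat_floor (INR n - t) = n.-1.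
  apply: nat_floor_unique; rewrite -{2 3}(prednK n0) S_INR; lra.
have : tau_sum k (INR n) = (tau_sum k (INR n - t) + tau k n)%N.
  by rewrite /tau_sum f1 f2 prednK // big_nat_recr.
move=> /(congr1 INR); rewrite INRD.
have : 1 <= INR (tau k n) by apply: (le_INR 1); apply/leP; apply: tau_gt0.
move: s1 s2 hM => /Rabs_def2 s1 /Rabs_def2 s2 /Rabs_def2 hM; lra.
Qed.

(** Some exponent is admissible, so the infimum is not [+oo]. *)
Lemma Delta_bigO_2 : Delta_bigO k 2.
Proof.
have [C [C0 hC]] := @tau_sum_bound k 1 Rlt_0_1.
have [A [A0 hA]] := log_poly_bound P Rlt_0_1.
exists (C + A), 1 => x x0 x1; rewrite /Delta_tau mainP //.
apply: (Rle_trans _ _ _ (Rabs_triang _ _)); rewrite Rabs_Ropp Rabs_pos_eq; last exact: pos_INR.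
have h1 := hC x x1; have h2 := hA x 1 x1 (Rle_refl 1).
rewrite Rpower_base1 Rmult_1_r Rdiv_1_r in h2.
have -> : (2 : R) = 1 + 1 by ring.
lra.
Qed.

Lemma Delta_bigO_le a b : a <= b -> Delta_bigO k a -> Delta_bigO k b.
Proof.
move=> ab [K [x0 h]]; exists (Rabs K), (Rmax x0 1) => x xp xx.
have [x1 x2] : x0 <= x /\ 1 <= x by have := Rmax_l x0 1; have := Rmax_r x0 1; lra.
apply: (Rle_trans _ _ _ (h x xp x1)).
apply: (Rle_trans _ (Rabs K * Rpower x a)).
  by apply: Rmult_le_compat_r; [exact: Rlt_le (Rpower_pos _ _)|exact: Rle_abs].
by apply: Rmult_le_compat_l; [exact: Rabs_pos|apply: Rpower_le1].
Qed.

(** [alpha] takes the real part of an extended infimum, which would be 0 at an infinite value. The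
    lower bound 0 and the admissible exponent 2 make the infimum finite, and admissibility is upward
    closed. *)
Lemma alpha_spec : 0 <= alpha k /\ forall a, alpha k < a -> Delta_bigO k a.
Proof.
have [lb gl] := Glb_Rbar_correct (Delta_bigO k).
have g0 : Rbar_le 0 (Glb_Rbar (Delta_bigO k)).
  by apply: gl => a ha; apply: Delta_bigO_ge0.
have g2 := lb 2 Delta_bigO_2.
have E : Glb_Rbar (Delta_bigO k) = Rbar.Finite (alpha k).
  by rewrite /alpha; case: (Glb_Rbar _) g0 g2.
rewrite E in g0 lb gl; split => // a ha.
have [//|n] := classic (Delta_bigO k a).
have : Rbar_le a (alpha k).
  apply: gl => b hb /=; have [//|ba] := Rle_lt_dec a b.
  by case: n; apply: Delta_bigO_le hb; lra.
by move=> /= h; lra.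
Qed.

End Alpha.

(** * Computability of the coefficients *)

Definition rec1 (f : nat -> nat) := recs 1 (fun s => f (nth 0%N s 0)).

Lemma rec1_recursive1 f : rec1 f -> recursive1 f.
Proof.
move=> h; apply: (rec_comp (h := fun (i : 'I_1) (v : 1.-tuple nat) => tnth v i) h).
  by move=> i; apply: (rec_proj (i := i)).
move=> v; congr f; rewrite /thead -[RHS](tnth_nth 0%N _ ord0) tnth_mktuple //.
Qed.

Lemma rec1_id : rec1 id.
Proof. exact: recs_var. Qed.

Lemma rec1_const c : rec1 (fun=> c).
Proof. exact: recs_const. Qed.

Lemma rec1_add f g : rec1 f -> rec1 g -> rec1 (fun n => f n + g n)%N.
Proof. exact: recs_add. Qed.

Lemma rec1_mul f g : rec1 f -> rec1 g -> rec1 (fun n => f n * g n)%N.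
Proof. exact: recs_mul. Qed.

Lemma rec1_comp f g : rec1 f -> rec1 g -> rec1 (fun n => f (g n)).
Proof. exact: recs_comp1. Qed.

Definition recq (u : nat -> R) := exists p q m : nat -> nat,
  [/\ rec1 p, rec1 q, rec1 m & forall n, u n = (INR (p n) - INR (q n)) / INR (m n).+1].

Lemma recq_ext u v : (forall n, u n = v n) -> recq u -> recq v.
Proof.
by move=> e [p [q [m [h1 h2 h3 h4]]]]; exists p, q, m; split => // n; rewrite -e.
Qed.

Lemma recq_plus u v : recq u -> recq v -> recq (fun n => u n + v n).
Proof.
move=> [p [q [m [h1 h2 h3 h4]]]] [p' [q' [m' [h1' h2' h3' h4']]]].
exists (fun n => p n * (m' n).+1 + p' n * (m n).+1)%N,
  (fun n => q n * (m' n).+1 + q' n * (m n).+1)%N,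
  (fun n => m n * m' n + m n + m' n)%N; split.
- by apply: rec1_add; apply: rec1_mul => //; apply: recs_succ.
- by apply: rec1_add; apply: rec1_mul => //; apply: recs_succ.
- by do !(apply: rec1_add) => //; apply: rec1_mul.
move=> n; rewrite h4 h4'.
have -> : ((m n * m' n + m n + m' n).+1 = (m n).+1 * (m' n).+1)%N by lia.
have := INR_S_neq0 (m n); have := INR_S_neq0 (m' n); move: (m n).+1 (m' n).+1 => a b b0 a0.
by rewrite !INRD !INRM; field.
Qed.

Lemma recq_mult u v : recq u -> recq v -> recq (fun n => u n * v n).
Proof.
move=> [p [q [m [h1 h2 h3 h4]]]] [p' [q' [m' [h1' h2' h3' h4']]]].
exists (fun n => p n * p' n + q n * q' n)%N, (fun n => p n * q' n + q n * p' n)%N,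
  (fun n => m n * m' n + m n + m' n)%N; split.
- by apply: rec1_add; apply: rec1_mul.
- by apply: rec1_add; apply: rec1_mul.
- by do !(apply: rec1_add) => //; apply: rec1_mul.
move=> n; rewrite h4 h4'.
have -> : ((m n * m' n + m n + m' n).+1 = (m n).+1 * (m' n).+1)%N by lia.
have := INR_S_neq0 (m n); have := INR_S_neq0 (m' n); move: (m n).+1 (m' n).+1 => a b b0 a0.
by rewrite !INRD !INRM; field.
Qed.

Lemma recq_const c : is_rat c -> recq (fun=> c).
Proof.
move=> [p [q [m e]]]; exists (fun=> p), (fun=> q), (fun=> m).
by split => //; apply: rec1_const.
Qed.

Lemma recq_nat f : rec1 f -> recq (fun n => INR (f n)).
Proof.
move=> h; exists f, (fun=> 0%N), (fun=> 0%N); split => //; try exact: rec1_const.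
by move=> n; rewrite /=; field.
Qed.

Lemma recq_inv f : rec1 f -> (forall n, 0 < f n)%N -> recq (fun n => / INR (f n)).
Proof.
move=> h h0; exists (fun=> 1%N), (fun=> 0%N), (fun n => (f n).-1); split; try exact: rec1_const.
  exact: recs_pred.
by move=> n; rewrite prednK // [INR 1]/= [INR 0]/= /Rdiv; ring.
Qed.

Lemma recq_comp u f : recq u -> rec1 f -> recq (fun n => u (f n)).
Proof.
move=> [p [q [m [h1 h2 h3 h4]]]] h.
exists (fun n => p (f n)), (fun n => q (f n)), (fun n => m (f n)); split; try exact: rec1_comp.
by move=> n; rewrite h4.
Qed.

Lemma recq_bigsum N (u : nat -> nat -> R) : (forall j, recq (u j)) ->
  recq (fun n => \big[Rplus/0]_(j < N) u j n).
Proof.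
move=> h; elim: N => [|N IH].
  by apply: recq_ext (recq_const (is_rat_nat 0)) => n; rewrite big_ord0.
apply: (@recq_ext (fun n => \big[Rplus/0]_(j < N) u j n + u N n)); last exact: recq_plus.
by move=> n; rewrite big_ord_recr.
Qed.

(* Geometric rate with arbitrary constants; the rate [2^-n] is reached along [n |-> a n + b]. *)
Definition geom_computable (y : R) := exists (u : nat -> R) (K th : R),
  [/\ recq u, 0 < th < 1 & forall n, Rabs (y - u n) <= K * th ^ n].

Lemma pow_lt_eps th eps : 0 < th < 1 -> 0 < eps -> exists n, th ^ n < eps.
Proof.
move=> h e0; have [N hN] := pow_lt_1_zero th ltac:(rewrite Rabs_pos_eq; lra) eps e0.
by exists N; apply: Rle_lt_trans (hN N (Nat.le_refl _)); apply: Rle_abs.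
Qed.

Lemma geom_computable_real y : geom_computable y -> computable_real y.
Proof.
move=> [u [K [th [hu ht h]]]].
(* [a] brings the rate below [1/2], and the offset [b] absorbs the constant [K]; both are fixed
   numbers, so [n |-> a n + b] is recursive. *)
have [a ha] := @pow_lt_eps th (/ 2) ht ltac:(lra).
have K0 := Rabs_pos K.
have [b hb] := @pow_lt_eps th (/ (Rabs K + 1)) ht ltac:(apply: Rinv_0_lt_compat; lra).
have [p [q [m [h1 h2 h3 h4]]]] : recq (fun n => u (a * n + b)%N).
  apply: recq_comp => //; apply: rec1_add; last exact: rec1_const.
  by apply: rec1_mul; [exact: rec1_const|exact: rec1_id].
exists p, q, m; split; try exact: rec1_recursive1.
move=> n; rewrite -h4; apply: (Rle_trans _ _ _ (h _)).
rewrite pow_add pow_mult.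
have q0 : 0 <= th ^ b by apply: pow_le; lra.
have q1 : 0 <= th ^ a by apply: pow_le; lra.
have q2 : (th ^ a) ^ n <= (/ 2) ^ n by apply: pow_incr; lra.
have q3 : 0 <= (th ^ a) ^ n by apply: pow_le.
have q4 : Rabs K * th ^ b <= 1.
  have : Rabs K * th ^ b <= Rabs K * / (Rabs K + 1) by apply: Rmult_le_compat_l; lra.
  have : Rabs K * / (Rabs K + 1) = 1 - / (Rabs K + 1) by field; lra.
  by have : 0 < / (Rabs K + 1) by [apply: Rinv_0_lt_compat; lra]; lra.
rewrite -pow_inv.
apply: (Rle_trans _ (Rabs K * ((th ^ a) ^ n * th ^ b))).
  by apply: Rmult_le_compat_r; [nra|exact: Rle_abs].
have : Rabs K * th ^ b * (th ^ a) ^ n <= 1 * (th ^ a) ^ n by apply: Rmult_le_compat_r.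
nra.
Qed.

Lemma geom_computable_mult x y : geom_computable x -> geom_computable y -> geom_computable (x * y).
Proof.
move=> [u [K [th [hu ht h]]]] [v [K' [th' [hv ht' h']]]].
set t := Rmax th th'.
have [t1 t2] : th <= t /\ th' <= t by split; [apply: Rmax_l|apply: Rmax_r].
have t3 : t < 1 by apply: Rmax_lub_lt; lra.
exists (fun n => u n * v n), (Rabs K * (Rabs y + Rabs K') + Rabs x * Rabs K'), t; split.
- exact: recq_mult.
- lra.
move=> n.
have p1 : th ^ n <= t ^ n by apply: pow_incr; lra.
have p2 : th' ^ n <= t ^ n by apply: pow_incr; lra.
have p0 : 0 <= t ^ n by apply: pow_le; lra.
have p3 : t ^ n <= 1 by rewrite -(pow1 n); apply: pow_incr; lra.
have p4 : 0 <= th ^ n by apply: pow_le; lra.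
have p5 : 0 <= th' ^ n by apply: pow_le; lra.
have a0 := Rabs_pos K; have a1 := Rabs_pos K'; have a2 := Rabs_pos x; have a3 := Rabs_pos y.
have b1 : Rabs (x - u n) <= Rabs K * t ^ n.
  apply: (Rle_trans _ _ _ (h n)); apply: (Rle_trans _ (Rabs K * th ^ n)).
    by apply: Rmult_le_compat_r => //; exact: Rle_abs.
  exact: Rmult_le_compat_l.
have b2 : Rabs (y - v n) <= Rabs K' * t ^ n.
  apply: (Rle_trans _ _ _ (h' n)); apply: (Rle_trans _ (Rabs K' * th' ^ n)).
    by apply: Rmult_le_compat_r => //; exact: Rle_abs.
  exact: Rmult_le_compat_l.
have b3 : Rabs (v n) <= Rabs y + Rabs K'.
  have := Rabs_triang y (- (y - v n)); rewrite Rabs_Ropp (_ : y + - (y - v n) = v n); last by ring.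
  have : Rabs K' * t ^ n <= Rabs K' * 1 by apply: Rmult_le_compat_l.
  lra.
rewrite (_ : x * y - u n * v n = (x - u n) * v n + x * (y - v n)); last by ring.
apply: (Rle_trans _ _ _ (Rabs_triang _ _)); rewrite !Rabs_mult.
have c1 : Rabs (x - u n) * Rabs (v n) <= (Rabs K * t ^ n) * (Rabs y + Rabs K').
  by apply: Rmult_le_compat => //; exact: Rabs_pos.
have c2 : Rabs x * Rabs (y - v n) <= Rabs x * (Rabs K' * t ^ n) by apply: Rmult_le_compat_l.
lra.
Qed.

Lemma geom_computable_rat c : is_rat c -> geom_computable c.
Proof.
move=> h; exists (fun=> c), 0, (/ 2); split; [exact: recq_const|lra|].
by move=> n; rewrite Rminus_diag Rabs_R0; lra.
Qed.

Lemma geom_computable_pow x n : geom_computable x -> geom_computable (x ^ n).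
Proof.
move=> h; elim: n => [|n IH]; first by apply: geom_computable_rat; apply: (is_rat_nat 1).
exact: geom_computable_mult.
Qed.

(** * Recursive approximation of the logarithm of 2 *)

Lemma pow2_INR n : INR (2 ^ n)%N = 2 ^ n.
Proof. by elim: n => // n IH; rewrite expnS INRM IH. Qed.

(* [sum_(N < j <= 2 N) 1/j] is within [1/(2N)] of [ln 2]; each [1/j] is replaced by
   [floor(N^2/j) / N^2]. *)
Definition ln2_num (N : nat) : nat := (\sum_(j < N) (N * N %/ (N + j).+1))%N.

Lemma Rsum_recr n (F : nat -> R) :
  \big[Rplus/0]_(i < n.+1) F i = \big[Rplus/0]_(i < n) F i + F n.
Proof. by rewrite big_ord_recr. Qed.

(** [ln 2 = ln (2 N) - ln N] is a sum of increments of [ln], each between the reciprocals of its two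
    endpoints; the differences of the reciprocals telescope. *)
Lemma harmonic_block N : (0 < N)%N ->
  0 <= ln 2 - \big[Rplus/0]_(j < N) / INR (N + j).+1 <= / INR N.
Proof.
move=> N0.
have Np : 0 < INR N by apply: lt_0_INR; lia.
have tel m : ln (INR (N + m)) - ln (INR N) = \big[Rplus/0]_(j < m) (ln (INR (N + j).+1) - ln (INR (N + j))).
  elim: m => [|m IH]; first by rewrite big_ord0 addn0; ring.
  by rewrite (Rsum_recr m (fun j => ln (INR (N + j).+1) - ln (INR (N + j)))) -IH addnS; ring.
have tel2 m : / INR N - / INR (N + m) = \big[Rplus/0]_(j < m) (/ INR (N + j) - / INR (N + j).+1).
  elim: m => [|m IH]; first by rewrite big_ord0 addn0; ring.
  by rewrite (Rsum_recr m (fun j => / INR (N + j) - / INR (N + j).+1)) -IH addnS; ring.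
have bd j : / INR (N + j).+1 <= ln (INR (N + j).+1) - ln (INR (N + j)) <= / INR (N + j).
  have [lo hi _] := log_step_bounds (N + j).-1.
  by move: lo hi; rewrite /log_step prednK; [split|lia].
have e2 : ln 2 = \big[Rplus/0]_(j < N) (ln (INR (N + j).+1) - ln (INR (N + j))).
  rewrite -tel INRD -ln_div; [|lra|lra]; congr ln; field; lra.
rewrite e2 Rsum_minus; split.
  by apply: Rsum_ge0 => j _; have := bd j; lra.
apply: (Rle_trans _ (/ INR N - / INR (N + N))).
  by rewrite tel2; apply: Rsum_le => j _; have := bd j; lra.
have : 0 < / INR (N + N) by apply: Rinv_0_lt_compat; apply: lt_0_INR; lia.
lra.
Qed.

(** One [1 / N] comes from the harmonic block, the other from [N] roundings of at most [1 / N^2]. *)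
Lemma ln2_num_bound N : (0 < N)%N ->
  Rabs (ln 2 - INR (ln2_num N) / (INR N * INR N)) <= 2 * / INR N.
Proof.
move=> N0.
have Np : 0 < INR N by apply: lt_0_INR; lia.
have h := harmonic_block N0.
have fl j : 0 <= / INR (N + j).+1 - INR (N * N %/ (N + j).+1) / (INR N * INR N) <= / (INR N * INR N).
  have mp : 0 < INR (N + j).+1 by apply: lt_0_INR; lia.
  have h1 := ltn_ceil (N * N) (ltn0Sn (N + j)); have h2 := leq_trunc_div (N * N) (N + j).+1.
  move: mp h1 h2; move: (N * N %/ (N + j).+1)%N => a; move: (N + j).+1 => b b0 h1 h2.
  have l1 : INR a * INR b <= INR N * INR N by rewrite -!INRM; apply: le_INR; apply/leP.
  have l2 : INR N * INR N <= (INR a + 1) * INR b.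
    by rewrite -S_INR -!INRM; apply: le_INR; apply/leP; apply: ltnW.
  have NN : 0 < INR N * INR N by nra.
  have -> : / INR b - INR a / (INR N * INR N) = (INR N * INR N - INR a * INR b) * / (INR b * (INR N * INR N)) by field; lra.
  have -> : / (INR N * INR N) = INR b * / (INR b * (INR N * INR N)) by field; lra.
  have ip : 0 < / (INR b * (INR N * INR N)) by apply: Rinv_0_lt_compat; nra.
  split; first by apply: Rmult_le_pos; lra.
  by apply: Rmult_le_compat_r; lra.
have E : INR (ln2_num N) / (INR N * INR N) = \big[Rplus/0]_(j < N) (INR (N * N %/ (N + j).+1) / (INR N * INR N)).
  by rewrite /ln2_num INR_sum /Rdiv big_distrl.
have h2 : 0 <= \big[Rplus/0]_(j < N) / INR (N + j).+1 - INR (ln2_num N) / (INR N * INR N) <= / INR N.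
  rewrite E Rsum_minus; split; first by apply: Rsum_ge0 => j _; have := fl j; lra.
  apply: (Rle_trans _ (\big[Rplus/0]_(j < N) / (INR N * INR N))).
    by apply: Rsum_le => j _; have := fl j; lra.
  rewrite big_const card_ord.
  have -> : forall q n, iter n (Rplus q) 0 = INR n * q.
    by move=> q; elim=> [|n IH]; [rewrite /=; ring|rewrite iterS IH S_INR; ring].
  by apply: Req_le; field; lra.
by apply: Rabs_le; lra.
Qed.

(** The quotient counts the positive multiples of the divisor up to [F s], which is a bounded
    sum. *)
Lemma recs_div n F G : recs n F -> recs n G -> (forall s, 0 < G s)%N -> recs n (fun s => F s %/ G s)%N.
Proof.
move=> hF hG G0.
have h : recs n (fun s => \sum_(i < F s) ((i.+1 * G s <= F s) : nat))%N.
  apply: (@recs_ext _ (fun s => \sum_(i < F s) ((nth 0 ((i : nat) :: s) 0).+1 * G (behead ((i : nat) :: s)) <= F (behead ((i : nat) :: s)) : nat)))%N.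
    by [].
  apply: (@recs_bsum _ F (fun s => ((nth 0 s 0).+1 * G (behead s) <= F (behead s) : nat))%N) => //.
  apply: recs_leq; last exact: recs_behead.
  by apply: recs_mul; [apply: recs_succ; exact: recs_var|exact: recs_behead].
apply: recs_ext h => s _.
move: (F s) (G s) (G0 s) => a b b0.
have cnt m : (\sum_(i < m) (i.+1 * b <= a) = minn m (a %/ b))%N.
  elim: m => [|m IH]; first by rewrite big_ord0 min0n.
  by rewrite big_ord_recr /= IH -leq_divRL //; lia.
by rewrite cnt; apply/minn_idPr; apply: leq_div.
Qed.

Lemma rec1_ln2_num f : rec1 f -> rec1 (fun n => ln2_num (f n)).
Proof.
move=> hf; apply: (@rec1_comp ln2_num) hf.
have h : recs 2 (fun s => nth 0 s 1 * nth 0 s 1 %/ (nth 0 s 1 + nth 0 s 0).+1)%N.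
  apply: recs_div => //; first by apply: recs_mul; exact: recs_var.
  by apply: recs_succ; apply: recs_add; exact: recs_var.
exact: (@recs_bsum 1 (fun s => nth 0 s 0)%N _ (recs_var (ltnSn 0)) h).
Qed.

(** At [x = 2^n] the coefficients appear multiplied by powers of [ln 2], which this inverse
    removes. *)
Lemma geom_computable_inv_ln2 : geom_computable (/ ln 2).
Proof.
(* The shift by 4 makes the error [2 / N] at most [1/8], which keeps the approximation above [1/4];
   inversion multiplies the error by at most [2 * 4], and [8 * 2 / N = 2^(-n)]. *)
pose N n := (2 ^ (n + 4))%N.
have N0 n : (0 < N n)%N by rewrite expn_gt0.
have NE n : INR (N n) = 16 * 2 ^ n by rewrite pow2_INR pow_add /=; ring.
have l2 := ln_lt_2.
have tp n : 1 <= 2 ^ n by apply: pow_R1_Rle; lra.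
have b n := ln2_num_bound (N0 n).
have ib n : 2 * / INR (N n) <= / 8.
  rewrite NE (_ : 2 * / (16 * 2 ^ n) = / 8 * / 2 ^ n); last by field; have := tp n; lra.
  have : / 2 ^ n <= 1 by rewrite -Rinv_1; apply: Rinv_le_contravar; [lra|exact: tp].
  lra.
have rat_lo n : / 4 <= INR (ln2_num (N n)) / (INR (N n) * INR (N n)).
  by have := b n; have := ib n; move=> h1 /Rabs_le_between h2; lra.
have p0 n : (0 < ln2_num (N n))%N.
  rewrite lt0n; apply/eqP => e; have := rat_lo n; rewrite e /Rdiv Rmult_0_l; lra.
exists (fun n => INR (N n * N n) * / INR (ln2_num (N n))), 1, (/ 2); split.
- have rN : rec1 N by apply: (@recs_exp2 1 (fun s => nth 0 s 0 + 4)%N); apply: recs_add; [exact: recs_var|exact: recs_const].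
  apply: recq_mult; first by apply: recq_nat; apply: rec1_mul.
  by apply: recq_inv => //; apply: rec1_ln2_num.
- lra.
move=> n; rewrite INRM.
have Np : 0 < INR (N n) by apply: lt_0_INR; apply/ltP.
have Pp : 0 < INR (ln2_num (N n)) by apply: lt_0_INR; apply/ltP.
set z := INR (ln2_num (N n)) / (INR (N n) * INR (N n)).
have hz := rat_lo n; have hb := b n; rewrite -/z in hz hb.
have -> : INR (N n) * INR (N n) * / INR (ln2_num (N n)) = / z by rewrite /z; field; lra.
have -> : / ln 2 - / z = - (ln 2 - z) * (/ ln 2 * / z) by field; lra.
rewrite Rabs_mult Rabs_Ropp.
have i1 : 0 < / ln 2 <= 2.
  split; first by apply: Rinv_0_lt_compat; lra.
  by have := Rinv_le_contravar (/ 2) (ln 2) ltac:(lra) ltac:(lra); rewrite Rinv_inv.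
have i2 : 0 < / z <= 4.
  split; first by apply: Rinv_0_lt_compat; lra.
  by rewrite -(Rinv_inv 4); apply: Rinv_le_contravar; lra.
have i3 : Rabs (/ ln 2 * / z) <= 8 by rewrite Rabs_pos_eq; nra.
apply: (Rle_trans _ ((2 * / INR (N n)) * 8)).
  by apply: Rmult_le_compat => //; exact: Rabs_pos.
rewrite NE pow_inv; apply: Req_le; field; have := tp n; lra.
Qed.

(** For fixed [n] the numbers [e l * n^l] are the coefficients of a polynomial in [t] whose values
    at [t = 1, ..., L + 1] are approximated by [u (n t)]. The rational weights of [coef_span]
    recover them, and division by [n^l] does not worsen the error. The code uses [n.+1] in place of
    [n]. *)
Lemma sum_coef_computable L (e : nat -> R) (u : nat -> R) (K th : R) :
  recq u -> 0 < th < 1 ->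
  (forall n, (0 < n)%N -> Rabs (u n - sum_f_R0 (fun l => e l * INR n ^ l) L) <= K * th ^ n) ->
  forall l, (l <= L)%N -> geom_computable (e l).
Proof.
move=> hu ht hK l hl.
have [w [w1 w2]] := coef_span L l.
have K0 := Rabs_pos K.
exists (fun n => / INR (n.+1 ^ l)%N * \big[Rplus/0]_(j < L.+1) (w j * u (n.+1 * j.+1)%N)),
  (Rabs K * \big[Rplus/0]_(j < L.+1) Rabs (w j)), th; split => //.
  apply: recq_mult.
    apply: recq_inv; last by move=> n; rewrite expn_gt0.
    by apply: (@recs_expc 1 (fun s => (nth 0 s 0).+1)%N); apply: recs_succ; exact: recs_var.
  apply: (@recq_bigsum L.+1 (fun j n => w j * u (n.+1 * j.+1)%N)) => j.
  apply: recq_mult; first exact: recq_const.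
  apply: recq_comp => //; apply: rec1_mul; last exact: rec1_const.
  by apply: recs_succ; exact: rec1_id.
move=> n; set s := mkseq (fun i => e i * INR n.+1 ^ i) L.+1.
have sz : size s = L.+1 by rewrite size_mkseq.
have ev j : peval s (INR j.+1) = sum_f_R0 (fun l => e l * INR (n.+1 * j.+1)%N ^ l) L.
  rewrite peval_mkseq !sum_f_R0E; apply: eq_bigr => i _.
  by rewrite INRM Rpow_mult_distr; ring.
have np : 1 <= INR n.+1 by apply: (le_INR 1); lia.
have pl : 1 <= INR n.+1 ^ l by apply: pow_R1_Rle.
have powE : INR (n.+1 ^ l)%N = INR n.+1 ^ l.
  by elim: l {hl w2 pl} => // l IH; rewrite expnS INRM IH.
have cl : e l * INR n.+1 ^ l = \big[Rplus/0]_(j < L.+1) (w j * peval s (INR j.+1)).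
  by rewrite -w2 // nth_mkseq.
have -> : e l = / INR (n.+1 ^ l)%N * \big[Rplus/0]_(j < L.+1) (w j * peval s (INR j.+1)).
  by rewrite -cl powE; field; lra.
rewrite -Rmult_minus_distr_l Rsum_minus Rabs_mult.
have il : Rabs (/ INR (n.+1 ^ l)%N) <= 1.
  rewrite powE Rabs_pos_eq; last by apply: Rlt_le; apply: Rinv_0_lt_compat; lra.
  by rewrite -Rinv_1; apply: Rinv_le_contravar; lra.
have S0 : 0 <= \big[Rplus/0]_(j < L.+1) Rabs (w j) by apply: Rsum_ge0 => j _; apply: Rabs_pos.
have tn : 0 <= th ^ n by apply: pow_le; lra.
rewrite -[X in _ <= X]Rmult_1_l; apply: Rmult_le_compat => //; try exact: Rabs_pos.
apply: (Rle_trans _ _ _ (Rabs_sum_le _ _ _)).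
rewrite (Rmult_comm (Rabs K)) Rmult_assoc big_distrl; apply: Rsum_le => j _.
rewrite -Rmult_minus_distr_l Rabs_mult; apply: Rmult_le_compat_l; first exact: Rabs_pos.
rewrite -Rabs_Ropp Ropp_minus_distr ev.
apply: (Rle_trans _ _ _ (hK _ _)); first by rewrite muln_gt0.
apply: (Rle_trans _ (Rabs K * th ^ (n.+1 * j.+1))).
  by apply: Rmult_le_compat_r; [apply: pow_le; lra|exact: Rle_abs].
apply: Rmult_le_compat_l => //.
have -> : (n.+1 * j.+1 = n + (n.+1 * j.+1 - n))%N by rewrite subnKC //; nia.
rewrite pow_add -[X in _ <= X]Rmult_1_r; apply: Rmult_le_compat_l => //.
rewrite -(pow1 (n.+1 * j.+1 - n)); apply: pow_incr; lra.
Qed.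

(** Powers of 2 make [x^r] an integer and [ln x = n ln 2], with error [2^(- eta n)] after division
    by [x^r]. The constants [C] and [eta] need only exist, since computability of a single number
    allows any fixed offset and rate. *)
Lemma asymptotic_computable r k L (d : nat -> R) (C eta : R) : 0 < eta ->
  (forall x, 2 <= x -> Rabs (INR (tau_prod_sum r k x) - x ^ r * sum_f_R0 (fun l => d l * ln x ^ l) L)
     <= C * Rpower x (INR r - eta)) ->
  forall l, (l <= L)%N -> computable_real (d l).
Proof.
move=> e0 h l hl; apply: geom_computable_real.
have l2 := ln_lt_2.
set th := Rpower 2 (- eta).
have hth : 0 < th < 1.
  split; first exact: Rpower_pos.
  by rewrite /th -(Rpower_O 2); [apply: Rpower_lt; lra|lra].
pose u n := INR (tau_box r k (2 ^ n)) * / INR (2 ^ (r * n))%N.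
have hu : recq u.
  apply: recq_mult.
    by apply: recq_nat; apply: (@recs_tau_box r k 1 (fun s => 2 ^ nth 0 s 0)%N); apply: (@recs_exp2 1 (fun s => nth 0 s 0)%N); exact: recs_var.
  apply: recq_inv; last by move=> n; rewrite expn_gt0.
  by apply: (@recs_exp2 1 (fun s => r * nth 0 s 0)%N); apply: recs_mul; [exact: recs_const|exact: recs_var].
have E : geom_computable (d l * ln 2 ^ l).
  apply: (@sum_coef_computable L (fun l => d l * ln 2 ^ l) u C th) => // n n0.
  have x2 : 2 <= 2 ^ n by rewrite -{1}(pow_1 2); apply: Rle_pow; [lra|lia].
  have := h (2 ^ n) x2.
  have -> : tau_prod_sum r k (2 ^ n) = tau_box r k (2 ^ n).
    rewrite /tau_prod_sum -pow2_INR (_ : nat_floor (INR (2 ^ n)) = (2 ^ n)%N) //.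
    by apply: nat_floor_unique; lra.
  have -> : ln (2 ^ n) = INR n * ln 2 by rewrite ln_pow; lra.
  have -> : sum_f_R0 (fun l => d l * (INR n * ln 2) ^ l) L = sum_f_R0 (fun l => d l * ln 2 ^ l * INR n ^ l) L.
    by apply: PartSum.sum_eq => i _; rewrite Rpow_mult_distr; ring.
  set S := sum_f_R0 _ _.
  have pE : (2 ^ n) ^ r = INR (2 ^ (r * n))%N by rewrite pow2_INR -pow_mult; congr pow; lia.
  rewrite pE.
  have q0 : 0 < INR (2 ^ (r * n))%N by rewrite pow2_INR; apply: pow_lt; lra.
  have -> : Rpower (2 ^ n) (INR r - eta) = INR (2 ^ (r * n))%N * th ^ n.
    have pn : 0 < 2 ^ n by apply: pow_lt; lra.
    rewrite Rpower_plus Rpower_pow // pE /th; congr Rmult.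
    by rewrite -(Rpower_pow n) -?(Rpower_pow n _ (Rpower_pos _ _)) ?Rpower_mult; [congr Rpower; ring|lra].
  rewrite /u => hh.
  have -> : INR (tau_box r k (2 ^ n)) * / INR (2 ^ (r * n))%N - S =
     / INR (2 ^ (r * n))%N * (INR (tau_box r k (2 ^ n)) - INR (2 ^ (r * n))%N * S) by field; lra.
  rewrite Rabs_mult Rabs_pos_eq; last by apply: Rlt_le; apply: Rinv_0_lt_compat.
  apply: (Rmult_le_reg_l (INR (2 ^ (r * n))%N)) => //.
  rewrite -Rmult_assoc Rinv_r; last lra.
  by rewrite Rmult_1_l; apply: (Rle_trans _ _ _ hh); apply: Req_le; ring.
have -> : d l = (d l * ln 2 ^ l) * (/ ln 2) ^ l.
  by rewrite pow_inv; field; apply: pow_nonzero; lra.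
by apply: geom_computable_mult => //; apply: geom_computable_pow; exact: geom_computable_inv_ln2.
Qed.

Lemma Rabs_lim_le (u : nat -> R) (a l B : R) N0 : is_lim_seq u l ->
  (forall N, (N0 <= N)%N -> Rabs (a - u N) <= B) -> Rabs (a - l) <= B.
Proof.
move=> hl h.
have h1 := is_lim_seq_abs _ _ (is_lim_seq_minus' _ _ _ _ (is_lim_seq_const a) hl).
apply: (is_lim_seq_le_loc _ (fun=> B) (Rabs (a - l)) B _ h1 (is_lim_seq_const B)).
by exists N0 => N hN; apply: h; lia.
Qed.

Theorem theorem1 (r k : nat) (hr : (2 <= r)%N) (hk : (3 <= k)%N) :
  exists d : nat -> R,
    (forall l : nat, (l <= r * (k - 1))%N -> computable_real (d l)) /\
    forall eps : R, (0 < eps) ->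
      exists K : R, forall x : R, (2 <= x) ->
        (Rabs (INR (tau_prod_sum r k x)
               - x ^ r * sum_f_R0 (fun l => d l * ln x ^ l) (r * (k - 1))%N)
         <= K * Rpower x (INR r - 1 + alpha k + eps)).
Proof.
have k0 : (0 < k)%N by lia.
have r0 : (0 < r)%N by lia.
have rp : 0 < INR r by apply: lt_0_INR; lia.
have [p hp] := main_term_poly k.-1; rewrite prednK // in hp.
pose P := mkseq p k.
have sP : size P = k by rewrite size_mkseq.
have mainP x : 0 < x -> main_term k x = log_poly P x.
  by move=> x0; rewrite hp // /log_poly -peval_mkseq prednK.
have [a0 ha] := alpha_spec k0 mainP.
have [a1|a1] := Rle_lt_dec 1 (alpha k).
  exists (fun=> 0); split.
    by move=> l _; apply: geom_computable_real; apply: geom_computable_rat; apply: (is_rat_nat 0).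
  move=> eps e0.
  have er : 0 < eps / INR r by apply: Rdiv_lt_0_compat.
  have [C [C0 hC]] := tau_sum_bound k er.
  exists (C ^ r) => x x2.
  rewrite sum_f_R0E big1; last by move=> i _; rewrite Rmult_0_l.
  rewrite Rmult_0_r Rminus_0_r Rabs_pos_eq; last exact: pos_INR.
  apply: (Rle_trans _ (INR (tau_sum k x) ^ r)).
    apply: (Rle_trans _ (INR (tau_sum k x ^ r)%N)); first by apply: le_INR; apply/leP; apply: tau_prod_sum_le.
    by apply: Req_le; elim: (r) => // n IH; rewrite expnS INRM IH.
  apply: (Rle_trans _ ((C * Rpower x (1 + eps / INR r)) ^ r)).
    by apply: pow_incr; split; [exact: pos_INR|apply: hC; lra].
  rewrite Rpow_mult_distr; apply: Rmult_le_compat_l; first by apply: pow_le; lra.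
  rewrite -(Rpower_pow r (Rpower x _)); last exact: Rpower_pos.
  rewrite Rpower_mult; apply: Rpower_le1; first lra.
  have -> : (1 + eps / INR r) * INR r = INR r + eps by field; lra.
  lra.
have [c hc] := @main_box_sum_limit r k P r0 sP k0.
have bound eps : 0 < eps -> exists K : R, forall x : R, 2 <= x ->
   Rabs (INR (tau_prod_sum r k x) - x ^ r * sum_f_R0 (fun l => c l * ln x ^ l) (r * (k - 1))%N)
         <= K * Rpower x (INR r - 1 + alpha k + eps).
  (* [eta] moves above the infimum, so that [alpha k + eta] is an admissible exponent; it stays
     below 1 and uses up at most half of [eps]. *)
  move=> e0; set eta := Rmin (eps / 2) ((1 - alpha k) / 2).
  have [h1 h2] : eta <= eps / 2 /\ eta <= (1 - alpha k) / 2 by split; [apply: Rmin_l|apply: Rmin_r].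
  have h3 : 0 < eta by apply: Rmin_pos; lra.
  have hdelta : 0 < alpha k + eta < 1 by lra.
  have [KD hKD] := Delta_bigO_global mainP hdelta (ha (alpha k + eta) ltac:(lra)).
  have [C hC] := @tau_prod_sum_error r k P _ KD r0 hdelta hKD (eps / 2) ltac:(lra).
  exists (Rabs C) => x x2.
  (* The bound holds for every [N >= floor x] with one constant, so it survives the limit in [N]. *)
  apply: (Rabs_lim_le (N0 := nat_floor x) (hc x ltac:(lra))) => N hN.
  apply: (Rle_trans _ _ _ (hC x N ltac:(lra) hN)).
  apply: (Rle_trans _ (Rabs C * Rpower x (INR r - 1 + (alpha k + eta) + eps / 2))).
    by apply: Rmult_le_compat_r; [exact: Rlt_le (Rpower_pos _ _)|exact: Rle_abs].
  by apply: Rmult_le_compat_l; [exact: Rabs_pos|apply: Rpower_le1; lra].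
exists c; split => //.
(* Half of the gap [1 - alpha k] is given away as [eps]; the other half remains as the power saving
   [eta] needed for computability. *)
have [C hC] := bound ((1 - alpha k) / 2) ltac:(lra).
apply: (@asymptotic_computable r k _ c C ((1 - alpha k) / 2)); first lra.
move=> x x2; apply: (Rle_trans _ _ _ (hC x x2)); apply: Req_le.
by congr (_ * Rpower _ _); lra.
Qed.
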